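(* Let $i\in I^{\mathrm{re}}$. For any $x\in U^+[i]$ and $y\in U^-[i]$, $$\{L''_{i,1}(x),L''_{i,1}(y)\}=\{x,y\}.$$
   Context: **Borcherds-Cartan datum.** $I$ is a finite or countably infinite set; $A=(a_{ij})_{i,j\in I}$ is an integer matrix with $a_{ii}\in\{2,0,-2,-4,\dots\}$, $a_{ij}\le 0$ for $i\ne j$, and there are $s_i\in\mathbb{Z}_{>0}$ with $s_ia_{ij}=s_ja_{ji}$. $I^{\mathrm{re}}=\{i: a_{ii}=2\}$, $I^{\mathrm{im}}=\{i:a_{ii}\le 0\}$, $I^\infty=(I^{\mathrm{re}}\times\{1\})\cup(I^{\mathrm{im}}\times\mathbb{Z}_{>0})$; for $i\in I^{\mathrm{re}}$ we write $i$ for $(i,1)$. $P^\vee=(\bigoplus_i\mathbb{Z}h_i)\oplus(\bigoplus_i\mathbb{Z}d_i)$, $\mathfrak h=\mathbb{Q}\otimes P^\vee$, $P=\{\lambda\in\mathfrak h^*:\lambda(P^\vee)\subseteq\mathbb{Z}\}$, and $\alpha_j\in P$ are the simple roots: $\alpha_j(h_i)=a_{ij}$, $\alpha_j(d_i)=\delta_{ij}$. $Q_+=\sum_i\mathbb{Z}_{\ge0}\alpha_i$. There is a symmetric bilinear form on $\mathfrak h^*$ with $(\alpha_i,\lambda)=s_i\lambda(h_i)$, so $(\alpha_i,\alpha_j)=s_ia_{ij}$. $q$ is an indeterminate, $q_i=q^{s_i}$, $q_{(i)}=q^{(\alpha_i,\alpha_i)/2}$; for $i\in I^{\mathrm{re}}$,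 $[n]_i=\frac{q_i^n-q_i^{-n}}{q_i-q_i^{-1}}$, $[n]_i!=\prod_{k=1}^n[k]_i$, and $x^{(n)}=x^n/[n]_i!$ for $x$ one of the generators indexed by $i$. **Form.** $\mathscr E$ is the free associative $\mathbb{Q}(q)$-algebra on $e_{il}$, $(i,l)\in I^\infty$, $Q_+$-graded by $|e_{il}|=l\alpha_i$; $\mathscr E\otimes\mathscr E$ has the multiplication $(x_1\otimes x_2)(y_1\otimes y_2)=q^{(|x_2|,|y_1|)}x_1y_1\otimes x_2y_2$; $\rho:\mathscr E\to\mathscr E\otimes\mathscr E$ is the algebra map $\rho(e_{il})=\sum_{m+n=l}q_{(i)}^{mn}e_{im}\otimes e_{in}$ ($e_{i0}=1$). Fix $\nu_{il}\in\mathbb{Q}(q)$, with $\nu_{il}\in 1+q^{-1}\mathbb{Z}_{\ge0}[[q^{-1}]]$, $(i,l)\in I^\infty$, and set $\nu_{i0}=1$. $\{\ ,\ \}$ is the symmetric bilinear form on $\mathscr E$ with $\{x,y\}=0$ if $|x|\ne|y|$, $\{1,1\}=1$, $\{e_{il},e_{il}\}=\nu_{il}$, $\{x,yz\}=\{\rho(x),y\otimes z\}$ (where $\{x_1\otimes x_2,y_1\otimes y_2\}=\{x_1,y_1\}\{x_2,y_2\}$). **Algebra.** $U=U_q(\mathfrak g)$ is the $\mathbb{Q}(q)$-algebra generated by $q^h$ ($h\in P^\vee$), $e_{il},f_{il}$ ($(i,l)\in I^\infty$) with relations: $q^0=1$, $q^hq^{h'}=q^{h+h'}$; $q^he_{jl}q^{-h}=q^{l\alpha_j(h)}e_{jl}$,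 $q^hf_{jl}q^{-h}=q^{-l\alpha_j(h)}f_{jl}$; $\sum_{r+s=1-la_{ij}}(-1)^re_i^{(r)}e_{jl}e_i^{(s)}=0=\sum_{r+s=1-la_{ij}}(-1)^rf_i^{(r)}f_{jl}f_i^{(s)}$ for $i\in I^{\mathrm{re}}$, $(j,l)\ne (i,1)$; $e_{ik}e_{jl}=e_{jl}e_{ik}$ and $f_{ik}f_{jl}=f_{jl}f_{ik}$ if $a_{ij}=0$; $e_{ik}f_{jl}=f_{jl}e_{ik}$ if $i\ne j$; and $\sum_{m+n=k,\,n+s=l}q_{(i)}^{n(m-s)}\nu_{in}K_i^{-n}f_{is}e_{im}=\sum_{m+n=k,\,n+s=l}q_{(i)}^{n(s-m)}\nu_{in}K_i^{n}e_{im}f_{is}$ for $(i,k),(i,l)\in I^\infty$, where $K_i=q_i^{h_i}$ (i.e. $q^{s_ih_i}$), $e_{i0}=f_{i0}=1$. $U^+$ (resp. $U^-$) is the subalgebra generated by the $e_{il}$ (resp. $f_{il}$). $U^+$ is the quotient of $\mathscr E$ by the radical of $\{\ ,\ \}$, so $\rho$ and $\{\ ,\ \}$ descend to $U^+$. $\omega$ is the involution of $U$ with $\omega(q^h)=q^{-h}$, $\omega(e_{il})=f_{il}$, $\omega(f_{il})=e_{il}$. For $x\in U^+$, $y\in U^-$ put $\{x,y\}=\{y,x\}:=\{x,\omega(y)\}$. **Primitive generators.** For $i\in I^{\mathrm{im}}$, $l\ge1$, $\mathtt a_{il}\in U^+_{l\alpha_i}$ is the unique element such that: the $\mathtt a_{il}$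 and the $e_{il}$ ($l\ge1$) generate the same algebra; $\{\mathtt a_{il},z\}=0$ for $z$ in the subalgebra generated by $e_{i1},\dots,e_{i,l-1}$; $\mathtt a_{il}-e_{il}$ lies in the subalgebra generated by $e_{ik}$, $k<l$; $\mathtt a_{il}$ is fixed by the bar involution ($q\mapsto q^{-1}$, $e_{jk}\mapsto e_{jk}$); $\rho(\mathtt a_{il})=\mathtt a_{il}\otimes1+1\otimes\mathtt a_{il}$. Put $\mathtt b_{il}=\omega(\mathtt a_{il})$. For $i\in I^{\mathrm{re}}$, $\mathtt a_i=\mathtt a_{i1}=e_{i1}$, $\mathtt b_i=\mathtt b_{i1}=f_{i1}$. $\tau_{il}=\{\mathtt a_{il},\mathtt a_{il}\}$, $\tau_i=\tau_{i1}$ for $i\in I^{\mathrm{re}}$. For $i\in I^{\mathrm{re}}$, $\mathtt B_i=\mathtt b_i/(\tau_i(q_i^{-1}-q_i))$. **Symmetry.** For $i\in I^{\mathrm{re}}$, $L''_{i,1}$ is the algebra automorphism of $U$ with, for $(j,l)\in I^\infty$, $(j,l)\ne(i,1)$: $L''_{i,1}(\mathtt a_i)=-\mathtt B_iK_i$, $L''_{i,1}(\mathtt B_i)=-K_i^{-1}\mathtt a_i$, $L''_{i,1}(\mathtt a_{jl})=\sum_{r+s=-la_{ij}}(-1)^rq_i^{-r}\mathtt a_i^{(s)}\mathtt a_{jl}\mathtt a_i^{(r)}$, $L''_{i,1}(\mathtt b_{jl})=\sum_{r+s=-la_{ij}}(-1)^rq_i^{r}\mathtt B_i^{(r)}\mathtt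 b_{jl}\mathtt B_i^{(s)}$, $L''_{i,1}(q^h)=q^{h-\alpha_i(h)h_i}$. **Subalgebras.** For $i\in I^{\mathrm{re}}$, $(j,l)\in I^\infty$, $(j,l)\ne(i,1)$, $m\in\mathbb{Z}$ (zero for $m<0$) put $f(i,(j,l),m)=\sum_{k=0}^m(-1)^kq_i^{k(la_{ij}+m-1)}\mathtt a_i^{(k)}\mathtt a_{jl}\mathtt a_i^{(m-k)}$ and $g(i,(j,l),m)=\sum_{k=0}^m(-1)^kq_i^{k(-la_{ij}-m+1)}\mathtt B_i^{(m-k)}\mathtt b_{jl}\mathtt B_i^{(k)}$. $U^+[i]$ (resp. $U^-[i]$) is the subalgebra of $U$ generated by all $f(i,(j,l),m)$ (resp. all $g(i,(j,l),m)$), $(j,l)\ne(i,1)$, $m\in\mathbb{Z}$. One has $L''_{i,1}(U^\pm[i])\subseteq U^\pm$, so the left side of the claim is defined. *)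

(* Defs.v *)
From HB Require Import structures.
From mathcomp Require Import all_boot all_order all_algebra.
From mathcomp Require Import generic_quotient fraction finmap boolp.
From mathcomp.multinomials Require Import monalg.

Set Implicit Arguments.
Unset Strict Implicit.
Unset Printing Implicit Defensive.

Import GRing.Theory Num.Theory.

Local Open Scope ring_scope.
Local Open Scope quotient_scope.

(* Locked, so that unification never unfolds the fraction field. *)
HB.lock Definition Qq : fieldType := {fraction {poly rat}}.

(* The inclusion of Q[q] into Q(q), transported along the locking equation. *)
Definition ofpoly : {rmorphism {poly rat} -> Qq} :=
  eq_rect_r (fun F : fieldType => {rmorphism {poly rat} -> F})
    (@FracField.tofrac {poly rat}) Qq.unlock.

Definition qq : Qq := ofpoly 'X.

Lemma fraction_repr (x : {fraction {poly rat}}) :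
  x = FracField.tofrac (frac (repr x)).1 / FracField.tofrac (frac (repr x)).2.
Proof.
rewrite -{1}[x]reprK; move: (repr x) => r.
have d0 := denom_ratioP r.
apply: (mulIf (x := FracField.tofrac (frac r).2)); first by rewrite tofrac_eq0.
rewrite divfK ?tofrac_eq0 //; unlock FracField.tofrac.
rewrite -[LHS]FracField.pi_mul; apply/eqmodP; rewrite /= FracField.equivfE.
by rewrite /FracField.mulf !numden_Ratio ?oner_eq0 ?mulr1 ?mulf_neq0 // mulrC.
Qed.

Lemma Qq_fracP (x : Qq) :
  exists2 pd : {poly rat} * {poly rat}, pd.2 != 0 & x = ofpoly pd.1 / ofpoly pd.2.
Proof.
suff H (F : fieldType) (e : F = {fraction {poly rat}} :> fieldType) (y : F)
    (f := eq_rect_r (fun F : fieldType => {rmorphism {poly rat} -> F})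
            (@FracField.tofrac {poly rat}) e) :
  exists2 pd : {poly rat} * {poly rat}, pd.2 != 0 & y = f pd.1 / f pd.2.
  exact: H.
rewrite {}/f; subst F; exists (frac (repr y)); first exact: denom_ratioP.
exact: fraction_repr.
Qed.

(* x lies in q^(-N) Q[[q^-1]]: its degree, as a rational function of q, is at
   most -N. *)
Definition order_at_infty_ge (N : nat) (x : Qq) : Prop :=
  exists p d : {poly rat}, [/\ d != 0, (size p + N <= size d)%N &
    x = ofpoly p / ofpoly d].

(* x lies in 1 + q^-1 Z_{>=0}[[q^-1]], where Q(q) is embedded in Q((q^-1)). *)
Definition admissible (x : Qq) : Prop :=
  exists2 c : nat -> nat, c 0%N = 1%N &
    forall N : nat,
      order_at_infty_ge N (x - \sum_(n < N) (c n)%:R * qq ^- n).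

(* The field automorphism q |-> q^-1 of Q(q), computed on any expression of x
   as a quotient of polynomials. *)
Definition subst_qV (p : {poly rat}) : Qq :=
  (map_poly (fun c : rat => ofpoly c%:P) p).[qq^-1].

Definition barQ (x : Qq) : Qq :=
  let pd := s2val (cid2 (Qq_fracP x)) in subst_qV pd.1 / subst_qV pd.2.

(* The free monoid on X; conversion is much faster on it than on {fmonom X}. *)
Lemma cat_eq_nil (X : choiceType) (u v : seq X) :
  u ++ v = [::] -> u = [::] /\ v = [::].
Proof. by case: u. Qed.

HB.instance Definition _ (X : choiceType) :=
  Choice_isMonomialDef.Build (seq X) (@catA X) (@cat0s X) (@cats0 X)
    (@cat_eq_nil X).

Notation freealg X := {malg Qq[seq X]}.

HB.lock Definition gen (X : choiceType) (x : X) : freealg X := << [:: x] >>.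
Canonical gen_unlockable := Unlockable gen.unlock.

Definition evalfree (X : choiceType) (A : lalgType Qq) (f : X -> A)
    (x : freealg X) : A :=
  \sum_(w <- msupp x) x@_w *: \prod_(g <- w) f g.

Inductive subalg (A : lalgType Qq) (S : A -> Prop) : A -> Prop :=
| subalg_gen x : S x -> subalg S x
| subalg_one : subalg S 1
| subalg_scale c x : subalg S x -> subalg S (c *: x)
| subalg_add x y : subalg S x -> subalg S y -> subalg S (x + y)
| subalg_mul x y : subalg S x -> subalg S y -> subalg S (x * y).

(* The two-sided ideal generated by the differences x - y with R x y. *)
Inductive relideal (X : choiceType) (R : freealg X -> freealg X -> Prop) :
  freealg X -> Prop :=
| relideal_rel x y : R x y -> relideal R (x - y)
| relideal_zero : relideal R 0
| relideal_add x y : relideal R x -> relideal R y -> relideal R (x + y)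
| relideal_mull z x : relideal R x -> relideal R (z * x)
| relideal_mulr z x : relideal R x -> relideal R (x * z).

Record relations (X : choiceType) := Relations {
  rel_of :> freealg X -> freealg X -> Prop;
  rel_proper : ~ relideal rel_of 1
}.

Section Presentation.
Variables (X : choiceType) (R : relations X).

Let relideal := (relideal R).

Definition relequiv (x y : freealg X) : bool := `[< relideal (x - y) >].

Lemma relequivP x y : reflect (relideal (x - y)) (relequiv x y).
Proof. exact: asboolP. Qed.

Lemma relideal_opp x : relideal x -> relideal (- x).
Proof. by move=> hx; rewrite -mulN1r; apply: relideal_mull. Qed.

Lemma relequiv_is_equiv : equiv_class_of relequiv.
Proof.
split=> [x|x y|y x z].
- by apply/relequivP; rewrite subrr; apply: relideal_zero.
- by apply/relequivP/relequivP => h; rewrite -opprB; apply: relideal_opp.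
- move=> /relequivP h1 /relequivP h2; apply/relequivP.
  by rewrite -[x](addrNK y) -addrA; apply: relideal_add.
Qed.

Canonical relequiv_equiv := EquivRelPack relequiv_is_equiv.
Canonical relequiv_encModRel := defaultEncModRel relequiv.

(* The algebra with generators X and relations x = y for all R x y. *)
Definition presented := {eq_quot relequiv}.

HB.instance Definition _ : EqQuotient (freealg X) relequiv presented :=
  EqQuotient.on presented.
HB.instance Definition _ := Choice.on presented.

Fact presented_key : unit. Proof. by []. Qed.

Definition presented_pi : freealg X -> presented :=
  locked_with presented_key (fun x => \pi_presented x).
Canonical presented_pi_unlockable := [unlockable fun presented_pi].

Let pr := presented_pi.
Let rp (u : presented) : freealg X := repr u.

Lemma presented_piK u : pr (rp u) = u.
Proof. by rewrite /pr [presented_pi]unlock; exact: reprK. Qed.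

Lemma presented_piP x y : pr x = pr y <-> relideal (x - y).
Proof.
rewrite /pr [presented_pi]unlock; split=> [/eqP|h].
  by rewrite eqmodE => /relequivP.
by apply/eqP; rewrite eqmodE; apply/relequivP.
Qed.

Lemma rpK x : relideal (rp (pr x) - x).
Proof. by apply/presented_piP; rewrite presented_piK. Qed.

(* Locked, so that unification in U never unfolds the operations. *)
Definition padd := locked_with presented_key (fun u v => pr (rp u + rp v)).
Definition popp := locked_with presented_key (fun u => pr (- rp u)).
Definition pmul := locked_with presented_key (fun u v => pr (rp u * rp v)).
Definition pscale :=
  locked_with presented_key (fun (c : Qq) u => pr (c *: rp u)).
Canonical padd_unlockable := [unlockable fun padd].
Canonical popp_unlockable := [unlockable fun popp].
Canonical pmul_unlockable := [unlockable fun pmul].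
Canonical pscale_unlockable := [unlockable fun pscale].

Lemma pi_addE x y : padd (pr x) (pr y) = pr (x + y).
Proof.
rewrite [padd]unlock; apply/presented_piP; rewrite opprD addrACA.
apply: relideal_add; exact: rpK.
Qed.

Lemma pi_oppE x : popp (pr x) = pr (- x).
Proof.
rewrite [popp]unlock; apply/presented_piP; rewrite -opprD; apply: relideal_opp; exact: rpK.
Qed.

Lemma pi_mulE x y : pmul (pr x) (pr y) = pr (x * y).
Proof.
rewrite [pmul]unlock; apply/presented_piP.
have -> : rp (pr x) * rp (pr y) - x * y =
    (rp (pr x) - x) * rp (pr y) + x * (rp (pr y) - y).
  by rewrite mulrBl mulrBr addrA subrK.
by apply: relideal_add; [apply: relideal_mulr|apply: relideal_mull]; exact: rpK.
Qed.

Lemma pi_scaleE c x : pscale c (pr x) = pr (c *: x).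
Proof.
rewrite [pscale]unlock; apply/presented_piP; rewrite -scalerBr -mul_malgC.
by apply: relideal_mull; exact: rpK.
Qed.

Ltac lift u := rewrite -(presented_piK u).

Lemma paddA : associative padd.
Proof. by move=> u v w; lift u; lift v; lift w; rewrite !pi_addE addrA. Qed.
Lemma paddC : commutative padd.
Proof. by move=> u v; lift u; lift v; rewrite !pi_addE addrC. Qed.
Lemma padd0 : left_id (pr 0) padd.
Proof. by move=> u; lift u; rewrite pi_addE add0r. Qed.
Lemma paddN : left_inverse (pr 0) popp padd.
Proof. by move=> u; lift u; rewrite pi_oppE pi_addE addNr. Qed.

HB.instance Definition _ := GRing.isZmodule.Build presented
  paddA paddC padd0 paddN.

Lemma pmulA : associative pmul.
Proof. by move=> u v w; lift u; lift v; lift w; rewrite !pi_mulE mulrA. Qed.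
Lemma pmul1l : left_id (pr 1) pmul.
Proof. by move=> u; lift u; rewrite pi_mulE mul1r. Qed.
Lemma pmul1r : right_id (pr 1) pmul.
Proof. by move=> u; lift u; rewrite pi_mulE mulr1. Qed.
Lemma pmulDl : left_distributive pmul padd.
Proof.
by move=> u v w; lift u; lift v; lift w; rewrite !(pi_addE, pi_mulE) mulrDl.
Qed.
Lemma pmulDr : right_distributive pmul padd.
Proof.
by move=> u v w; lift u; lift v; lift w; rewrite !(pi_addE, pi_mulE) mulrDr.
Qed.

Lemma pone_neq0 : pr 1 != 0.
Proof.
apply/eqP => /presented_piP; rewrite subr0; exact: rel_proper.
Qed.

HB.instance Definition _ := GRing.Zmodule_isNzRing.Build presented
  pmulA pmul1l pmul1r pmulDl pmulDr pone_neq0.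

Lemma pscaleA a b u : pscale a (pscale b u) = pscale (a * b) u.
Proof. by lift u; rewrite !pi_scaleE scalerA. Qed.
Lemma pscale1 : left_id 1 pscale.
Proof. by move=> u; lift u; rewrite pi_scaleE scale1r. Qed.
Lemma pscaleDr : right_distributive pscale +%R.
Proof.
move=> c u v; rewrite -[u + v]/(padd u v) -[RHS]/(padd _ _).
by lift u; lift v; rewrite !(pi_scaleE, pi_addE) scalerDr.
Qed.
Lemma pscaleDl u : {morph pscale^~ u : a b / a + b}.
Proof.
move=> a b /=; rewrite -[RHS]/(padd _ _).
by lift u; rewrite !(pi_scaleE, pi_addE) scalerDl.
Qed.

HB.instance Definition _ := GRing.Zmodule_isLmodule.Build Qq presented
  pscaleA pscale1 pscaleDr pscaleDl.

Lemma pscaleAl (c : Qq) (u v : presented) : c *: (u * v) = (c *: u) * v.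
Proof.
rewrite -[LHS]/(pscale c (pmul u v)) -[RHS]/(pmul (pscale c u) v).
by lift u; lift v; rewrite !(pi_scaleE, pi_mulE) scalerAl.
Qed.

HB.instance Definition _ := GRing.Lmodule_isLalgebra.Build Qq presented
  pscaleAl.

Lemma free_scaleAr (c : Qq) (x y : freealg X) : c *: (x * y) = x * (c *: y).
Proof.
rewrite (monalgE x) mulr_suml scaler_sumr mulr_suml.
apply: eq_bigr => k _; rewrite (monalgE y) mulr_sumr !scaler_sumr mulr_sumr.
apply: eq_bigr => l _.
have scU (z : Qq) (w : seq X) : c *: << z *g w >> = << c * z *g w >>.
  by apply/malgP => v; rewrite mcoeffZ !mcoeffU mulrnAr.
have mulUU (z1 z2 : Qq) (w1 w2 : seq X) :
    << z1 *g w1 >> * << z2 *g w2 >> = << z1 * z2 *g w1 ++ w2 >>.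
  exact: fgmulUU.
by rewrite mulUU !scU mulUU mulrCA.
Qed.

Lemma pscaleAr (c : Qq) (u v : presented) : c *: (u * v) = u * (c *: v).
Proof.
rewrite -[LHS]/(pscale c (pmul u v)) -[RHS]/(pmul u (pscale c v)).
by lift u; lift v; rewrite !(pi_scaleE, pi_mulE) free_scaleAr.
Qed.

HB.instance Definition _ := GRing.Lalgebra_isAlgebra.Build Qq presented
  pscaleAr.

End Presentation.

Record BCdatum (I : countType) := BCDatum {
  cartan : I -> I -> int;
  symm : I -> nat;
  cartan_diag : forall i,
    cartan i i = 2 \/ (cartan i i <= 0 /\ (2 %| cartan i i)%Z);
  cartan_off : forall i j, i != j -> cartan i j <= 0;
  symm_gt0 : forall i, (0 < symm i)%N;
  symm_cartan : forall i j,
    (symm i)%:Z * cartan i j = (symm j)%:Z * cartan j i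
}.

Section Datum.
Variables (I : countType) (D : BCdatum I).
Let a := cartan D.

Definition is_re (i : I) : bool := a i i == 2.

Definition in_Iinf (p : I * nat) : bool :=
  (0 < p.2)%N && (is_re p.1 ==> (p.2 == 1%N)).

Definition Iinf : choiceType := {p : I * nat | in_Iinf p}.

Definition idx (g : Iinf) : I := (val g).1.
Definition lev (g : Iinf) : nat := (val g).2.

(* Convention f_{i0} = 1 for a family f indexed by I^infty; the value 0 at the
   remaining pairs outside I^infty is never used. *)
Definition ext (A : pzRingType) (f : Iinf -> A) (i : I) (l : nat) : A :=
  if l == 0%N then 1 else if insub (i, l) is Some g then f g else 0.

(* (sum_i m_i h_i, sum_i n_i d_i) *)
Definition coweight := ({malg int[I]} * {malg int[I]})%type.

Definition coroot (m : int) (i : I) : coweight := (<< m *g i >>, 0).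

Definition alpha (j : I) (h : coweight) : int :=
  \sum_(i <- msupp h.1) h.1@_i * a i j + h.2@_j.

Definition Qlattice := {malg int[I]}.

Definition rootform (b c : Qlattice) : int :=
  \sum_(i <- msupp b) \sum_(j <- msupp c) b@_i * c@_j * ((symm D i)%:Z * a i j).

Definition qi (i : I) : Qq := qq ^+ symm D i.

(* s_i a_ii is even, so the quotient is exactly (alpha_i, alpha_i) / 2. *)
Definition qpar (i : I) : Qq := qq ^ (((symm D i)%:Z * a i i) %/ 2)%Z.

Definition qint (i : I) (n : nat) : Qq :=
  (qi i ^+ n - qi i ^- n) / (qi i - (qi i)^-1).

Definition qfact (i : I) (n : nat) : Qq := \prod_(1 <= k < n.+1) qint i k.

Definition dpow (A : lalgType Qq) (i : I) (x : A) (n : nat) : A :=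
  (qfact i n)^-1 *: x ^+ n.

Local Notation word := (seq Iinf).
Local Notation E := (freealg Iinf).

Definition wdeg (w : word) : Qlattice :=
  \sum_(g <- w) << (lev g)%:Z *g idx g >>.

Definition homog (b : Qlattice) (x : E) : Prop :=
  forall w, w \in msupp x -> wdeg w = b.

Definition EE := {malg Qq[(word * word)%type]}.

Definition tens (x y : E) : EE :=
  \sum_(u <- msupp x) \sum_(v <- msupp y) << x@_u * y@_v *g (u, v) >>.

Definition tmul (S T : EE) : EE :=
  \sum_(u <- msupp S) \sum_(v <- msupp T)
    << qq ^ rootform (wdeg u.2) (wdeg v.1) * (S@_u * T@_v)
       *g (u.1 ++ v.1, u.2 ++ v.2) >>.

Definition rho_gen (g : Iinf) : EE :=
  \sum_(m < (lev g).+1)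
    qpar (idx g) ^+ (m * (lev g - m)) *:
      tens (ext (@gen Iinf) (idx g) m) (ext (@gen Iinf) (idx g) (lev g - m)).

(* rho is the algebra map extending rho_gen, for the twisted product tmul. *)
Definition rho_word (w : word) : EE :=
  foldr (fun g T => tmul (rho_gen g) T) (tens 1 1) w.

Definition rho (x : E) : EE := \sum_(w <- msupp x) x@_w *: rho_word w.

Definition tens_form (B : E -> E -> Qq) (S T : EE) : Qq :=
  \sum_(u <- msupp S) \sum_(v <- msupp T)
    S@_u * T@_v * (B << u.1 >> << v.1 >> * B << u.2 >> << v.2 >>).

Record is_form (nu : Iinf -> Qq) (B : E -> E -> Qq) : Prop := IsForm {
  form_linear : forall c x y z, B (c *: x + y) z = c * B x z + B y z;
  form_sym : forall x y, B x y = B y x;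
  form_orth : forall b c x y, homog b x -> homog c y -> b <> c -> B x y = 0;
  form_one : B 1 1 = 1;
  form_gen : forall g, B (gen g) (gen g) = nu g;
  form_mul : forall x y z, B x (y * z) = tens_form B (rho x) (tens y z)
}.

Definition barE (x : E) : E := \sum_(w <- msupp x) << barQ x@_w *g w >>.

End Datum.

Section QuantumGroup.
Variables (I : countType) (D : BCdatum I) (nu : Iinf D -> Qq).
Let a := cartan D.

Local Notation E := (freealg (Iinf D)).

Definition Ugens : choiceType := (coweight I + (Iinf D + Iinf D))%type.

Definition genq (h : coweight I) : freealg Ugens := gen (inl h : Ugens).
Definition gene (g : Iinf D) : freealg Ugens := gen (inr (inl g) : Ugens).
Definition genf (g : Iinf D) : freealg Ugens := gen (inr (inr g) : Ugens).

(* K_i^n *)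
Definition genK (i : I) (n : int) : freealg Ugens :=
  genq (coroot ((symm D i)%:Z * n) i).

Definition serre (x : Iinf D -> freealg Ugens) (i : I) (g : Iinf D) :
    freealg Ugens :=
  let N := absz (1 - (lev g)%:Z * a i (idx g))%R in
  \sum_(r < N.+1)
    (-1) ^+ r *: (dpow D i (ext x i 1) r * x g * dpow D i (ext x i 1) (N - r)).

Inductive Urel : freealg Ugens -> freealg Ugens -> Prop :=
| Urel_q0 : Urel (genq 0) 1
| Urel_qD h h' : Urel (genq h * genq h') (genq (h + h'))
| Urel_qe h g : Urel (genq h * gene g * genq (- h))
    (qq ^ ((lev g)%:Z * alpha D (idx g) h) *: gene g)
| Urel_qf h g : Urel (genq h * genf g * genq (- h))
    (qq ^ (- ((lev g)%:Z * alpha D (idx g) h)) *: genf g)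
| Urel_serre_e i g : is_re D i -> val g != (i, 1%N) -> Urel (serre gene i g) 0
| Urel_serre_f i g : is_re D i -> val g != (i, 1%N) -> Urel (serre genf i g) 0
| Urel_ee g g' : a (idx g) (idx g') = 0 ->
    Urel (gene g * gene g') (gene g' * gene g)
| Urel_ff g g' : a (idx g) (idx g') = 0 ->
    Urel (genf g * genf g') (genf g' * genf g)
| Urel_ef g g' : idx g != idx g' -> Urel (gene g * genf g') (genf g' * gene g)
| Urel_ef_same i k l : in_Iinf D (i, k) -> in_Iinf D (i, l) ->
    Urel
      (\sum_(n < (minn k l).+1)
        (qpar D i ^ (n%:Z * ((k - n)%N%:Z - (l - n)%N%:Z)) * ext nu i n) *:
          (genK i (- n%:Z) * ext genf i (l - n) * ext gene i (k - n)))
      (\sum_(n < (minn k l).+1)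
        (qpar D i ^ (n%:Z * ((l - n)%N%:Z - (k - n)%N%:Z)) * ext nu i n) *:
          (genK i n%:Z * ext gene i (k - n) * ext genf i (l - n))).

(* The trivial character q^h |-> 1, e_il, f_il |-> 0 shows that U is nonzero. *)
Definition triv_word (w : seq Ugens) : Qq :=
  \prod_(g <- w) (if g is inl _ then 1 else 0).

Lemma triv_word_mmorphism : mmorphism triv_word.
Proof.
split; last by rewrite /triv_word big_nil.
by move=> u v; rewrite /triv_word big_cat.
Qed.

HB.instance Definition _ := isMultiplicative.Build _ _ triv_word
  triv_word_mmorphism.

Definition triv : freealg Ugens -> Qq := mmap (@idfun Qq) triv_word.

Lemma triv0 : triv 0 = 0. Proof. exact: rmorph0. Qed.
Lemma triv1 : triv 1 = 1. Proof. exact: rmorph1. Qed.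
Lemma trivD : {morph triv : x y / x + y}.
Proof. exact: rmorphD. Qed.
Lemma trivB : {morph triv : x y / x - y}.
Proof. exact: rmorphB. Qed.
Lemma trivM : {morph triv : x y / x * y}.
Proof. exact: rmorphM. Qed.
Lemma trivC x y : triv (x * y) = triv (y * x).
Proof. by rewrite !trivM mulrC. Qed.
Lemma trivZ c x : triv (c *: x) = c * triv x.
Proof. by rewrite -mul_malgC trivM /triv mmapC. Qed.

Lemma triv_sum n (c : 'I_n -> Qq) (x : 'I_n -> freealg Ugens) :
  triv (\sum_(r < n) c r *: x r) = \sum_(r < n) c r * triv (x r).
Proof.
by rewrite (big_morph triv trivD triv0); apply: eq_bigr => r _; exact: trivZ.
Qed.

Lemma trivM3 x y z : triv (x * y * z) = triv x * triv y * triv z.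
Proof. by rewrite (trivM (x * y)) (trivM x). Qed.

Lemma triv_gen g : triv (gen g) = if g is inl _ then 1 else 0.
Proof. by rewrite /triv [gen]unlock mmapU mul1r /triv_word big_seq1. Qed.

Lemma triv_ext (x : Iinf D -> freealg Ugens) i n :
  (forall g, triv (x g) = 0) -> triv (ext x i n) = (n == 0%N)%:R.
Proof.
move=> x0; rewrite /ext; case: eqP => _; first exact: triv1.
by case: insub => [g|]; [exact: x0|exact: triv0].
Qed.

Lemma triv_genq h : triv (genq h) = 1. Proof. exact: triv_gen. Qed.
Lemma triv_gene g : triv (gene g) = 0. Proof. exact: triv_gen. Qed.
Lemma triv_genf g : triv (genf g) = 0. Proof. exact: triv_gen. Qed.

Lemma triv_serre x i g : (forall g', triv (x g') = 0) -> triv (serre x i g) = 0.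
Proof.
move=> x0; rewrite /serre triv_sum big1 // => r _.
by rewrite trivM3 x0 mulr0 mul0r mulr0.
Qed.

Lemma triv_rel x y : Urel x y -> triv x = triv y.
Proof.
case=> {x y}.
- by rewrite triv_genq triv1.
- by move=> h h'; rewrite (trivM (genq h) (genq h')) !triv_genq mulr1.
- by move=> h g; rewrite trivZ trivM3 triv_gene mulr0 mul0r mulr0.
- by move=> h g; rewrite trivZ trivM3 triv_genf mulr0 mul0r mulr0.
- by move=> i g _ _; rewrite (triv_serre i g triv_gene) triv0.
- by move=> i g _ _; rewrite (triv_serre i g triv_genf) triv0.
- by move=> g g' _; exact: trivC.
- by move=> g g' _; exact: trivC.
- by move=> g g' _; exact: trivC.
- move=> i k l _ _; apply: etrans (triv_sum _ _) (esym _).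
  apply: etrans (triv_sum _ _) _; apply: eq_bigr => n _.
  rewrite 2!trivM3 2!triv_genq 2!mul1r.
  rewrite (triv_ext i (k - n) triv_gene) (triv_ext i (l - n) triv_genf).
  case: (_ =P 0%N) => [->|_]; last by rewrite !mulr0 ?mul0r ?mulr0.
  by case: (_ =P 0%N) => [->|_]; rewrite ?mulr0 ?mul0r ?mulr0.
Qed.

Lemma triv_ideal x : relideal Urel x -> triv x = 0.
Proof.
elim=> {x} [x y /triv_rel xy||x y _ x0 _ y0|z x _ x0|z x _ x0].
- by rewrite trivB xy subrr.
- exact: triv0.
- by rewrite trivD x0 y0 addr0.
- by rewrite trivM x0 mulr0.
- by rewrite trivM x0 mul0r.
Qed.

Lemma Urel_proper : ~ relideal Urel 1.
Proof. by move/triv_ideal/eqP; rewrite triv1 oner_eq0. Qed.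

Definition Urelations : relations Ugens := Relations Urel_proper.

Definition Uq : algType Qq := presented Urelations.

Definition qU (h : coweight I) : Uq := presented_pi Urelations (genq h).
Definition eU (g : Iinf D) : Uq := presented_pi Urelations (gene g).
Definition fU (g : Iinf D) : Uq := presented_pi Urelations (genf g).
Definition KU (i : I) (n : int) : Uq := qU (coroot ((symm D i)%:Z * n) i).

(* The canonical surjection from E onto the subalgebra U^+ of U. *)
Definition piU (x : E) : Uq := evalfree eU x.

(* BU restricts on U^+ to the form induced by B; its values outside U^+ are
   arbitrary. *)
Definition is_descended_form (B : E -> E -> Qq) (BU : Uq -> Uq -> Qq) : Prop :=
  forall x y : E, BU (piU x) (piU y) = B x y.

Record is_omega (w : {lrmorphism Uq -> Uq}) : Prop := IsOmega {
  omega_invol : involutive w;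
  omega_q : forall h, w (qU h) = qU (- h);
  omega_e : forall g, w (eU g) = fU g;
  omega_f : forall g, w (fU g) = eU g
}.

Definition Uplus_homog (b : Qlattice I) (x : Uq) : Prop :=
  exists2 X : E, homog b X & piU X = x.

(* The bar involution of U^+ is induced by barE. *)
Definition Uplus_bar_fixed (x : Uq) : Prop :=
  exists2 X : E, piU X = x & piU (barE X) = x.

(* T vanishes in U^+ (x) U^+, i.e. T lies in ker (x) E + E (x) ker, with ker
   the kernel of E -> U^+. *)
Definition tens_null (T : EE D) : Prop :=
  exists2 s : seq (E * E), T = \sum_(p <- s) tens p.1 p.2 &
    {in s, forall p, piU p.1 = 0 \/ piU p.2 = 0}.

(* rho(x) = x (x) 1 + 1 (x) x in U^+ (x) U^+ *)
Definition Uplus_primitive (x : Uq) : Prop :=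
  exists2 X : E, piU X = x & tens_null (rho X - (tens X 1 + tens 1 X)).

Record is_prim_gens (BU : Uq -> Uq -> Qq) (aa : Iinf D -> Uq) : Prop :=
  IsPrimGens {
  prim_re : forall g, is_re D (idx g) -> aa g = eU g;
  prim_homog : forall g, ~~ is_re D (idx g) ->
    Uplus_homog << (lev g)%:Z *g idx g >> (aa g);
  prim_same_alg : forall i, ~~ is_re D i -> forall x : Uq,
    subalg (fun z => exists2 g, idx g = i & z = aa g) x <->
    subalg (fun z => exists2 g, idx g = i & z = eU g) x;
  prim_orth : forall g, ~~ is_re D (idx g) -> forall z : Uq,
    subalg (fun u => exists g',
      [/\ idx g' = idx g, (lev g' < lev g)%N & u = eU g']) z ->
    BU (aa g) z = 0;
  prim_lower : forall g, ~~ is_re D (idx g) ->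
    subalg (fun u => exists g',
      [/\ idx g' = idx g, (lev g' < lev g)%N & u = eU g']) (aa g - eU g);
  prim_bar : forall g, ~~ is_re D (idx g) -> Uplus_bar_fixed (aa g);
  prim_rho : forall g, ~~ is_re D (idx g) -> Uplus_primitive (aa g)
}.

Section Symmetry.
Variables (BU : Uq -> Uq -> Qq) (w : Uq -> Uq) (aa : Iinf D -> Uq) (i : I).

Definition bb (g : Iinf D) : Uq := w (aa g).

Definition tau : Qq := BU (ext aa i 1) (ext aa i 1).

(* B_i *)
Definition bigB : Uq := (tau * ((qi D i)^-1 - qi D i))^-1 *: ext bb i 1.

(* L is L''_{i,1} *)
Record is_L2 (L : {lrmorphism Uq -> Uq}) : Prop := IsL2 {
  L2_bij : bijective L;
  L2_a : L (ext aa i 1) = - (bigB * KU i 1);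
  L2_B : L bigB = - (KU i (-1) * ext aa i 1);
  L2_aa : forall g, val g != (i, 1%N) ->
    let N := absz (- ((lev g)%:Z * a i (idx g)))%R in
    L (aa g) = \sum_(r < N.+1)
      ((-1) ^+ r * qi D i ^- r) *:
        (dpow D i (ext aa i 1) (N - r) * aa g * dpow D i (ext aa i 1) r);
  L2_bb : forall g, val g != (i, 1%N) ->
    let N := absz (- ((lev g)%:Z * a i (idx g)))%R in
    L (bb g) = \sum_(r < N.+1)
      ((-1) ^+ r * qi D i ^+ r) *:
        (dpow D i bigB r * bb g * dpow D i bigB (N - r));
  L2_q : forall h, L (qU h) = qU (h - coroot (alpha D i h) i)
}.

Definition fI (g : Iinf D) (m : int) : Uq :=
  if m is Posz n then
    \sum_(k < n.+1)
      ((-1) ^+ k *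
        qi D i ^ (k%:Z * ((lev g)%:Z * a i (idx g) + n%:Z - 1))) *:
        (dpow D i (ext aa i 1) k * aa g * dpow D i (ext aa i 1) (n - k))
  else 0.

Definition gI (g : Iinf D) (m : int) : Uq :=
  if m is Posz n then
    \sum_(k < n.+1)
      ((-1) ^+ k *
        qi D i ^ (k%:Z * (- ((lev g)%:Z * a i (idx g)) - n%:Z + 1))) *:
        (dpow D i bigB (n - k) * bb g * dpow D i bigB k)
  else 0.

Definition UplusI : Uq -> Prop :=
  subalg (fun u => exists g m, val g != (i, 1%N) /\ u = fI g m).

Definition UminusI : Uq -> Prop :=
  subalg (fun u => exists g m, val g != (i, 1%N) /\ u = gI g m).

End Symmetry.

End QuantumGroup.

(* Main.v *)
(** Write e = a_i and <b> = <b, alpha_i^vee>. For another generator a = a_jl of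
    weight d, with N = -<d> = - l a_ij, let
      F_0 = G_0 = a,  F_(m+1) = F_m e - q_i^<F_m> e F_m,
      G_(k+1) = e G_k - q_i^<G_k> G_k e.
    Then F_m = [m]! f(i,(j,l),m), and since [B_i, G_k] is a multiple of
    G_(k-1) K_i^-1, the element L''(F_m) is a multiple of G_(N-m); by injectivity
    of L'', F_(N+1) = G_(N+1) = 0.

    Multiplication by a primitive element p has an adjoint for the form, which is
    a skew derivation. On U^+[i] the adjoint of left multiplication by e vanishes,
    on L''(U^+[i]) that of right multiplication by e does. On generators, hence
    everywhere, L'' turns the q-commutator with e on the right into the adjoint of
    left multiplication by e, the adjoint of right multiplication by e into the
    q-commutator with e on the left, and the adjoint of right multiplication by a
    into that of right multiplication by e^N a, all up to scalars. As
    {x' G_N, y'} = {x' e^N a, y'} on L''(U^+[i]), the form can be evaluated on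
    products of the F_m in parallel on both sides, and for x of weight b
      {L'' x, L'' y} = kappa^-<b> {x, y},  kappa = {e, e} (1 - q_i^-2),
    where both arguments are in U^+[i]. Finally omega L'' omega = kappa^<b> L'' in
    weight b of U^+[i], by the normalization of B_i. *)

Require Import Defs.
From HB Require Import structures.
From mathcomp Require Import all_boot all_order all_algebra.
From mathcomp Require Import finmap ring zify.
From mathcomp.multinomials Require Import monalg.

Set Implicit Arguments.
Unset Strict Implicit.
Unset Printing Implicit Defensive.

Import GRing.Theory Num.Theory.

Local Open Scope ring_scope.

(** * Linear extension from a basis *)

(** For m > 0 the element F_m is not primitive, so multiplication by it has no skew derivation as
    adjoint: only the a_jl can be peeled off a product. The remaining factors e must be carried
    across the form, although e lies outside U^+[i] and L'' sends it to -B_i K_i. Hence only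
    q-commutators with e are moved, which keep U^+[i] stable.

    The exponent of kappa comes from two counts. Moving e costs C q^(-<b>) on one side and C q^<c>
    on the other, with <c> = <b> + 2; here C^2 q^2 = kappa^2 while the weight grows by alpha_i and
    <alpha_i> = 2. Peeling off a_jl costs kappa^N, while <a_jl> = -N.

    Weights of words and the twisted coproduct live on the free algebra E, so an element of U^+[i]
    and its image are followed as a pair of lifts to E. Identities that hold only in U^+ are stated
    after [piU] and enter the form because it factors through [piU]. *)

Section LinearExtension.
Variables (R : nzRingType) (K : choiceType) (V : lmodType R).
Implicit Types (G : K -> V) (S T : {malg R[K]}).

Definition lext G S : V := \sum_(k <- msupp S) S@_k *: G k.

Lemma lextEw G S (d : {fset K}) :
  (msupp S `<=` d)%fset -> lext G S = \sum_(k <- d) S@_k *: G k.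
Proof.
move=> le; rewrite /lext [RHS](big_fsetID _ (mem (msupp S))) /=.
rewrite [X in _ = _ + X]big1_fset ?addr0; last first.
  by move=> k; rewrite !inE => /andP[_ /mcoeff_outdom ->] _; rewrite scale0r.
have -> // : [fset x | x in d & x \in msupp S]%fset = msupp S.
apply/fsetP => k; rewrite !inE /=; apply: andb_idl.
by move/fsubsetP: le => /(_ k).
Qed.

Lemma lext_linear G c S T : lext G (c *: S + T) = c *: lext G S + lext G T.
Proof.
pose d := (msupp S `|` msupp T `|` msupp (c *: S + T))%fset.
have dST : (msupp S `|` msupp T `<=` d)%fset by exact: fsubsetUl.
rewrite !(@lextEw _ _ d) ?fsubsetUr //; last 2 first.
- by apply: fsubset_trans dST; exact: fsubsetUr.
- by apply: fsubset_trans dST; exact: fsubsetUl.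
rewrite scaler_sumr -big_split /=; apply: eq_bigr => k _.
by rewrite mcoeffD mcoeffZ scalerDl scalerA.
Qed.

HB.instance Definition _ G :=
  GRing.isLinear.Build R {malg R[K]} V *:%R (lext G) (lext_linear G).

Lemma lextD G : {morph lext G : S T / S + T}.
Proof. exact: linearD. Qed.

Lemma lext0 G : lext G 0 = 0.
Proof. exact: linear0. Qed.

Lemma lextZ G c S : lext G (c *: S) = c *: lext G S.
Proof. exact: linearZ. Qed.

Lemma lextU G c k : lext G << c *g k >> = c *: G k.
Proof.
rewrite (@lextEw _ _ [fset k]%fset) ?msuppU_le //.
by rewrite big_seq_fset1 mcoeffUU.
Qed.

Lemma lextU1 G k : lext G << k >> = G k.
Proof. by rewrite lextU scale1r. Qed.

Lemma malgZU (c d : R) k : c *: << d *g k >> = << c * d *g k >> :> {malg R[K]}.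
Proof. by apply/malgP => v; rewrite mcoeffZ !mcoeffU mulrnAr. Qed.

Lemma malg_ind (P : {malg R[K]} -> Prop) :
  P 0 -> (forall c S T, P S -> P T -> P (c *: S + T)) ->
  (forall k, P << k >>) -> forall S, P S.
Proof.
move=> P0 Plin Pgen S; rewrite (monalgE S).
elim/big_rec: _ => // k T _ PT.
by rewrite -[S@_k]mulr1 -malgZU; apply: Plin.
Qed.

Lemma eq_lext G G' S : G =1 G' -> lext G S = lext G' S.
Proof. by move=> eqG; apply: eq_bigr => k _; rewrite eqG. Qed.

End LinearExtension.

Lemma lext_comp (R : nzRingType) (K K' : choiceType) (V : lmodType R)
  (G : K' -> V) (M : K -> {malg R[K']}) (S : {malg R[K]}) :
  lext G (lext M S) = lext (fun k => lext G (M k)) S.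
Proof.
elim/malg_ind: S => [|c S T IH IH'|k]; first by rewrite !lext0.
  by rewrite !lext_linear IH IH'.
by rewrite !lextU1.
Qed.

Section BilinearExtension.
Variables (R : comNzRingType) (K K' : choiceType) (V : lmodType R).
Variable G : K -> K' -> V.
Implicit Types (S : {malg R[K]}) (T : {malg R[K']}).

Definition lext2 S T : V := lext (fun k => lext (G k) T) S.

Lemma lext2Pl c S S' T : lext2 (c *: S + S') T = c *: lext2 S T + lext2 S' T.
Proof. by rewrite /lext2 lext_linear. Qed.

Lemma lext2_0l T : lext2 0 T = 0.
Proof. by rewrite /lext2 lext0. Qed.

Lemma lext2Pr c S T T' : lext2 S (c *: T + T') = c *: lext2 S T + lext2 S T'.
Proof.
rewrite /lext2 {1 3 5}/lext scaler_sumr -big_split /=; apply: eq_bigr => k _.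
by rewrite lext_linear scalerDr !scalerA mulrC.
Qed.

Lemma lext2_0r S : lext2 S 0 = 0.
Proof. by rewrite /lext2 {1}/lext big1 // => k _; rewrite lext0 scaler0. Qed.

Lemma lext2UU k k' : lext2 << k >> << k' >> = G k k'.
Proof. by rewrite /lext2 !lextU1. Qed.

Lemma lext2Ul k T : lext2 << k >> T = lext (G k) T.
Proof. by rewrite /lext2 lextU1. Qed.

End BilinearExtension.

Lemma eq_lext2 (R : comNzRingType) (K K' : choiceType) (V : lmodType R)
  (G H : K -> K' -> V) S T :
  (forall k k', G k k' = H k k') -> lext2 G S T = lext2 H S T.
Proof. by move=> eqG; apply: eq_lext => k; apply: eq_lext. Qed.

Lemma lext2_comp (R : comNzRingType) (K K' K'' : choiceType) (V : lmodType R)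
  (G : K'' -> V) (M : K -> K' -> {malg R[K'']}) S T :
  lext G (lext2 M S T) = lext2 (fun k k' => lext G (M k k')) S T.
Proof. by rewrite /lext2 lext_comp; apply: eq_lext => k; rewrite lext_comp. Qed.

Lemma lext2_mul (R : comNzRingType) (K K' : choiceType) (c : R)
  (F : K -> R) (H : K' -> R) S T :
  lext2 (fun k k' => c * (F k * H k') : R^o) S T =
  c * (lext (F : K -> R^o) S * lext (H : K' -> R^o) T).
Proof.
rewrite /lext2 {1 3}/lext mulr_suml mulr_sumr; apply: eq_bigr => k _.
rewrite -[LHS]/(_ * _) -[X in _ = c * (X * _)]/(_ * _) /lext !mulr_sumr.
apply: eq_bigr => k' _.
rewrite -[X in _ * X = _]/(_ * _) -[X in _ = _ * (_ * X)]/(_ * _).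
by ring.
Qed.

(** * The free algebra: products and evaluation maps *)

Section FreeAlgebra.
Variables (X : choiceType).
Local Notation E := (freealg X).
Implicit Types (x y : E) (u v : seq X).

Lemma free_mulUU u v : << u >> * << v >> = << u ++ v >> :> E.
Proof. by rewrite -[X in << X *g u ++ v >>]mulr1; exact: fgmulUU. Qed.

Lemma free_one : 1 = << [::] >> :> E.
Proof. by []. Qed.

Lemma evalfree_lext (A : lalgType Qq) (f : X -> A) x :
  evalfree f x = lext (fun w => \prod_(g <- w) f g) x.
Proof. by []. Qed.

Lemma evalfree_linear (A : lalgType Qq) (f : X -> A) c x y :
  evalfree f (c *: x + y) = c *: evalfree f x + evalfree f y.
Proof. exact: lext_linear. Qed.

Lemma evalfreeM (A : algType Qq) (f : X -> A) x y :
  evalfree f (x * y) = evalfree f x * evalfree f y.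
Proof.
rewrite !evalfree_lext; elim/malg_ind: x => [|c x x' IH IH'|u].
- by rewrite mul0r !lext0 mul0r.
- by rewrite mulrDl -scalerAl !lext_linear IH IH' mulrDl scalerAl.
elim/malg_ind: y => [|c y y' IH IH'|v].
- by rewrite mulr0 !lext0 mulr0.
- by rewrite mulrDr -free_scaleAr !lext_linear IH IH' mulrDr scalerAr.
by rewrite free_mulUU !lextU1 big_cat.
Qed.

Lemma evalfree_gen (A : lalgType Qq) (f : X -> A) g : evalfree f (gen g) = f g.
Proof. by rewrite evalfree_lext [gen]unlock lextU1 big_seq1. Qed.

Lemma evalfree1 (A : lalgType Qq) (f : X -> A) : evalfree f 1 = 1.
Proof. by rewrite evalfree_lext free_one lextU1 big_nil. Qed.

End FreeAlgebra.

(** * Weights, the pairing with a simple coroot, homogeneous elements *)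

Section Weights.
Variables (I : countType) (D : BCdatum I).
Local Notation a := (cartan D).
Local Notation E := (freealg (Iinf D)).
Local Notation word := (seq (Iinf D)).
Local Notation Q := (Qlattice I).
Implicit Types (b c : Q) (i j : I) (m : int).

Definition hgt i b : int := lext (fun j => a i j : int^o) b.

Lemma hgtD i : {morph hgt i : b c / b + c}.
Proof. by move=> b c; rewrite /hgt lextD. Qed.

Lemma hgtU i m j : hgt i << m *g j >> = m * a i j.
Proof. by rewrite /hgt lextU. Qed.

Lemma rootform_lext b c :
  rootform D b c =
  lext (fun i => lext (fun j => (symm D i)%:Z * a i j : int^o) c : int^o) b.
Proof.
rewrite /rootform {1}/lext; apply: eq_bigr => i _; rewrite scaler_sumr.
by apply: eq_bigr => j _; rewrite scalerA.
Qed.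

Lemma rootformDl b b' c : rootform D (b + b') c = rootform D b c + rootform D b' c.
Proof. by rewrite !rootform_lext lextD. Qed.

Lemma rootformUl i m b : rootform D << m *g i >> b = m * ((symm D i)%:Z * hgt i b).
Proof.
rewrite rootform_lext lextU; congr (_ * _); rewrite /hgt /lext mulr_sumr.
by apply: eq_bigr => j _; rewrite -[_ *: _]/(_ * _) -[X in _ = _ * X]/(_ * _) mulrCA.
Qed.

Lemma rootformC b c : rootform D b c = rootform D c b.
Proof.
rewrite /rootform exchange_big; apply: eq_bigr => i _; apply: eq_bigr => j _.
by rewrite [b@__ * _]mulrC symm_cartan.
Qed.

Lemma rootformDr b c c' : rootform D b (c + c') = rootform D b c + rootform D b c'.
Proof. by rewrite ![rootform D b _]rootformC rootformDl. Qed.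

Lemma rootform0l b : rootform D 0 b = 0.
Proof. by rewrite -[RHS](subrr (rootform D 0 b)) -{2}[0]addr0 rootformDl addrK. Qed.

Lemma rootform0r b : rootform D b 0 = 0.
Proof. by rewrite rootformC rootform0l. Qed.

Lemma wdeg_cat (u v : word) : wdeg (u ++ v) = wdeg u + wdeg v.
Proof. by rewrite /wdeg big_cat. Qed.

Lemma wdeg_nil : wdeg ([::] : word) = 0.
Proof. by rewrite /wdeg big_nil. Qed.

Lemma homog_ind b (P : E -> Prop) :
  P 0 -> (forall (k : Qq) x y, P x -> P y -> P (k *: x + y)) ->
  (forall w, wdeg w = b -> P << w >>) -> forall x, homog b x -> P x.
Proof.
move=> P0 Plin Pgen x hx; rewrite (monalgE x) big_seq_cond.
elim/big_rec: _ => // k T /andP[/hx hk _] PT.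
by rewrite -[x@_k]mulr1 -malgZU; apply: Plin => //; exact: Pgen.
Qed.

Lemma homog0 b : homog b (0 : E).
Proof. by move=> w; rewrite msupp0 in_fset0. Qed.

Lemma homogP b (k : Qq) (x y : E) : homog b x -> homog b y -> homog b (k *: x + y).
Proof.
move=> hx hy w; move/(fsubsetP (msuppD_le _ _)); rewrite in_fsetU.
by case/orP=> [/(fsubsetP (msuppZ_le _ _)) /hx|/hy].
Qed.

Lemma homogU (w : word) : homog (wdeg w) (<< w >> : E).
Proof. by move=> u; rewrite msuppU1 in_fset1 => /eqP ->. Qed.

Lemma homog1 : homog 0 (1 : E).
Proof. by rewrite -wdeg_nil; exact: homogU. Qed.

Lemma homogM b c (x y : E) : homog b x -> homog c y -> homog (b + c) (x * y).
Proof.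
move=> hx hy; elim/homog_ind: hx => [|k x1 x2 h1 h2|u <-].
- by rewrite mul0r; exact: homog0.
- by rewrite mulrDl -scalerAl; exact: homogP.
elim/homog_ind: hy => [|k x1 x2 h1 h2|v <-].
- by rewrite mulr0; exact: homog0.
- by rewrite mulrDr -free_scaleAr; exact: homogP.
by rewrite free_mulUU -wdeg_cat; exact: homogU.
Qed.

Lemma homog_gen g : homog << (lev g)%:Z *g idx g >> (gen g : E).
Proof. by move=> w; rewrite [gen]unlock => /homogU ->; rewrite /wdeg big_seq1. Qed.

End Weights.

Lemma ofpoly_eq0 (p : {poly rat}) : (ofpoly p == 0) = (p == 0).
Proof.
rewrite /ofpoly; set e := Qq.unlock; move: e; rewrite -/Qq.
(* Generalizing [Qq] together with its locking equation lets substitution turn [ofpoly] into the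
   plain embedding of polynomials. *)
move: (Qq) => F e; subst F; exact: tofrac_eq0.
Qed.

Lemma qq_neq0 : qq != 0.
Proof. by rewrite ofpoly_eq0 polyX_eq0. Qed.

Lemma qq_exp_neq1 n : (0 < n)%N -> qq ^+ n != 1.
Proof.
move=> n0; rewrite -subr_eq0 -rmorphXn -(rmorph1 ofpoly) -rmorphB ofpoly_eq0.
by rewrite -size_poly_eq0 size_XnsubC.
Qed.

Lemma additive_sum_eq (V W : zmodType) (F : V -> W) :
  (forall x y, F (x + y) = F x + F y) -> forall x y z t u k l,
  F x = k -> F y = l -> F z = 0 -> F t = 0 -> F u = 0 ->
  F (x + y + (z + t + u)) = k + l.
Proof. by move=> FD x y z t u k l; rewrite !FD => -> -> -> -> ->; rewrite !addr0. Qed.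

(** * The twisted coproduct *)

Section Coproduct.
Variables (I : countType) (D : BCdatum I).
Local Notation E := (freealg (Iinf D)).
Local Notation word := (seq (Iinf D)).
Local Notation EE := (EE D).
Local Notation Q := (Qlattice I).
Local Notation rf := (rootform D).
Implicit Types (b c : Q) (x y p r : E) (f h : E -> Qq) (S T : EE).

Lemma tens_lext2 x y : tens x y = lext2 (fun u v : word => << (u, v) >> : EE) x y.
Proof.
rewrite /tens /lext2 {1}/lext; apply: eq_bigr => u _; rewrite scaler_sumr.
by apply: eq_bigr => v _; rewrite scalerA malgZU mulr1.
Qed.

Lemma tensPl (k : Qq) x x' y : tens (k *: x + x') y = k *: tens x y + tens x' y.
Proof. by rewrite !tens_lext2 lext2Pl. Qed.

Lemma tensPr (k : Qq) x y y' : tens x (k *: y + y') = k *: tens x y + tens x y'.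
Proof. by rewrite !tens_lext2 lext2Pr. Qed.

Lemma tensBl x x' y : tens (x - x') y = tens x y - tens x' y.
Proof. by rewrite addrC -scaleN1r tensPl scaleN1r addrC. Qed.

Lemma tensBr x y y' : tens x (y - y') = tens x y - tens x y'.
Proof. by rewrite addrC -scaleN1r tensPr scaleN1r addrC. Qed.

Lemma tensUU (u v : word) : tens << u >> << v >> = << (u, v) >> :> EE.
Proof. by rewrite tens_lext2 lext2UU. Qed.

Lemma tmul_lext2 S T :
  tmul S T = lext2 (fun u v : word * word =>
    qq ^ rf (wdeg u.2) (wdeg v.1) *: << (u.1 ++ v.1, u.2 ++ v.2) >> : EE) S T.
Proof.
rewrite /tmul /lext2 {1}/lext; apply: eq_bigr => u _; rewrite scaler_sumr.
by apply: eq_bigr => v _; rewrite !scalerA malgZU mulr1 mulrC.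
Qed.

Lemma tmulPl (k : Qq) S S' T : tmul (k *: S + S') T = k *: tmul S T + tmul S' T.
Proof. by rewrite !tmul_lext2 lext2Pl. Qed.

Lemma tmulPr (k : Qq) S T T' : tmul S (k *: T + T') = k *: tmul S T + tmul S T'.
Proof. by rewrite !tmul_lext2 lext2Pr. Qed.

Lemma tmul0l T : tmul 0 T = 0 :> EE.
Proof. by rewrite tmul_lext2 lext2_0l. Qed.

Lemma tmul0r S : tmul S 0 = 0 :> EE.
Proof. by rewrite tmul_lext2 lext2_0r. Qed.

Lemma tmulDl S S' T : tmul (S + S') T = tmul S T + tmul S' T.
Proof. by rewrite -[S]scale1r tmulPl !scale1r. Qed.

Lemma tmulDr S T T' : tmul S (T + T') = tmul S T + tmul S T'.
Proof. by rewrite -[T]scale1r tmulPr !scale1r. Qed.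

Lemma tmulZr (k : Qq) S T : tmul S (k *: T) = k *: tmul S T.
Proof. by rewrite -[k *: T]addr0 tmulPr tmul0r addr0. Qed.

Lemma tmulZl (k : Qq) S T : tmul (k *: S) T = k *: tmul S T.
Proof. by rewrite -[k *: S]addr0 tmulPl tmul0l addr0. Qed.

Lemma tmulUU (u v : word * word) :
  tmul << u >> << v >> =
    qq ^ rf (wdeg u.2) (wdeg v.1) *: << (u.1 ++ v.1, u.2 ++ v.2) >> :> EE.
Proof. by rewrite tmul_lext2 lext2UU. Qed.

Lemma tmulA S T W : tmul S (tmul T W) = tmul (tmul S T) W :> EE.
Proof.
elim/malg_ind: S => [|k S S' IH IH'|u]; first by rewrite !tmul0l.
  by rewrite !tmulPl IH IH'.
elim/malg_ind: T => [|k T T' IH IH'|v]; first by rewrite !(tmul0l, tmul0r).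
  by rewrite !(tmulPl, tmulPr) IH IH'.
elim/malg_ind: W => [|k W W' IH IH'|w]; first by rewrite !tmul0r.
  by rewrite !tmulPr IH IH'.
rewrite !tmulUU tmulZr tmulZl !tmulUU /= !scalerA -!catA.
congr (_ *: _); rewrite !wdeg_cat rootformDl rootformDr.
by rewrite !expfzDr ?qq_neq0 // mulrA -!expfzDr ?qq_neq0 //; congr (_ ^ _); ring.
Qed.

Lemma tmul1l S : tmul (tens 1 1) S = S.
Proof.
rewrite free_one tensUU; elim/malg_ind: S => [|k S S' IH IH'|u].
- by rewrite tmul0r.
- by rewrite tmulPr IH IH'.
by rewrite tmulUU /= wdeg_nil rootform0l expr0z scale1r; case: u.
Qed.

Lemma rho_lext x : rho x = lext (@rho_word I D) x.
Proof. by []. Qed.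

Lemma rho_word_cat (u v : word) :
  rho_word (u ++ v) = tmul (rho_word u) (rho_word v).
Proof. by elim: u => [|g u IH]; [rewrite tmul1l | rewrite /= IH tmulA]. Qed.

Lemma rhoM x y : rho (x * y) = tmul (rho x) (rho y).
Proof.
rewrite !rho_lext; elim/malg_ind: x => [|k x x' IH IH'|u].
- by rewrite mul0r !lext0 tmul0l.
- by rewrite mulrDl -scalerAl !lext_linear IH IH' tmulPl.
elim/malg_ind: y => [|k y y' IH IH'|v].
- by rewrite mulr0 !lext0 tmul0r.
- by rewrite mulrDr -free_scaleAr !lext_linear IH IH' tmulPr.
by rewrite free_mulUU !lextU1 rho_word_cat.
Qed.

(** A linear functional supported in one weight. The twist in [tmul] depends on the weights of
    words, and such functionals turn it into a constant. *)
Definition weighted b f :=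
  scalar f /\ forall w : word, wdeg w <> b -> f << w >> = 0.

(* <S, f (x) h>; thus B x (y z) = <rho x, B(-, y) (x) B(-, z)>. *)
Definition pair2 f h S : Qq :=
  lext (fun w => f << w.1 >> * h << w.2 >> : Qq^o) S.

Lemma scalar_lext f x : scalar f -> f x = lext (fun w => f << w >> : Qq^o) x.
Proof.
move=> lf; elim/malg_ind: x => [|k x x' IH IH'|u]; last by rewrite lextU1.
  by have := lf (-1) 0 0; rewrite lext0 scaler0 addr0 mulN1r addNr.
by rewrite lf lext_linear IH IH'.
Qed.

Lemma scalar_funB f x y : scalar f -> f (x - y) = f x - f y.
Proof. by move=> lf; rewrite addrC -scaleN1r lf mulN1r addrC. Qed.

Lemma scalar_funZ f (k : Qq) x : scalar f -> f (k *: x) = k * f x.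
Proof.
move=> lf; have f0 : f 0 = 0 by rewrite -(subrr x) scalar_funB ?subrr.
by rewrite -[k *: x]addr0 lf f0 addr0.
Qed.

Lemma scalar_homog f g b x : scalar f -> scalar g -> homog b x ->
  (forall w, wdeg w = b -> f << w >> = g << w >>) -> f x = g x.
Proof.
move=> lf lg hx fg; rewrite (scalar_lext x lf) (scalar_lext x lg).
elim/homog_ind: hx => [|k x1 x2 IH1 IH2|w hw]; first by rewrite !lext0.
- by rewrite !lext_linear IH1 IH2.
- by rewrite !lextU1 fg.
Qed.

Lemma scalar_mulr f p : scalar f -> scalar (fun v => f (v * p)).
Proof. by move=> lf k x y; rewrite mulrDl -scalerAl lf. Qed.

Lemma scalar_mull f p : scalar f -> scalar (fun v => f (p * v)).
Proof. by move=> lf k x y; rewrite mulrDr -free_scaleAr lf. Qed.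

Lemma weighted_homog b c f x : weighted b f -> homog c x -> c <> b -> f x = 0.
Proof.
move=> [lf wf] hx cb; apply: (@scalar_homog f (fun=> 0) c) => //.
- by move=> k u v; rewrite mulr0 addr0.
- by move=> w wc; apply: wf; rewrite wc.
Qed.

Lemma weighted_mulr b c f p :
  homog c p -> weighted b f -> weighted (b - c) (fun v => f (v * p)).
Proof.
move=> hp wf; split=> [|w hw]; first exact: scalar_mulr (proj1 wf).
apply: (weighted_homog wf (homogM (@homogU _ _ _) hp)) => hb.
by apply: hw; rewrite -hb addrK.
Qed.

Lemma weighted_mull b c f p :
  homog c p -> weighted b f -> weighted (b - c) (fun v => f (p * v)).
Proof.
move=> hp wf; split=> [|w hw]; first exact: scalar_mull (proj1 wf).
apply: (weighted_homog wf (homogM hp (@homogU _ _ _))) => hb.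
by apply: hw; rewrite -hb addrC addKr.
Qed.

Lemma pair2P f h (k : Qq) S T :
  pair2 f h (k *: S + T) = k * pair2 f h S + pair2 f h T.
Proof. by rewrite /pair2 lext_linear. Qed.

Lemma pair2_0 f h : pair2 f h 0 = 0.
Proof. by rewrite /pair2 lext0. Qed.

Lemma pair2D f h S T : pair2 f h (S + T) = pair2 f h S + pair2 f h T.
Proof. by rewrite /pair2 lextD. Qed.

Lemma pair2_ext f h f' h' S :
  (forall u, f << u >> = f' << u >>) -> (forall u, h << u >> = h' << u >>) ->
  pair2 f h S = pair2 f' h' S.
Proof. by move=> ff hh; rewrite /pair2 /lext; apply: eq_bigr => w _; rewrite ff hh. Qed.

Lemma pair2Zl (k : Qq) f h S : pair2 (fun x => k * f x) h S = k * pair2 f h S.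
Proof.
rewrite /pair2 /lext mulr_sumr; apply: eq_bigr => w _.
set s := S@_w; rewrite -[LHS]/(s * (k * f << w.1 >> * h << w.2 >>)).
by rewrite -[X in _ = _ * X]/(s * (f << w.1 >> * h << w.2 >>)); ring.
Qed.

Lemma pair2Zr (k : Qq) f h S : pair2 f (fun x => k * h x) S = k * pair2 f h S.
Proof.
rewrite /pair2 /lext mulr_sumr; apply: eq_bigr => w _.
set s := S@_w; rewrite -[LHS]/(s * (f << w.1 >> * (k * h << w.2 >>))).
by rewrite -[X in _ = _ * X]/(s * (f << w.1 >> * h << w.2 >>)); ring.
Qed.

Lemma pair2_tens f h x y : scalar f -> scalar h -> pair2 f h (tens x y) = f x * h y.
Proof.
move=> lf lh; rewrite (scalar_lext x lf) (scalar_lext y lh) -[RHS]mul1r -lext2_mul.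
rewrite /pair2 tens_lext2 lext2_comp; apply: (@eq_lext2 _ _ _ Qq^o) => u v.
by rewrite lextU1 mul1r.
Qed.

Lemma pair2_tmulU f h (u : word * word) p r b :
  scalar f -> scalar h ->
  (forall v, wdeg v <> b -> f (<< u.1 >> * << v >>) = 0) ->
  pair2 f h (tmul << u >> (tens p r)) =
    qq ^ rf (wdeg u.2) b * (f (<< u.1 >> * p) * h (<< u.2 >> * r)).
Proof.
move=> lf lh supp.
rewrite (scalar_lext p (scalar_mull _ lf)) (scalar_lext r (scalar_mull _ lh)).
rewrite -lext2_mul /pair2 tmul_lext2 lext2Ul lext_comp tens_lext2 lext2_comp.
apply: (@eq_lext2 _ _ _ Qq^o) => v w; rewrite lextU1 lextZ lextU1 /= !free_mulUU.
have [->//|/eqP nb] := eqVneq (wdeg v) b.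
by rewrite -free_mulUU supp // !mul0r scaler0 mulr0.
Qed.

Lemma pair2U f h (u : word * word) : pair2 f h << u >> = f << u.1 >> * h << u.2 >>.
Proof. by rewrite /pair2 lextU1. Qed.

Lemma pair2_tmul_ind f h f' h' (k : Qq) S T :
  (forall u : word * word,
     pair2 f h (tmul << u >> T) = k * (f' << u.1 >> * h' << u.2 >>)) ->
  pair2 f h (tmul S T) = k * pair2 f' h' S.
Proof.
move=> H; elim/malg_ind: S => [|l S S' IH IH'|u].
- by rewrite tmul0l !pair2_0 mulr0.
- by rewrite tmulPl !pair2P IH IH' mulrDr mulrCA.
by rewrite H pair2U.
Qed.

(** Only words u with |u.1| = b - d and |u.2| = c - d' contribute, so the twist is the same for all
    of them. *)
Lemma pair2_tmul_tens f h S p r b c d d' :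
  weighted b f -> weighted c h -> homog d p -> homog d' r ->
  pair2 f h (tmul S (tens p r)) =
    qq ^ rf (c - d') d * pair2 (fun v => f (v * p)) (fun v => h (v * r)) S.
Proof.
move=> wf wh hp hr; apply: pair2_tmul_ind => u.
have wfp w : wdeg w <> b - d -> f (<< w >> * p) = 0.
  exact: (proj2 (weighted_mulr hp wf)).
have whr w : wdeg w <> c - d' -> h (<< w >> * r) = 0.
  exact: (proj2 (weighted_mulr hr wh)).
rewrite (@pair2_tmulU f h u p r (b - wdeg u.1) (proj1 wf) (proj1 wh)); last first.
  move=> v nb; apply: (proj2 (weighted_mull (@homogU _ _ u.1) wf)) => hv.
  by apply: nb.
have [uc|/eqP/whr ->] := eqVneq (wdeg u.2) (c - d'); last by rewrite !mulr0.
have [ub|/eqP/wfp ->] := eqVneq (wdeg u.1) (b - d); last by rewrite !(mulr0, mul0r).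
by rewrite uc ub; congr (_ ^ rf _ _ * _); rewrite opprB addrC subrK.
Qed.

(** Here p and r carry no grading, as they will come from the kernel terms of a coproduct; the
    weight of f still fixes the twist for each word u. *)
Lemma pair2_tmul_null f h S p r b :
  weighted b f -> scalar h ->
  (forall v, f (v * p) = 0) \/ (forall v, h (v * r) = 0) ->
  pair2 f h (tmul S (tens p r)) = 0.
Proof.
move=> wf lh null; rewrite (@pair2_tmul_ind _ _ f h 0) ?mul0r // => u.
rewrite (@pair2_tmulU f h u p r (b - wdeg u.1) (proj1 wf) lh); last first.
  by move=> v nb; apply: (proj2 (weighted_mull (@homogU _ _ u.1) wf)).
by case: null => ->; rewrite !(mul0r, mulr0).
Qed.

Lemma pair2_tmul_word f h S (u1 u2 : word) b :
  weighted b f ->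
  pair2 f h (tmul << (u1, u2) >> S) = qq ^ rf (wdeg u2) (b - wdeg u1) *
    pair2 (fun v => f (<< u1 >> * v)) (fun v => h (<< u2 >> * v)) S.
Proof.
move=> wf; elim/malg_ind: S => [|l S S' IH IH'|v].
- by rewrite tmul0r !pair2_0 mulr0.
- by rewrite tmulPr !pair2P IH IH' mulrDr mulrCA.
rewrite tmulUU /pair2 lextZ !lextU1 /= !free_mulUU.
have [->//|/eqP nb] := eqVneq (wdeg v.1) (b - wdeg u1).
have -> : f << u1 ++ v.1 >> = 0.
  by rewrite -free_mulUU; apply: (proj2 (weighted_mull (@homogU _ _ u1) wf)).
by rewrite !mul0r scaler0 mulr0.
Qed.

Lemma pair2_tmulD f h S T T' :
  pair2 f h (tmul S (T + T')) = pair2 f h (tmul S T) + pair2 f h (tmul S T').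
Proof. by rewrite tmulDr pair2D. Qed.

(** Shaped for a coproduct equal to p (x) 1 + 1 (x) p plus three terms that the form does not
    see. *)
Lemma pair2_tmul_sum f h S T1 T2 T3 T4 T5 k1 k2 :
  pair2 f h (tmul S T1) = k1 -> pair2 f h (tmul S T2) = k2 ->
  pair2 f h (tmul S T3) = 0 -> pair2 f h (tmul S T4) = 0 ->
  pair2 f h (tmul S T5) = 0 ->
  pair2 f h (tmul S (T1 + T2 + (T3 + T4 + T5))) = k1 + k2.
Proof. exact: (additive_sum_eq (pair2_tmulD f h S)). Qed.

Lemma tmul1r S : tmul S (tens 1 1) = S.
Proof.
rewrite free_one tensUU; elim/malg_ind: S => [|k S S' IH IH'|u].
- by rewrite tmul0l.
- by rewrite tmulPl IH IH'.
by rewrite tmulUU /= wdeg_nil rootform0r expr0z scale1r !cats0; case: u.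
Qed.

Lemma rho1 : rho (1 : E) = tens 1 1 :> EE.
Proof. by rewrite free_one rho_lext lextU1. Qed.

Lemma ext_gen (A : pzRingType) (F : Iinf D -> A) g : ext F (idx g) (lev g) = F g.
Proof.
rewrite /ext; have -> : (lev g == 0%N) = false.
  by have := valP g; rewrite /in_Iinf lt0n => /andP[/negbTE].
by rewrite -[(idx g, lev g)]surjective_pairing valK.
Qed.

Lemma rho_gen1 g : lev g = 1%N -> rho (gen g) = tens (gen g) 1 + tens 1 (gen g) :> EE.
Proof.
move=> lg; rewrite [gen in LHS]unlock rho_lext lextU1 /= tmul1r /rho_gen lg.
rewrite big_ord_recl big_ord1 /= !expr0 !scale1r addrC.
by rewrite -[X in ext _ _ X]lg ext_gen.
Qed.

End Coproduct.

Lemma regroup_sub (V : zmodType) (a b a' b' r : V) :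
  r = a + b + ((a' - a) + (b' - b) + (r - (a' + b'))).
Proof.
have -> : a' - a + (b' - b) = a' + b' - (a + b) by rewrite addrACA opprD.
by rewrite addrA addrC [a + b + _]addrC subrK subrK.
Qed.

(** * Adjoints of multiplications with respect to the form *)

Section Form.
Variables (I : countType) (D : BCdatum I) (nu : Iinf D -> Qq).
Local Notation E := (freealg (Iinf D)).
Local Notation word := (seq (Iinf D)).
Local Notation Q := (Qlattice I).
Local Notation rf := (rootform D).
Variables (B : E -> E -> Qq) (formP : is_form nu B).
Implicit Types (b c d : Q) (x y z p r u v : E).

Lemma form_scalar_l y : scalar (B^~ y).
Proof. by move=> k u v; exact: (form_linear formP). Qed.

Lemma form_scalar_r x : scalar (B x).
Proof. by move=> k u v; rewrite !(form_sym formP x) (form_linear formP). Qed.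

Lemma form_scalel (k : Qq) x y : B (k *: x) y = k * B x y.
Proof. exact: (scalar_funZ k x (form_scalar_l y)). Qed.

Lemma form_scaler (k : Qq) x y : B x (k *: y) = k * B x y.
Proof. exact: (scalar_funZ k y (form_scalar_r x)). Qed.

Lemma form_subl x x' y : B (x - x') y = B x y - B x' y.
Proof. exact: (scalar_funB x x' (form_scalar_l y)). Qed.

Lemma form_subr x y y' : B x (y - y') = B x y - B x y'.
Proof. exact: (scalar_funB y y' (form_scalar_r x)). Qed.

Lemma form_addr x y y' : B x (y + y') = B x y + B x y'.
Proof. by rewrite -[y]scale1r form_scalar_r mul1r scale1r. Qed.

Lemma form_addl x x' y : B (x + x') y = B x y + B x' y.
Proof. by rewrite !(form_sym formP _ y) form_addr. Qed.

Lemma form_zero_r x : B x 0 = 0.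
Proof. by rewrite -[0 in LHS](subrr (0 : E)) form_subr subrr. Qed.

Lemma form_weighted b y : homog b y -> weighted b (B^~ y).
Proof.
move=> hy; split=> [|w wb]; first exact: form_scalar_l.
exact: (form_orth formP (@homogU _ _ w) hy).
Qed.

Lemma form_pair2 x y z : B x (y * z) = pair2 (B^~ y) (B^~ z) (rho x).
Proof.
rewrite (form_mul formP) /tens_form /pair2 /lext; apply: eq_bigr => u _.
rewrite -(pair2_tens y z (form_scalar_r << u.1 >>) (form_scalar_r << u.2 >>)).
rewrite -[RHS]/(_ * pair2 _ _ _) /pair2 /lext mulr_sumr; apply: eq_bigr => v _.
by rewrite -mulrA.
Qed.

#[local] Opaque tens tmul rho pair2.

(** A relation rather than an operator: the form on E may be degenerate, and y' is determined only
    modulo its radical. *)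
Definition adjR p y y' := forall v, B (v * p) y = B v y'.
Definition adjL p y y' := forall v, B (p * v) y = B v y'.

Lemma adjR_lin p (k : Qq) y y' z z' :
  adjR p y y' -> adjR p z z' -> adjR p (y - k *: z) (y' - k *: z').
Proof. by move=> hy hz v; rewrite !form_subr !form_scaler hy hz. Qed.

Lemma adjL_lin p (k : Qq) y y' z z' :
  adjL p y y' -> adjL p z z' -> adjL p (y - k *: z) (y' - k *: z').
Proof. by move=> hy hz v; rewrite !form_subr !form_scaler hy hz. Qed.

(* rho(p) = p (x) 1 + 1 (x) p, as seen by the form: primitivity in
   U^+ only gives information on rho modulo the kernel of E -> U^+. *)
Record skew_prim d p := SkewPrim {
  skew_prim_homog : homog d p;
  skew_prim_mul : forall u b c y z, homog b y -> homog c z ->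
    B (u * p) (y * z) =
      qq ^ rf c d * pair2 (fun v => B (v * p) y) (B^~ z) (rho u) +
      pair2 (B^~ y) (fun v => B (v * p) z) (rho u)
}.

(** [skew_prim_mul] already splits the pairing over rho; taking the adjoint inside each tensor
    factor gives a Leibniz rule, twisted by passing p over z. *)
Lemma adjR_mul d p b c y y' z z' :
  skew_prim d p -> homog b y -> homog c z -> adjR p y y' -> adjR p z z' ->
  adjR p (y * z) (qq ^ rf c d *: (y' * z) + y * z').
Proof.
move=> pp hy hz ay az v; rewrite (skew_prim_mul pp _ hy hz) form_addr form_scaler !form_pair2.
by congr (_ * _ + _); apply: pair2_ext => // u; rewrite ?ay ?az.
Qed.

Lemma form_prim d p b c y z :
  skew_prim d p -> homog b y -> homog c z ->
  B p (y * z) = qq ^ rf c d * B p y * B 1 z + B 1 y * B p z.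
Proof.
move=> pp hy hz; have := skew_prim_mul pp 1 hy hz; rewrite mul1r => ->.
have h1 x : scalar (fun v => B (v * p) x) by exact: (scalar_mulr p (form_scalar_l x)).
by rewrite rho1 !pair2_tens ?mul1r ?mulrA //; exact: form_scalar_l.
Qed.

Lemma form1_homog d p : homog d p -> d <> 0 -> B 1 p = 0.
Proof. by move=> hp d0; apply: (form_orth formP (@homog1 _ D) hp) => e; exact: d0. Qed.

Lemma form_ind y y' (F G : E -> E) :
  scalar (fun v => B (F v) y) -> scalar (fun v => B (G v) y') ->
  (forall w : word, B (F << w >>) y = B (G << w >>) y') ->
  forall v, B (F v) y = B (G v) y'.
Proof.
move=> sF sG FG v; rewrite (scalar_lext v sF) (scalar_lext v sG).
by apply: (@eq_lext _ _ Qq^o) => w.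
Qed.

Lemma adjR_prim d p d' p' : skew_prim d p -> skew_prim d' p' -> d <> 0 ->
  adjR p p' (B p p' *: 1).
Proof.
move=> pp pp' d0; apply: (@form_ind _ _ (fun v => v * p) id) => [||w].
- exact: (scalar_mulr p (form_scalar_l p')).
- exact: form_scalar_l.
rewrite (form_sym formP) (form_prim pp' (@homogU _ _ w) (skew_prim_homog pp)).
rewrite (form1_homog (skew_prim_homog pp) d0) mulr0 add0r form_scaler mulrC.
by rewrite (form_sym formP p') (form_sym formP 1).
Qed.

(** Pairing with 1 is a character of E, because rho 1 = 1 (x) 1. *)
Lemma form1M x y : B 1 (x * y) = B 1 x * B 1 y.
Proof. by rewrite form_pair2 rho1 pair2_tens //; exact: form_scalar_l. Qed.

Lemma adjL_prim d p d' p' : skew_prim d p -> skew_prim d' p' -> d <> 0 ->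
  adjL p p' (B p p' *: 1).
Proof.
move=> pp pp' d0; apply: (@form_ind _ _ (fun v => p * v) id) => [||w].
- exact: (scalar_mull p (form_scalar_l p')).
- exact: form_scalar_l.
rewrite (form_sym formP) (form_prim pp' (skew_prim_homog pp) (@homogU _ _ w)).
rewrite (form1_homog (skew_prim_homog pp) d0) mul0r addr0 form_scaler.
rewrite (form_sym formP p') -mulrA mulrCA (form_sym formP _ 1); congr (_ * _).
(* The twist by the weight of w is harmless: {1, w} vanishes unless w has weight 0. *)
have [->|/eqP w0] := eqVneq (wdeg w) 0; first by rewrite rootform0l mul1r.
by rewrite (form1_homog (@homogU _ _ w) w0) mulr0.
Qed.

Lemma adjR_one d p : homog d p -> d <> 0 -> adjR p 1 0.
Proof.
move=> hp d0 v; rewrite (form_sym formP) form1M (form1_homog hp d0) mulr0.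
by rewrite form_zero_r.
Qed.

(* p is known to be primitive only modulo the kernel N of E -> U^+, through
   another, not necessarily homogeneous, lift p'. *)
Lemma prim_of_rho d p p' (N : E -> Prop) :
  (forall n v y, N n -> B (v * n) y = 0) ->
  homog d p -> N (p' - p) ->
  (exists2 s : seq (E * E), rho p' - (tens p' 1 + tens 1 p') =
       \sum_(t <- s) tens t.1 t.2 &
     {in s, forall t, N t.1 \/ N t.2}) ->
  skew_prim d p.
Proof.
move=> N0 hp Np [s rhop sN]; split=> // u b c y z hy hz.
have [wy wz] := (form_weighted hy, form_weighted hz).
have nullN S t1 t2 : N t1 \/ N t2 ->
    pair2 (B^~ y) (B^~ z) (tmul S (tens t1 t2)) = 0.
  move=> nt; apply: (pair2_tmul_null S wy (proj1 wz)).
  by case: nt => nt; [left|right] => v; exact: N0.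
have -> : B (u * p) (y * z) = B (u * p') (y * z).
  have := N0 _ u (y * z) Np; rewrite mulrBr form_subl => /eqP.
  by rewrite subr_eq0 => /eqP.
rewrite form_pair2 rhoM.
have -> : rho p' = tens p 1 + tens 1 p + (tens (p' - p) 1 + tens 1 (p' - p)
    + \sum_(t <- s) tens t.1 t.2).
  by rewrite -rhop tensBl tensBr -regroup_sub.
apply: pair2_tmul_sum.
- rewrite (pair2_tmul_tens _ wy wz hp (@homog1 _ D)) subr0; congr (_ * _).
  by apply: pair2_ext => v; rewrite ?mulr1.
- rewrite (pair2_tmul_tens _ wy wz (@homog1 _ D) hp) rootform0r expr0z mul1r.
  by apply: pair2_ext => v; rewrite ?mulr1.
- by apply: nullN; left.
- by apply: nullN; right.
rewrite big_seq_cond; elim/big_rec: _ => [|t T /andP[/sN nt _] IH].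
  by rewrite tmul0r pair2_0.
by rewrite pair2_tmulD nullN ?IH ?addr0.
Qed.

End Form.

(** * Iterated q-commutators *)

Section QCommutators.
Variables (A : lalgType Qq) (v : Qq) (c : int) (e a : A).

(* For v = q_i and c = <a> these are the F_m and G_m, of weight |a| + m alpha_i. *)
Fixpoint qadR m : A :=
  if m is m'.+1 then
    qadR m' * e - v ^ (c + 2 * m'%:Z) *: (e * qadR m')
  else a.

Fixpoint qadL m : A :=
  if m is m'.+1 then
    e * qadL m' - v ^ (c + 2 * m'%:Z) *: (qadL m' * e)
  else a.

End QCommutators.

(** The computation shared by [lower_right] and [lower_left]: the t-terms give 1 - k^2, and because
    k = l k' the s-terms form l times the q-commutator that defines x. *)
Lemma lower_comb (V : lmodType Qq) (k k' l t s : Qq) (x u w : V) : k = l * k' ->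
  s *: x = s *: (u - k' *: w) ->
  t *: x + l *: (s *: u) - k *: (s *: w + k *: (t *: x)) =
    (t * (1 - k ^+ 2) + l * s) *: x.
Proof.
move=> -> hx; rewrite [in RHS]scalerDl -[in RHS](scalerA l s x) hx.
rewrite mulrBr mulr1 scalerBl !scalerBr scalerDr !scalerA.
rewrite [X in _ - X]addrC opprD addrACA; congr (_ - _ *: _ + (_ - _ *: _)); ring.
Qed.

Section ScalarIdentities.
Variables (A : lalgType Qq) (scaleAr : forall (k : Qq) (x y : A), k *: (x * y) = x * (k *: y)).
Implicit Types (k l t s : Qq) (x y e : A).

Lemma cancel_left k l t e x :
  (0 * e + k *: (x * (t *: 1))) - k *: ((t *: 1) * x + l *: (e * 0)) = 0.
Proof.
by rewrite mul0r mulr0 scaler0 add0r addr0 -scaleAr mulr1 -scalerAl mul1r subrr.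
Qed.

Lemma cancel_right k l t e x :
  (k *: ((t *: 1) * x) + e * 0) - k *: (l *: (0 * e) + x * (t *: 1)) = 0.
Proof.
by rewrite mul0r mulr0 scaler0 add0r addr0 -scaleAr mulr1 -scalerAl mul1r subrr.
Qed.

Lemma lower_right k k' l t s e x x' : k = l * k' ->
  s *: x = s *: (x' * e - k' *: (e * x')) ->
  (l *: ((s *: x') * e) + x * (t *: 1)) -
    k *: (k *: ((t *: 1) * x) + e * (s *: x')) = (t * (1 - k ^+ 2) + l * s) *: x.
Proof.
move=> hk hx; rewrite -(lower_comb t hk hx) -!scaleAr -!scalerAl mulr1 mul1r.
by rewrite [l *: _ + _]addrC [k *: (t *: x) + _]addrC.
Qed.

Lemma lower_left k k' l t s e x x' : k = l * k' ->
  s *: x = s *: (e * x' - k' *: (x' * e)) ->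
  ((t *: 1) * x + l *: (e * (s *: x'))) -
    k *: ((s *: x') * e + k *: (x * (t *: 1))) = (t * (1 - k ^+ 2) + l * s) *: x.
Proof.
by move=> hk hx; rewrite -(lower_comb t hk hx) -!scaleAr -!scalerAl mulr1 mul1r.
Qed.

Lemma derive_first k k' l t e x :
  (k *: ((t *: 1) * e) + x * 0) - k' *: (l *: (0 * x) + e * (t *: 1)) =
    (t * k - t * k') *: e.
Proof.
rewrite mulr0 addr0 mul0r scaler0 add0r -scaleAr mulr1 -scalerAl mul1r !scalerA.
by rewrite -scalerBl ![t * _]mulrC.
Qed.

Lemma derive_null k k' l e x :
  (k *: (0 * e) + x * 0) - k' *: (l *: (0 * x) + e * 0) = 0.
Proof. by rewrite !mul0r !mulr0 !scaler0 !addr0 scaler0 subr0. Qed.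

Lemma derive_exp k k' l r m e x :
  (k *: (0 * x) + e * (r *: e ^+ m)) - k' *: (l *: ((r *: e ^+ m) * e) + x * 0) =
    (r - k' * (r * l)) *: e ^+ m.+1.
Proof.
rewrite mul0r mulr0 scaler0 add0r addr0 -scaleAr -scalerAl -exprS -exprSr.
by rewrite !scalerA -scalerBl [r * l]mulrC mulrA.
Qed.

Lemma exp_step l r t m e :
  l *: ((r *: e ^+ m) * e) + e ^+ m.+1 * (t *: 1) = (l * r + t) *: e ^+ m.+1.
Proof. by rewrite -scalerAl -exprSr -scaleAr mulr1 scalerA scalerDl. Qed.

End ScalarIdentities.

(** * The root vector e: adjoints on q-commutators and on powers of e *)

Section RankOne.
Variables (I : countType) (D : BCdatum I) (nu : Iinf D -> Qq).
Local Notation E := (freealg (Iinf D)).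
Local Notation Q := (Qlattice I).
Local Notation rf := (rootform D).
Variables (B : E -> E -> Qq) (formP : is_form nu B).
Variables (g0 : Iinf D) (lev_g0 : lev g0 = 1%N) (re_g0 : is_re D (idx g0)).
Implicit Types (b c d : Q) (x y z p r u v : E) (f h : E -> Qq).

Let i : I := idx g0.
Let e : E := gen g0.
Let ai : Q := << 1 *g i >>.
Let q : Qq := qi D i.
Let tau : Qq := nu g0.
Local Notation adjR := (adjR B).
Local Notation adjL := (adjL B).
Local Notation skew_prim := (skew_prim B).

#[local] Opaque tens tmul rho pair2.

Lemma homog_e : homog ai e.
Proof. by have := @homog_gen I D g0; rewrite lev_g0. Qed.

Lemma hgt_ai : hgt D i ai = 2.
Proof. by rewrite hgtU mul1r; apply/eqP. Qed.

Lemma ai_neq0 : ai <> 0.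
Proof. by move/(congr1 (hgt D i)); rewrite hgt_ai /hgt lext0. Qed.

Lemma qq_rf_l b : qq ^ rf ai b = q ^ hgt D i b.
Proof. by rewrite rootformUl mul1r -exprz_exp. Qed.

Lemma qq_rf_r b : qq ^ rf b ai = q ^ hgt D i b.
Proof. by rewrite rootformC qq_rf_l. Qed.

Lemma prim_e : skew_prim ai e.
Proof.
apply: (@prim_of_rho _ _ _ _ formP _ _ e (fun n => n = 0)) => [n v y ->|||].
- by rewrite mulr0 (form_sym formP) (form_zero_r formP).
- exact: homog_e.
- exact: subrr.
by exists [::]; rewrite // rho_gen1 // subrr big_nil.
Qed.

Lemma pair2_rho_e f h b c u : weighted b f -> weighted c h ->
  pair2 f h (rho (u * e)) =
    q ^ hgt D i c * pair2 (fun v => f (v * e)) h (rho u) +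
    pair2 f (fun v => h (v * e)) (rho u).
Proof.
move=> wf wh; rewrite rhoM (rho_gen1 lev_g0) pair2_tmulD; congr (_ + _).
  rewrite (pair2_tmul_tens _ wf wh homog_e (@homog1 _ D)) subr0 qq_rf_r.
  by congr (_ * _); apply: pair2_ext => v; rewrite ?mulr1.
rewrite (pair2_tmul_tens _ wf wh (@homog1 _ D) homog_e) rootform0r mul1r.
by apply: pair2_ext => v; rewrite ?mulr1.
Qed.

(** As h kills right multiples of e, all N factors e go to the first tensor factor, each twisted by
    the weight c of the second. *)
Lemma pair2_rho_exp_r f h b c N u : weighted b f -> weighted c h ->
  (forall v, h (v * e) = 0) ->
  pair2 f h (rho (u * e ^+ N)) =
    q ^ (hgt D i c * N%:Z) * pair2 (fun v => f (v * e ^+ N)) h (rho u).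
Proof.
move=> wf wh h0; elim: N b f wf => [|N IH] b f wf.
  by rewrite mulr0 expr0z mul1r expr0 mulr1; apply: pair2_ext => v; rewrite ?mulr1.
rewrite exprSr mulrA (pair2_rho_e _ wf wh) (IH _ _ (weighted_mulr homog_e wf)).
rewrite -[X in _ + X]mul1r -pair2Zr.
(* The functional v -> h (v e) is zero; writing it as 0 times h lets [pair2Zr] remove the term. *)
rewrite [X in _ + X](@pair2_ext _ _ _ _ f (fun v => 0 * h v)); first last.
- by move=> v; rewrite h0 mulr0 mul0r.
- by [].
rewrite pair2Zr mul0r addr0 mulrA -expfzDr; last exact: expf_neq0 (qq_neq0).
rewrite -{1}[hgt D i c]mulr1 -mulrDr.
by congr (_ ^ (_ * _) * _); apply: pair2_ext => v; rewrite ?exprSr ?mulrA.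
Qed.

Lemma pair2_rho_exp_l f h b c N u : weighted b f -> weighted c h ->
  (forall v, f (v * e) = 0) ->
  pair2 f h (rho (u * e ^+ N)) = pair2 f (fun v => h (v * e ^+ N)) (rho u).
Proof.
move=> wf wh f0; elim: N c h wh => [|N IH] c h wh.
  by rewrite expr0 mulr1; apply: pair2_ext => v; rewrite ?mulr1.
rewrite exprSr mulrA (pair2_rho_e _ wf wh) (IH _ _ (weighted_mulr homog_e wh)).
rewrite (@pair2_ext _ _ _ h (fun v => 0 * f v) h); first last.
- by [].
- by move=> v; rewrite f0 mul0r.
rewrite pair2Zl mul0r mulr0 add0r.
by apply: pair2_ext => v; rewrite ?exprSr ?mulrA.
Qed.

Lemma adjL_mul b c y y' z z' :
  homog b y -> homog c z -> adjL e y y' -> adjL e z z' ->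
  adjL e (y * z) (y' * z + q ^ hgt D i b *: (y * z')).
Proof.
move=> hy hz ay az u; have wy := form_weighted formP hy.
rewrite (form_addr formP) (form_scaler formP) !(form_pair2 formP) rhoM (rho_gen1 lev_g0) tmulDl pair2D.
(* As e is a single word, [pair2_tmul_word] applies to both terms of rho e; the twist arises when e
   passes the first tensor factor, of weight b. *)
have eE : e = << [:: g0] >> by rewrite /e [gen]unlock.
have wg0 : wdeg [:: g0] = ai by rewrite /wdeg big_seq1 lev_g0.
have -> : tens e 1 = << ([:: g0], [::]) >> by rewrite eE free_one tensUU.
have -> : tens 1 e = << ([::], [:: g0]) >> by rewrite eE free_one tensUU.
congr (_ + _).
  rewrite (pair2_tmul_word _ _ _ _ wy) wdeg_nil rootform0l mul1r -eE -free_one.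
  by apply: pair2_ext => v; rewrite ?mul1r ?ay.
rewrite (pair2_tmul_word _ _ _ _ wy) wg0 wdeg_nil subr0 qq_rf_l -eE -free_one.
by congr (_ * _); apply: pair2_ext => v; rewrite ?mul1r ?az.
Qed.

Lemma adjR_mul_e b c y y' z z' :
  homog b y -> homog c z -> adjR e y y' -> adjR e z z' ->
  adjR e (y * z) (q ^ hgt D i c *: (y' * z) + y * z').
Proof. by move=> *; rewrite -qq_rf_r; apply: (adjR_mul formP prim_e); eassumption. Qed.

Lemma adjR_e_e : adjR e e (tau *: 1).
Proof.
rewrite /tau -(form_gen formP); exact: (adjR_prim formP prim_e prim_e ai_neq0).
Qed.

Lemma adjL_e_e : adjL e e (tau *: 1).
Proof.
rewrite /tau -(form_gen formP); exact: (adjL_prim formP prim_e prim_e ai_neq0).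
Qed.

Lemma homogB b (k : Qq) x y :
  homog b x -> homog b y -> homog b (x - k *: y).
Proof. by move=> hx hy; rewrite addrC -scaleNr; exact: homogP. Qed.

Section Sequences.
Variables (d : Q) (p : E) (pp : skew_prim d p) (d_ai : d <> ai).
Let c := hgt D i d.
Let F : nat -> E := qadR q c e p.
Let G : nat -> E := qadL q c e p.
Let wt m := d + ai *+ m.

(** Common to both strings: the adjoint of right multiplication by e lowers F_m to F_(m-1), that of
    left multiplication lowers G_m to G_(m-1), with this coefficient. *)
Fixpoint coef m : Qq :=
  if m is m'.+1 then tau * (1 - (q ^ (c + 2 * m'%:Z)) ^+ 2) + q ^ 2%:Z * coef m'
  else 0.

Lemma hgt_wt m : hgt D i (wt m) = c + 2 * m%:Z.
Proof.
rewrite /wt hgtD; congr (_ + _); elim: m => [|m IH].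
  by rewrite mulr0n /hgt lext0.
by rewrite mulrSr hgtD IH hgt_ai; lia.
Qed.

Lemma homog_qadR m : homog (wt m) (F m).
Proof.
elim: m => [|m IH]; first by rewrite /wt addr0; exact: skew_prim_homog pp.
have -> : wt m.+1 = wt m + ai by rewrite /wt mulrSr addrA.
apply: homogB; first exact: homogM IH homog_e.
by rewrite addrC; exact: homogM homog_e IH.
Qed.

Lemma homog_qadL m : homog (wt m) (G m).
Proof.
elim: m => [|m IH]; first by rewrite /wt addr0; exact: skew_prim_homog pp.
have -> : wt m.+1 = wt m + ai by rewrite /wt mulrSr addrA.
apply: homogB; last exact: homogM IH homog_e.
by rewrite addrC; exact: homogM homog_e IH.
Qed.

Lemma q_neq0 : q != 0.
Proof. exact: expf_neq0 qq_neq0. Qed.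

Lemma form_e_p : B e p = 0.
Proof. by apply: (form_orth formP homog_e (skew_prim_homog pp)) => /esym. Qed.

Lemma adjR_e_p : adjR e p 0.
Proof. by have := adjR_prim formP prim_e pp ai_neq0; rewrite form_e_p scale0r. Qed.

Lemma adjL_e_p : adjL e p 0.
Proof. by have := adjL_prim formP prim_e pp ai_neq0; rewrite form_e_p scale0r. Qed.

(** The factor q^(c + 2m) in F_(m+1) is exactly the twist that the Leibniz rule produces from F_m e,
    so the two terms in tau F_m cancel. *)
Lemma adjL_qadR m : adjL e (F m) 0.
Proof.
elim: m => [|m IH]; first exact: adjL_e_p.
have := adjL_lin formP (q ^ (c + 2 * m%:Z))
  (adjL_mul (@homog_qadR m) homog_e IH adjL_e_e)
  (adjL_mul homog_e (@homog_qadR m) adjL_e_e IH).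
by rewrite hgt_wt (cancel_left (@free_scaleAr _)).
Qed.

Lemma adjR_qadL m : adjR e (G m) 0.
Proof.
elim: m => [|m IH]; first exact: adjR_e_p.
have := adjR_lin formP (q ^ (c + 2 * m%:Z))
  (adjR_mul_e homog_e (@homog_qadL m) adjR_e_e IH)
  (adjR_mul_e (@homog_qadL m) homog_e IH adjR_e_e).
by rewrite hgt_wt (cancel_right (@free_scaleAr _)).
Qed.

Lemma q_shift m : q ^ (c + 2 * m.+1%:Z) = q ^ 2%:Z * q ^ (c + 2 * m%:Z).
Proof. by rewrite -expfzDr ?q_neq0 //; congr (_ ^ _); lia. Qed.

Lemma adjR_qadR m : adjR e (F m.+1) (coef m.+1 *: F m).
Proof.
have step s x' k' n : adjR e (F n) (s *: x') ->
    q ^ (c + 2 * n%:Z) = q ^ 2%:Z * k' ->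
    s *: F n = s *: (x' * e - k' *: (e * x')) ->
    adjR e (F n.+1) ((tau * (1 - (q ^ (c + 2 * n%:Z)) ^+ 2) + q ^ 2%:Z * s) *: F n).
  move=> IH hk hF; have := adjR_lin formP (q ^ (c + 2 * n%:Z))
    (adjR_mul_e (@homog_qadR n) homog_e IH adjR_e_e)
    (adjR_mul_e homog_e (@homog_qadR n) adjR_e_e IH).
  by rewrite hgt_wt hgt_ai (lower_right (@free_scaleAr _) _ hk hF).
elim: m => [|m IH].
  (* F_0 has no predecessor in the string: s = 0 and x' = 0, with k' chosen to fit k = q^2 k'. *)
  apply: (step 0 0 (q ^ (c - 2))); last by rewrite !scale0r.
    by rewrite scale0r; exact: adjR_e_p.
  by rewrite -expfzDr ?q_neq0 //; congr (_ ^ _); lia.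
by apply: (step _ _ (q ^ (c + 2 * m%:Z)) _ IH); first exact: q_shift.
Qed.

Lemma adjL_qadL m : adjL e (G m.+1) (coef m.+1 *: G m).
Proof.
have step s x' k' n : adjL e (G n) (s *: x') ->
    q ^ (c + 2 * n%:Z) = q ^ 2%:Z * k' ->
    s *: G n = s *: (e * x' - k' *: (x' * e)) ->
    adjL e (G n.+1) ((tau * (1 - (q ^ (c + 2 * n%:Z)) ^+ 2) + q ^ 2%:Z * s) *: G n).
  move=> IH hk hG; have := adjL_lin formP (q ^ (c + 2 * n%:Z))
    (adjL_mul homog_e (@homog_qadL n) adjL_e_e IH)
    (adjL_mul (@homog_qadL n) homog_e IH adjL_e_e).
  by rewrite hgt_wt hgt_ai (lower_left (@free_scaleAr _) _ hk hG).
elim: m => [|m IH].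
  apply: (step 0 0 (q ^ (c - 2))); last by rewrite !scale0r.
    by rewrite scale0r; exact: adjL_e_p.
  by rewrite -expfzDr ?q_neq0 //; congr (_ ^ _); lia.
by apply: (step _ _ (q ^ (c + 2 * m%:Z)) _ IH); first exact: q_shift.
Qed.

Section Derivation.
Variables (dh : Q) (h : E) (ph : skew_prim dh h) (dh_ai : dh <> ai) (dh0 : dh <> 0).
Variables (t : Qq) (adjR_h_p : adjR h p (t *: 1)) (t_dh : t = 0 \/ dh = d).

Lemma adjR_h_e : adjR h e 0.
Proof.
have := adjR_prim formP ph prim_e dh0.
by rewrite (form_orth formP (skew_prim_homog ph) homog_e dh_ai) scale0r.
Qed.

Lemma t_hgt : t * q ^ hgt D i dh = t * q ^ c.
Proof. by case: t_dh => ->; rewrite ?mul0r. Qed.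

(** The case of F_1 decides: if t is nonzero then dh = d, and h passes e with the twist q^c, the
    very coefficient in F_1. *)
Lemma adjR_h_qadR m : adjR h (F m.+1) 0.
Proof.
elim: m => [|m IH].
  have := adjR_lin formP (q ^ (c + 2 * 0%:Z))
    (adjR_mul formP ph (@homog_qadR 0) homog_e adjR_h_p adjR_h_e)
    (adjR_mul formP ph homog_e (@homog_qadR 0) adjR_h_e adjR_h_p).
  rewrite (derive_first (@free_scaleAr _)).
  have -> : t * qq ^ rf ai dh - t * q ^ (c + 2 * 0%:Z) = 0.
    by rewrite qq_rf_l t_hgt mulr0 addr0 subrr.
  by rewrite scale0r.
have := adjR_lin formP (q ^ (c + 2 * m.+1%:Z))
  (adjR_mul formP ph (@homog_qadR m.+1) homog_e IH adjR_h_e)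
  (adjR_mul formP ph homog_e (@homog_qadR m.+1) adjR_h_e IH).
by rewrite derive_null.
Qed.

(** The adjoint of right multiplication by h strips p from G_m and leaves this multiple of e^m; each
    q-commutation with e contributes one factor. *)
Fixpoint topcoef m : Qq :=
  if m is m'.+1 then topcoef m' * (1 - q ^ (2 * (c + m'%:Z))) else t.

Lemma topcoef_hgt m : topcoef m * q ^ hgt D i dh = topcoef m * q ^ c.
Proof. by elim: m => [|m IH] /=; rewrite ?t_hgt // mulrAC IH mulrAC. Qed.

Lemma adjR_h_qadL m : adjR h (G m) (topcoef m *: e ^+ m).
Proof.
elim: m => [|m IH]; first exact: adjR_h_p.
have := adjR_lin formP (q ^ (c + 2 * m%:Z))
  (adjR_mul formP ph homog_e (@homog_qadL m) adjR_h_e IH)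
  (adjR_mul formP ph (@homog_qadL m) homog_e IH adjR_h_e).
rewrite (derive_exp (@free_scaleAr _)) qq_rf_l topcoef_hgt.
suff -> : topcoef m.+1 = topcoef m - q ^ (c + 2 * m%:Z) * (topcoef m * q ^ c) by [].
rewrite /= mulrBr mulr1 mulrCA -expfzDr ?q_neq0 //; congr (_ - _ * _ ^ _); lia.
Qed.

End Derivation.

End Sequences.

(** This is 1 + q^2 + ... + q^(2(m-1)). *)
Fixpoint qsum m : Qq := if m is m'.+1 then q ^ 2%:Z * qsum m' + 1 else 0.

Lemma adjR_e_exp m : adjR e (e ^+ m.+1) ((tau * qsum m.+1) *: e ^+ m).
Proof.
elim: m => [|m IH].
  by rewrite /= mulr0 add0r mulr1 expr0 expr1; exact: adjR_e_e.
have homog_exp n : homog (ai *+ n) (e ^+ n).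
  elim: n => [|n IHn]; first exact: homog1.
  by rewrite exprSr mulrSr; exact: homogM IHn homog_e.
have := adjR_mul_e (@homog_exp m.+1) homog_e IH adjR_e_e.
rewrite hgt_ai (exp_step (@free_scaleAr _)) -[e ^+ m.+1 * e]exprSr.
suff -> : tau * qsum m.+2 = q ^ 2%:Z * (tau * qsum m.+1) + tau by [].
by rewrite [qsum m.+2]/= [tau * (_ + 1)]mulrDr mulr1 [tau * (_ * _)]mulrCA.
Qed.

Lemma form_exp m k v : (k <= m)%N ->
  B (v * e ^+ m) (e ^+ k) =
    if m == k then (\prod_(1 <= j < k.+1) (tau * qsum j)) * B v 1 else 0.
Proof.
elim: k m v => [|k IH] [|m] v // km.
- by rewrite expr0 mulr1 big_geq // mul1r.
- rewrite expr0 exprSr mulrA (adjR_one formP homog_e ai_neq0).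
  exact: form_zero_r formP _.
rewrite exprSr mulrA adjR_e_exp (form_scaler formP) IH // eqSS.
case: eqP => _; last by rewrite mulr0.
by rewrite [in RHS]big_nat_recr //; exact: etrans (mulrCA _ _ _) (mulrA _ _ _).
Qed.

Section Top.
Variables (dh : Q) (h : E) (ph : skew_prim dh h).

(** Although e^N h is not primitive, its adjoint is a skew derivation where the adjoint of e
    vanishes: h goes to one tensor factor, and all of e^N must follow it, since the other factor is
    killed by e. *)
Lemma adjR_top_mul N b c y y' z z' :
  homog b y -> homog c z -> adjR e y 0 -> adjR e z 0 ->
  adjR (e ^+ N * h) y y' -> adjR (e ^+ N * h) z z' ->
  adjR (e ^+ N * h) (y * z)
    ((qq ^ rf c dh * q ^ (hgt D i c * N%:Z)) *: (y' * z) + y * z').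
Proof.
move=> hy hz ey ez ay az v.
have [wy wz] := (form_weighted formP hy, form_weighted formP hz).
have kill x : adjR e x 0 -> forall v, B (v * e) x = 0.
  by move=> ex u; rewrite ex (form_zero_r formP).
rewrite mulrA (skew_prim_mul ph _ hy hz) (form_addr formP) (form_scaler formP).
rewrite !(form_pair2 formP).
rewrite (pair2_rho_exp_r _ _ (weighted_mulr (skew_prim_homog ph) wy) wz (kill _ ez)).
rewrite (pair2_rho_exp_l _ _ wy (weighted_mulr (skew_prim_homog ph) wz) (kill _ ey)).
by rewrite mulrA; congr (_ * _ + _); apply: pair2_ext => u; rewrite -?ay -?az -?mulrA.
Qed.

End Top.

(** G_m differs from e^m p by right multiples of e, and y does not see those. *)
Lemma form_qadL_top (q' : int) p m v y :
  (forall u, B (u * e) y = 0) ->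
  B (v * qadL q q' e p m) y = B (v * (e ^+ m * p)) y.
Proof.
move=> ey; elim: m v => [|m IH] v; first by rewrite expr0 mul1r.
rewrite /= mulrBr -free_scaleAr (form_subl formP) (form_scalel formP).
by rewrite !mulrA ey mulr0 subr0 IH exprS !mulrA.
Qed.

End RankOne.

(** * Closed forms of the q-commutators in divided powers *)

Section DividedPowers.
Variables (I : countType) (D : BCdatum I) (i : I).
Local Notation q := (qi D i).
Local Notation "[ 'q' n ]" := (qint D i n) (format "[ 'q' n ]").

(** The coefficients of f(i,(j,l),m) for c = l a_ij; at c = -m they become those of L''(a_jl). *)
Definition qcoef (c : int) (m k : nat) : Qq :=
  (-1) ^+ k * q ^ (k%:Z * (c + m%:Z - 1)).

Lemma qi_neq0 : q != 0.
Proof. exact: expf_neq0 qq_neq0. Qed.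

Lemma qi_exp_neq1 n : (0 < n)%N -> q ^+ n != 1.
Proof. by move=> n0; rewrite -exprM qq_exp_neq1 // muln_gt0 symm_gt0. Qed.

Lemma qi_subV_neq0 n : (0 < n)%N -> q ^+ n - q ^- n != 0.
Proof.
move=> n0; rewrite subr_eq0; apply: contra (qi_exp_neq1 (ltn_addl n n0)).
by move/eqP => qV; rewrite exprD {1}qV mulVf // expf_neq0 // qi_neq0.
Qed.

Lemma qint_neq0 n : (0 < n)%N -> [q n] != 0.
Proof.
move=> n0; apply: mulf_neq0; first exact: qi_subV_neq0.
by rewrite invr_eq0; exact: (@qi_subV_neq0 1).
Qed.

Lemma qint0 : [q 0] = 0.
Proof. by rewrite /qint !expr0 invr1 subrr mul0r. Qed.

Lemma qfactS n : qfact D i n.+1 = qfact D i n * [q n.+1].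
Proof. by rewrite /qfact big_nat_recr. Qed.

Lemma qfact_neq0 n : qfact D i n != 0.
Proof.
elim: n => [|n IH]; first by rewrite /qfact big_geq // oner_eq0.
by rewrite qfactS mulf_neq0 ?qint_neq0.
Qed.

(** A q-Pascal rule: it compares the two ways of enlarging a divided power, on the right and on the
    left of a. *)
Lemma qcoef_rec c m k : (k <= m)%N ->
  qcoef c m k.+1 * [q m.+1 - k.+1] -
    q ^ (c + 2 * m%:Z) * (qcoef c m k * [q k.+1]) = qcoef c m.+1 k.+1 * [q m.+1].
Proof.
move=> km; rewrite /qcoef /qint !mulrA -!mulrBl; congr (_ / _).
have q0 := qi_neq0; have e0 n : q ^+ n != 0 by exact: expf_neq0.
pose W := q ^ (k%:Z * (c + m%:Z - 1)); pose V := q ^ (c + m%:Z).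
have -> : q ^ (k.+1%:Z * (c + m%:Z - 1)) = W * (V / q).
  by rewrite -[q^-1]exprN1 -!expfzDr //; congr (_ ^ _); lia.
have -> : q ^ (k.+1%:Z * (c + m.+1%:Z - 1)) = W * q ^+ k * V.
  by rewrite -[q ^+ k]/(q ^ k%:Z) -!expfzDr //; congr (_ ^ _); lia.
have -> : q ^ (c + 2 * m%:Z) = V * q ^+ m.
  by rewrite -[q ^+ m]/(q ^ m%:Z) -expfzDr //; congr (_ ^ _); lia.
have -> : q ^+ (m.+1 - k.+1) = q ^+ m / q ^+ k.
  by rewrite subSS -[in RHS](subnK km) exprD mulfK.
rewrite -/W !exprS; field.
by rewrite q0 !e0.
Qed.

Lemma qcoef0 c m : qcoef c m 0 = 1.
Proof. by rewrite /qcoef mul0r expr0 mul1r. Qed.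

Lemma qcoef_sum_rec (V : lmodType Qq) (T : nat -> V) c m :
  \sum_(k < m.+1) (qcoef c m k * [q m.+1 - k]) *: T k -
    q ^ (c + 2 * m%:Z) *: \sum_(k < m.+1) (qcoef c m k * [q k.+1]) *: T k.+1 =
  [q m.+1] *: \sum_(k < m.+2) qcoef c m.+1 k *: T k.
Proof.
have -> : \sum_(k < m.+1) (qcoef c m k * [q m.+1 - k]) *: T k =
    \sum_(k < m.+2) (qcoef c m k * [q m.+1 - k]) *: T k.
  by rewrite [RHS]big_ord_recr /= subnn qint0 mulr0 scale0r addr0.
rewrite !scaler_sumr [in LHS]big_ord_recl [in RHS]big_ord_recl /= -addrA; congr (_ + _).
  by rewrite !qcoef0 mul1r subn0 scalerA mulr1.
rewrite -sumrB; apply: eq_bigr => k _.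
by rewrite !scalerA -scalerBl /bump /= !add1n qcoef_rec 1?mulrC // -ltnS.
Qed.

Section ClosedForms.
Variables (A : algType Qq) (e a : A) (c : int).

Lemma dpowS n : [q n.+1] *: dpow D i e n.+1 = e * dpow D i e n.
Proof.
rewrite /dpow -scalerAr -exprS scalerA qfactS invfM mulrCA.
by rewrite mulfV ?mulr1 // qint_neq0.
Qed.

Lemma dpowSr n : [q n.+1] *: dpow D i e n.+1 = dpow D i e n * e.
Proof. by rewrite dpowS /dpow -scalerAr -scalerAl -exprS -exprSr. Qed.

Lemma dpow0 : dpow D i e 0 = 1.
Proof. by rewrite /dpow /qfact big_geq // invr1 scale1r expr0. Qed.

Lemma qadR_closed m :
  qadR q c e a m =
    qfact D i m *: \sum_(k < m.+1) qcoef c m k *: (dpow D i e k * a * dpow D i e (m - k)).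
Proof.
elim: m => [|m IH].
  by rewrite big_ord1 qcoef0 !dpow0 mulr1 mul1r scale1r /qfact big_geq // scale1r.
rewrite /= IH -scalerAl -scalerAr scalerA mulrC -scalerA -scalerBr qfactS -scalerA.
rewrite -(qcoef_sum_rec (fun k => dpow D i e k * a * dpow D i e (m.+1 - k))).
congr (_ *: (_ - _ *: _)).
  rewrite mulr_suml; apply: eq_bigr => k _; rewrite -scalerAl -scalerA; congr (_ *: _).
  by rewrite -[LHS]mulrA -dpowSr -scalerAr subSn // -ltnS.
rewrite mulr_sumr; apply: eq_bigr => k _; rewrite -scalerAr -scalerA; congr (_ *: _).
by rewrite !mulrA -dpowS -!scalerAl ?subSS.
Qed.

Lemma qadL_closed m :
  qadL q c e a m =
    qfact D i m *: \sum_(k < m.+1) qcoef c m k *: (dpow D i e (m - k) * a * dpow D i e k).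
Proof.
elim: m => [|m IH].
  by rewrite big_ord1 qcoef0 !dpow0 mulr1 mul1r scale1r /qfact big_geq // scale1r.
rewrite /= IH -scalerAl -scalerAr scalerA mulrC -scalerA -scalerBr qfactS -scalerA.
rewrite -(qcoef_sum_rec (fun k => dpow D i e (m.+1 - k) * a * dpow D i e k)).
congr (_ *: (_ - _ *: _)).
  rewrite mulr_sumr; apply: eq_bigr => k _; rewrite -scalerAr -scalerA; congr (_ *: _).
  by rewrite !mulrA -dpowS -!scalerAl subSn // -ltnS.
rewrite mulr_suml; apply: eq_bigr => k _; rewrite -scalerAl -scalerA; congr (_ *: _).
by rewrite -[LHS]mulrA -dpowSr -scalerAr ?subSS.
Qed.

End ClosedForms.

End DividedPowers.

(** * The reflection on q-commutators, in an abstract algebra *)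

Lemma lin_comb6 (V : lmodType Qq) (a b d f k l : Qq) (x1 x2 x3 x4 x5 x6 : V) :
  x1 + a *: x2 - b *: x3 + d *: x4 - k *: (x5 + l *: x2 - l *: x3 + f *: x6) =
  (x1 - k *: x5) + (a - k * l) *: x2 + (k * l - b) *: x3 + (d *: x4 - (k * f) *: x6).
Proof.
rewrite !scalerDr scalerN !scalerA 3!opprD addrACA [X in X + _]addrACA.
rewrite [X in X + _ + _]addrACA opprK !scalerBl; congr (_ + _ + _).
by rewrite addrC.
Qed.

Section ReflectionRecursion.
Variables (A : algType Qq) (q c0 : Qq) (q0 : q != 0) (e B K K' : A).
Hypotheses (KK' : K * K' = 1) (K'K : K' * K = 1).
Hypothesis Ke : K * e = q ^ 2%:Z *: (e * K).
Hypothesis Be : B * e = e * B + c0 *: (K - K').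

Lemma Kinv_comm (k : Qq) x : k != 0 -> K * x = k *: (x * K) -> K' * x = k^-1 *: (x * K').
Proof.
move=> k0 Kx; have <- : k *: (K' * x) = x * K'.
  by rewrite -[x in RHS]mul1r -K'K -(mulrA K') Kx -scalerAr -scalerAl -!mulrA KK' mulr1.
by rewrite scalerA mulVf // scale1r.
Qed.

(** The terms in G K cancel and those in G K' leave c0 (k - k^-1). Since K' e = q^(-2) e K' and k =
    q^2 k', the terms in G' regroup into s G K'. *)
Lemma commutator_step (G G' : A) (k k' s : Qq) :
  k != 0 -> K * G = k *: (G * K) -> B * G = G * B + s *: (G' * K') ->
  k = q ^ 2%:Z * k' -> s *: G = s *: (e * G' - k' *: (G' * e)) ->
  B * (e * G - k *: (G * e)) =
    (e * G - k *: (G * e)) * B + (c0 * (k - k^-1) + s) *: (G * K').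
Proof.
move=> k0 KG BG kk' sG; have K'G := Kinv_comm k0 KG.
have q20 : q ^ 2%:Z != 0 by exact: expfz_neq0.
have K'e := Kinv_comm q20 Ke.
have -> : B * (e * G - k *: (G * e)) = e * G * B + (k * c0) *: (G * K)
   - (c0 * k^-1) *: (G * K') + s *: (e * G' * K') -
   k *: (G * e * B + c0 *: (G * K) - c0 *: (G * K') + (s * (q ^ 2%:Z)^-1) *: (G' * e * K')).
  rewrite mulrBr -scalerAr; congr (_ - _ *: _).
    have -> : B * (e * G) = e * (B * G) + c0 *: (K * G - K' * G).
      by rewrite mulrA Be mulrDl -scalerAl mulrBl -mulrA.
    rewrite BG KG K'G mulrDr mulrA -scalerAr mulrA scalerBr !scalerA [k * _]mulrC.
    by rewrite addrAC addrA.
  have -> : B * (G * e) = G * (B * e) + s *: (G' * (K' * e)).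
    by rewrite mulrA BG mulrDl -scalerAl !mulrA.
  rewrite Be K'e mulrDr mulrA -!scalerAr mulrBr scalerBr !mulrA scalerA.
  by rewrite !addrA.
rewrite lin_comb6 subrr scale0r addr0 -[LHS]addrA; congr (_ + _).
  by rewrite mulrBl -scalerAl.
rewrite [in RHS]scalerDl [k * c0]mulrC -mulrBr; congr (_ + _).
rewrite [s *: (G * K')]scalerAl sG -scalerAl mulrBl scalerBr -scalerAl scalerA.
by congr (_ - _ *: _); rewrite kk'; field.
Qed.

Variables (a : A) (c : int).
Hypotheses (Ka : K * a = q ^ c *: (a * K)) (Ba : B * a = a * B).
Let F := qadR q c e a.
Let G := qadL q c e a.

(** The quantum sl_2 constants: [B, G_m] = delta_m G_(m-1) K'. *)
Fixpoint delta m : Qq :=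
  if m is m'.+1 then
    c0 * (q ^ (c + 2 * m'%:Z) - (q ^ (c + 2 * m'%:Z))^-1) + delta m'
  else 0.

Lemma K_qadL m : K * G m = q ^ (c + 2 * m%:Z) *: (G m * K).
Proof.
elim: m => [|m IH]; first by rewrite mulr0 addr0.
have -> : q ^ (c + 2 * m.+1%:Z) = q ^ (c + 2 * m%:Z) * q ^ 2%:Z.
  by rewrite -expfzDr //; congr (_ ^ _); lia.
rewrite /G /= -/G mulrBr mulrBl scalerBr; congr (_ - _).
  by rewrite mulrA Ke -scalerAl -mulrA IH -scalerAr mulrA scalerA mulrC.
rewrite -scalerAr mulrA IH -!scalerAl -mulrA Ke -scalerAr mulrA !scalerA.
by congr (_ *: _); ring.
Qed.

Lemma B_qadL m : B * G m.+1 = G m.+1 * B + delta m.+1 *: (G m * K').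
Proof.
have k0 n : q ^ (c + 2 * n%:Z) != 0 by exact: expfz_neq0.
elim: m => [|m IH].
  apply: (@commutator_step _ 0 _ (q ^ (c - 2)) _ (k0 0%N) (K_qadL 0)).
  - by rewrite scale0r addr0.
  - by rewrite -expfzDr //; congr (_ ^ _); lia.
  - by rewrite !scale0r.
apply: (@commutator_step _ _ _ (q ^ (c + 2 * m%:Z)) _ (k0 m.+1) (K_qadL m.+1) IH _ (erefl _)).
by rewrite -expfzDr //; congr (_ ^ _); lia.
Qed.

Lemma B_qadL_pred m : B * G m = G m * B + delta m *: (G m.-1 * K').
Proof. by case: m => [|m]; [rewrite scale0r addr0 | exact: B_qadL]. Qed.

Variables (N : nat) (g : Qq) (L : {lrmorphism A -> A}).
Hypotheses (cN : c = - N%:Z) (Le : L e = - (B * K)) (La : L a = g *: G N).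

Let LZ (k : Qq) x : L (k *: x) = k *: L x. Proof. exact: linearZ. Qed.
Let LB x y : L (x - y) = L x - L y. Proof. exact: rmorphB. Qed.
Let LM x y : L (x * y) = L x * L y. Proof. exact: rmorphM. Qed.

(** Each further e in F_m becomes a commutator with B that lowers the image once: the constants are
    delta_N, delta_(N-1), and so on. *)
Fixpoint gamma m : Qq := if m is m'.+1 then gamma m' * delta (N - m') else g.

Lemma L_qadR_step m : (m <= N)%N -> L (F m) = gamma m *: G (N - m) ->
  L (F m.+1) = gamma m.+1 *: G (N - m).-1.
Proof.
move=> mN LF; rewrite /F /= -/F LB LZ !LM LF Le.
have BKG : B * K * G (N - m) = q ^ (c + 2 * (N - m)%:Z) *: (B * G (N - m) * K).
  by rewrite -mulrA K_qadL -scalerAr mulrA.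
rewrite mulrN mulNr scalerN opprK -scalerAl -scalerAr BKG !scalerA.
(* Since c = -N the powers of q cancel, and the q-commutator turns into the plain commutator of B
   with G_(N-m). *)
have -> : q ^ (c + 2 * m%:Z) * gamma m * q ^ (c + 2 * (N - m)%:Z) = gamma m.
  rewrite mulrAC -expfzDr // (_ : _ + _ = 0) ?expr0z ?mul1r //; lia.
rewrite addrC -scalerBr mulrA -mulrBl B_qadL_pred [X in X - _]addrC addrK.
by rewrite -scalerAl -mulrA K'K mulr1 scalerA.
Qed.

Lemma L_qadR m : (m <= N)%N -> L (F m) = gamma m *: G (N - m).
Proof.
elim: m => [|m IH] mN; first by rewrite subn0.
by rewrite subnS; apply: L_qadR_step; [exact: ltnW | exact: IH (ltnW mN)].
Qed.

(** One step past the bottom of the string: G_0 = a commutes with B, that is, delta_0 = 0. *)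
Lemma L_qadR_top : L (F N.+1) = 0.
Proof.
by rewrite (L_qadR_step (leqnn N) (L_qadR (leqnn N))) /= subnn mulr0 scale0r.
Qed.

(** Applying L to [B, a] = 0 shows that K' e commutes with G_N; clearing K' gives e G_N = q^(c + 2N)
    G_N e. *)
Lemma qadL_top : g != 0 -> L B = - (K' * e) -> G N.+1 = 0.
Proof.
move=> g0 LB'; have := congr1 L Ba; rewrite !LM LB' La => /eqP.
rewrite mulNr mulrN eqr_opp -scalerAr -scalerAl => /eqP/(scalerI g0) eqG.
rewrite /G /= -/G; apply/eqP; rewrite subr_eq0; apply/eqP.
have := congr1 ( *%R K) eqG; rewrite !mulrA KK' mul1r => ->.
by rewrite K_qadL -!scalerAl -[_ * K * K']mulrA KK' mulr1.
Qed.

End ReflectionRecursion.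

(** * Relations in the quantum group *)

Section Presented.
Variables (X : choiceType) (R : relations X).
Local Notation pr := (presented_pi R).

Lemma presented_rel x y : R x y -> pr x = pr y.
Proof. by move=> Rxy; apply/presented_piP; exact: relideal_rel. Qed.

Lemma presented_piD x y : pr (x + y) = pr x + pr y.
Proof. by rewrite -pi_addE. Qed.

Lemma presented_piM x y : pr (x * y) = pr x * pr y.
Proof. by rewrite -pi_mulE. Qed.

Lemma presented_piZ (k : Qq) x : pr (k *: x) = k *: pr x.
Proof. by rewrite -pi_scaleE. Qed.

Lemma presented_pi1 : pr 1 = 1.
Proof. by []. Qed.

Lemma presented_pi_sum n (k : 'I_n -> Qq) (F1 F2 F3 : 'I_n -> freealg X) :
  pr (\sum_(r < n) k r *: (F1 r * F2 r * F3 r)) =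
    \sum_(r < n) k r *: (pr (F1 r) * pr (F2 r) * pr (F3 r)).
Proof.
have -> : pr (\sum_(r < n) k r *: (F1 r * F2 r * F3 r)) =
    \sum_(r < n) pr (k r *: (F1 r * F2 r * F3 r)).
  exact: (big_morph pr presented_piD).
by apply: eq_bigr => r _; rewrite presented_piZ !presented_piM.
Qed.

End Presented.

Section QuantumGroupRelations.
Variables (I : countType) (D : BCdatum I) (nu : Iinf D -> Qq).
Local Notation U := (Uq nu).
Local Notation pr := (presented_pi (Urelations nu)).
Local Notation q i := (qi D i).

Lemma qU0 : qU nu 0 = 1 :> U.
Proof. exact: (presented_rel (R := Urelations nu) (Urel_q0 nu)). Qed.

Lemma qUD h h' : qU nu (h + h') = qU nu h * qU nu h'.
Proof.
rewrite -presented_piM; apply: esym.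
exact: (presented_rel (R := Urelations nu) (Urel_qD nu h h')).
Qed.

Lemma qU_comm h (x : U) (k : Qq) :
  qU nu h * x * qU nu (- h) = k *: x -> qU nu h * x = k *: (x * qU nu h).
Proof.
move=> hx; rewrite scalerAl -hx -(mulrA _ (qU nu (- h))) -qUD addNr qU0 mulr1.
by [].
Qed.

Lemma qU_eU h g :
  qU nu h * eU nu g = qq ^ ((lev g)%:Z * alpha D (idx g) h) *: (eU nu g * qU nu h).
Proof.
apply: qU_comm; rewrite -!presented_piM -presented_piZ.
exact: (presented_rel (R := Urelations nu) (Urel_qe nu h g)).
Qed.

Lemma qU_fU h g :
  qU nu h * fU nu g = qq ^ (- ((lev g)%:Z * alpha D (idx g) h)) *: (fU nu g * qU nu h).
Proof.
apply: qU_comm; rewrite -!presented_piM -presented_piZ.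
exact: (presented_rel (R := Urelations nu) (Urel_qf nu h g)).
Qed.

Lemma eU_fU_comm g g' : idx g != idx g' -> eU nu g * fU nu g' = fU nu g' * eU nu g.
Proof.
move=> gg'; rewrite -!presented_piM.
exact: (presented_rel (R := Urelations nu) (Urel_ef nu gg')).
Qed.

Lemma alpha_coroot j m i : alpha D j (coroot m i) = m * cartan D i j.
Proof.
rewrite /alpha mcoeff0 addr0.
exact: (lextU (fun k => cartan D k j : int^o) m i).
Qed.

Lemma KU0 i : KU nu i 0 = 1.
Proof. by rewrite /KU mulr0 /coroot monalgU0 -[RHS]qU0. Qed.

Lemma KUD i m n : KU nu i (m + n) = KU nu i m * KU nu i n.
Proof.
rewrite /KU -qUD; congr (qU nu _); rewrite mulrDr /coroot monalgUD.
by congr pair; rewrite /= addr0.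
Qed.

Lemma KU_eU i n g :
  KU nu i n * eU nu g = q i ^ (n * ((lev g)%:Z * cartan D i (idx g))) *: (eU nu g * KU nu i n).
Proof.
rewrite qU_eU alpha_coroot; congr (_ *: _).
rewrite /qi -[qq ^+ _]/(qq ^ (symm D i)%:Z) exprz_exp; congr (_ ^ _); ring.
Qed.

Lemma KU_fU i n g :
  KU nu i n * fU nu g = q i ^ (- (n * ((lev g)%:Z * cartan D i (idx g)))) *: (fU nu g * KU nu i n).
Proof.
rewrite qU_fU alpha_coroot; congr (_ *: _).
rewrite /qi -[qq ^+ _]/(qq ^ (symm D i)%:Z) exprz_exp; congr (_ ^ _); ring.
Qed.

Lemma eU_fU_same g : lev g = 1%N ->
  eU nu g * fU nu g =
    fU nu g * eU nu g + nu g *: (KU nu (idx g) (-1) - KU nu (idx g) 1).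
Proof.
move=> lg; have gg : in_Iinf D (idx g, 1%N).
  by have := valP g; rewrite -lg /idx /lev -surjective_pairing.
have E := presented_rel (R := Urelations nu) (Urel_ef_same nu gg gg).
have {E} := etrans (esym (presented_pi_sum _ _ _ _ _)) (etrans E (presented_pi_sum _ _ _ _ _)).
have ext1 (A : pzRingType) (F : Iinf D -> A) k : (k <= 1)%N ->
    ext F (idx g) k = if k == 0%N then 1 else F g.
  by case: k => [|[|k]] // _; rewrite -lg ext_gen lg.
have o0 : nat_of_ord (ord0 : 'I_2) = 0%N by [].
have o1 : nat_of_ord (lift ord0 (ord0 : 'I_1)) = 1%N by [].
rewrite minnn !big_ord_recl !big_ord0 !ext1 // o0 o1.
rewrite subn0 subnn eqxx oner_eq0 subrr !mulr0 expr0z !mul1r.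
rewrite oppr0 !presented_pi1 !scale1r !addr0 !mulr1.
rewrite -[pr (genK D (idx g) 0)]/(KU nu (idx g) 0) KU0 !mul1r => H.
rewrite -[eU nu g * _](addrK (nu g *: KU nu (idx g) 1)).
have -> : eU nu g * fU nu g + nu g *: KU nu (idx g) 1 =
    fU nu g * eU nu g + nu g *: KU nu (idx g) (-1) by [].
by rewrite -addrA -scalerBr.
Qed.

Lemma piU_linear (k : Qq) x y : piU nu (k *: x + y) = k *: piU nu x + piU nu y.
Proof. exact: evalfree_linear. Qed.

Lemma piUM x y : piU nu (x * y) = piU nu x * piU nu y.
Proof. exact: evalfreeM. Qed.

Lemma piU1 : piU nu 1 = 1.
Proof. exact: evalfree1. Qed.

Lemma piU_gen g : piU nu (gen g) = eU nu g.
Proof. exact: evalfree_gen. Qed.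

Lemma piU0 : piU nu 0 = 0.
Proof. by rewrite /piU evalfree_lext lext0. Qed.

Lemma piUZ (k : Qq) x : piU nu (k *: x) = k *: piU nu x.
Proof. by rewrite -[k *: x]addr0 piU_linear piU0 addr0. Qed.

Lemma piUB x y : piU nu (x - y) = piU nu x - piU nu y.
Proof. by rewrite addrC -scaleN1r piU_linear scaleN1r addrC. Qed.

Lemma KU_homog i n b x : homog b x ->
  KU nu i n * piU nu x = q i ^ (n * hgt D i b) *: (piU nu x * KU nu i n).
Proof.
move=> hx; elim/homog_ind: hx => [|k y z IHy IHz|w <-].
- by rewrite piU0 mulr0 mul0r scaler0.
- rewrite piU_linear mulrDr mulrDl -scalerAr -scalerAl IHy IHz scalerDr !scalerA.
  by rewrite [k * _]mulrC.
rewrite /piU evalfree_lext lextU1; elim: w => [|g w IH].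
  by rewrite big_nil wdeg_nil /hgt lext0 mulr0 expr0z scale1r mul1r mulr1.
rewrite big_cons mulrA KU_eU -scalerAl -mulrA IH -scalerAr scalerA.
rewrite -expfzDr ?qi_neq0 //; congr (_ ^ _ *: _); last by rewrite mulrA.
by rewrite -[in RHS]cat1s wdeg_cat hgtD mulrDr [wdeg [:: g]]big_seq1 hgtU mulrA.
Qed.

Lemma subalg_comm (A : algType Qq) (S : A -> Prop) (y x : A) :
  (forall z, S z -> y * z = z * y) -> subalg S x -> y * x = x * y.
Proof.
move=> Sy; elim=> {x} [x /Sy||||] //.
- by rewrite mulr1 mul1r.
- by move=> k x _ IH; rewrite -scalerAr IH scalerAl.
- by move=> x z _ IHx _ IHz; rewrite mulrDr mulrDl IHx IHz.
- by move=> x z _ IHx _ IHz; rewrite mulrA IHx -mulrA IHz mulrA.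
Qed.

End QuantumGroupRelations.

(** * Matching the constants of the form with those of the commutators *)

Section StructureConstants.
Variables (I : countType) (D : BCdatum I) (nu : Iinf D -> Qq) (g0 : Iinf D).
Let i : I := idx g0.
Let q : Qq := qi D i.
Let tau : Qq := nu g0.
Let c0 : Qq := (q^-1 - q)^-1.

Let q0 : q != 0. Proof. exact: qi_neq0. Qed.

Lemma q2_neq1 : q * q - 1 != 0.
Proof. by rewrite subr_eq0 -expr2 qi_exp_neq1. Qed.

(** The adjoint of left multiplication by e and the commutator with B both lower G_m to G_(m-1).
    With k = q^(c + 2m) their increments agree up to scalars, as 1 - k^2 = -k (k - k^-1) and c0 (q -
    q^-1) = -1. *)
Lemma coef_delta d m :
  coef nu g0 d m.+1 =
    tau * (q - q^-1) * q ^ (hgt D i d + 2 * m%:Z) * delta q c0 (hgt D i d) m.+1.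
Proof.
have := q2_neq1; set c := hgt D i d => q21.
have step n s s' : s = q ^ (c + 2 * n%:Z) * s' * (tau * (q - q^-1)) / (q * q) ->
    tau * (1 - (q ^ (c + 2 * n%:Z)) ^+ 2) + q ^ 2%:Z * s =
    tau * (q - q^-1) * q ^ (c + 2 * n%:Z) *
      (c0 * (q ^ (c + 2 * n%:Z) - (q ^ (c + 2 * n%:Z))^-1) + s').
  have : q ^ (c + 2 * n%:Z) != 0 by exact: expfz_neq0.
  move: (q ^ (c + 2 * n%:Z)) => k k0 ->; rewrite -[q ^ 2%:Z]/(q * q) /c0.
  by field; rewrite k0 q0 mulNr -opprB oppr_eq0 q21.
elim: m => [|m IH]; first by apply: step; rewrite mulr0 !mul0r.
apply: (step m.+1 (coef nu g0 d m.+1) (delta q c0 c m.+1)); rewrite IH.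
have -> : q ^ (c + 2 * m.+1%:Z) = q ^ (c + 2 * m%:Z) * (q * q).
  by rewrite -[q * q]/(q ^ 2%:Z) -expfzDr //; congr (_ ^ _); lia.
by move: (delta _ _ _ _) (q ^ (c + 2 * m%:Z)) => s k; field.
Qed.

Lemma delta_closed c m :
  (q - q^-1) * delta q c0 c m =
    c0 * (q ^ (c + 2 * m%:Z - 1) + q ^ (1 - c - 2 * m%:Z) - q ^ (c - 1) - q ^ (1 - c)).
Proof.
elim: m => [|m IH].
  by rewrite !mulr0 addr0 subr0 -addrA -opprD subrr mulr0.
rewrite /= mulrDr IH; have : q ^ (c + 2 * m%:Z) != 0 by exact: expfz_neq0.
have -> : q ^ (c + 2 * m.+1%:Z - 1) = q ^ (c + 2 * m%:Z) * q.
  by rewrite -[q in X in _ = _ * X]expr1z -expfzDr //; congr (_ ^ _); lia.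
have -> : q ^ (1 - c - 2 * m.+1%:Z) = (q ^ (c + 2 * m%:Z))^-1 * q^-1.
  by rewrite -[q^-1]exprN1 invr_expz -expfzDr //; congr (_ ^ _); lia.
have -> : q ^ (c + 2 * m%:Z - 1) = q ^ (c + 2 * m%:Z) * q^-1.
  by rewrite -[q^-1]exprN1 -expfzDr //; congr (_ ^ _); lia.
have -> : q ^ (1 - c - 2 * m%:Z) = (q ^ (c + 2 * m%:Z))^-1 * q.
  by rewrite invr_expz -[q in X in _ = _ * X]expr1z -expfzDr //; congr (_ ^ _); lia.
by move: (q ^ (c + 2 * m%:Z)) c0 => k l k0; field; rewrite k0 q0.
Qed.

(** For c = -N the exponents c + 2m - 1 and 1 - c - 2m of the closed form are exchanged by m -> N +
    1 - m. *)
Lemma delta_sym N m : (m <= N.+1)%N ->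
  delta q c0 (- N%:Z) m = delta q c0 (- N%:Z) (N.+1 - m).
Proof.
move=> mN; have qq0 : q - q^-1 != 0 by exact: (@qi_subV_neq0 _ D i 1).
apply: (mulfI qq0); rewrite !delta_closed; congr (_ * (_ - _ - _)).
by rewrite addrC; congr (_ ^ _ + _ ^ _); lia.
Qed.

Lemma qsum_closed m : (q * q - 1) * qsum g0 m = q ^+ m * q ^+ m - 1.
Proof.
elim: m => [|m IH]; first by rewrite mulr0 expr0 mulr1 subrr.
rewrite /= -[qi D (idx g0) ^ 2%:Z]/(q * q) mulrDr mulrCA IH !exprS; ring.
Qed.

(** With the first product reversed, its factor 1 - q^(-2k) meets 1 + q^2 + ... + q^(2(k-1)), and
    together they are (1 - q^-2) [k]^2. *)
Lemma topcoef_prod d t N : hgt D i d = - N%:Z ->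
  topcoef g0 d t N * \prod_(1 <= j < N.+1) (tau * qsum g0 j) =
    t * (tau * (1 - q ^- 2)) ^+ N * (qfact D i N * qfact D i N).
Proof.
move=> dN; have tc M : topcoef g0 d t M = t * \prod_(k < M) (1 - q ^ (2 * (k%:Z - N%:Z))).
  elim: M => [|M IH]; first by rewrite big_ord0 mulr1.
  by rewrite big_ord_recr mulrA -IH /= -/i dN -/q [_ + M%:Z]addrC.
rewrite tc (reindex_inj rev_ord_inj) /= big_add1 big_mkord /qfact big_add1 big_mkord.
rewrite -(mulrA t) -[RHS]mulrA; congr (_ * _).
have <- : \prod_(k < N) (tau * (1 - q ^- 2)) = (tau * (1 - q ^- 2)) ^+ N.
  by rewrite prodr_const card_ord.
rewrite [N.+1.-1]/= -!big_split; apply: eq_bigr => k _.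
rewrite -[LHS]/(_ * (tau * qsum g0 k.+1)) -[RHS]/(_ * (qint D i k.+1 * qint D i k.+1)).
have -> : q ^ (2 * ((N - k.+1)%:Z - N%:Z)) = (q ^+ k.+1 * q ^+ k.+1)^-1.
  by rewrite -exprD -[q ^+ _]/(q ^ (_ + _)%:Z) invr_expz; congr (_ ^ _); have := ltn_ord k; lia.
have : q ^+ k.+1 != 0 by rewrite expf_neq0.
have := qsum_closed k.+1; rewrite /qint -/q; move: (q ^+ k.+1) (qsum g0 k.+1) => x s.
have := q2_neq1 => q21 hs x0; have -> : s = (x * x - 1) / (q * q - 1) by rewrite -hs mulrC mulKf.
field; rewrite ?x0 ?q0 ?q21 //.
Qed.

End StructureConstants.

Lemma scaler_lin (V : lmodType Qq) (k l : Qq) (x y : V) :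
  k *: (l *: x + y) = l *: (k *: x) + k *: y.
Proof. by rewrite scalerDr !scalerA mulrC. Qed.

Lemma cancel_comb (k l x y x' y' : Qq) :
  k * x' + y' = l * (k * x + y) -> x' = l * x -> y' = l * y.
Proof. by move=> h hx; rewrite hx mulrDr mulrCA in h; exact: (addrI _ h). Qed.

Section CommutatorIdentities.
Variables (A : lalgType Qq) (scaleAr : forall (k : Qq) (x y : A), k *: (x * y) = x * (k *: y)).
Implicit Types (x y z t e : A).

Lemma scale_leibniz (k l r u w : Qq) x y z t : k = w * u -> r * l = w ->
  (k *: x) * y + r *: (z * (l *: t)) = w *: (u *: (x * y) + z * t).
Proof. by move=> -> <-; rewrite -scaleAr -scalerAl scalerDr !scalerA. Qed.

Lemma qcomm_right_mul (k l : Qq) e x y :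
  l *: ((x * e - k *: (e * x)) * y) + x * (y * e - l *: (e * y)) =
    x * y * e - (k * l) *: (e * (x * y)).
Proof.
rewrite mulrBl mulrBr scalerBr -scalerAl -scaleAr scalerA [l * k]mulrC !mulrA.
by rewrite addrC addrA subrK.
Qed.

Lemma qcomm_left_mul (k l u w s t : Qq) e x y : u * k = w -> u * k * s = l ->
  u *: ((k *: (e * x - s *: (x * e))) * y) + x * (l *: (e * y - t *: (y * e))) =
    w *: (e * (x * y) - (s * t) *: (x * y * e)).
Proof.
move=> <- <-; rewrite -scaleAr -scalerAl !scalerA mulrBl mulrBr -scalerAl -scaleAr.
rewrite !scalerBr !scalerA !mulrA addrA subrK; congr (_ - _ *: _); ring.
Qed.

Lemma qcomm_left_scale (k l s : Qq) e x :
  k *: (e * (l *: x) - s *: ((l *: x) * e)) = (k * l) *: (e * x - s *: (x * e)).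
Proof.
by rewrite -scaleAr -scalerAl scalerA [s * l]mulrC -(scalerA l s) -scalerBr scalerA.
Qed.

Lemma scale_derivation (k s : Qq) x y z t :
  s *: ((k *: x) * y) + z * (k *: t) = k *: (s *: (x * y) + z * t).
Proof. by rewrite scaler_lin -scaleAr -scalerAl. Qed.

End CommutatorIdentities.

(** * Comparison of the form on both sides *)

Section GradedPairs.
Variables (I : countType) (D : BCdatum I) (nu : Iinf D -> Qq).
Local Notation E := (freealg (Iinf D)).
Local Notation Q := (Qlattice I).
Local Notation rf := (rootform D).
Variables (B : E -> E -> Qq) (formP : is_form nu B).
Hypothesis form_piU : forall x y z : E, piU nu x = piU nu y -> B x z = B y z.
Variables (g0 : Iinf D) (lev_g0 : lev g0 = 1%N) (re_g0 : is_re D (idx g0)).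
Hypothesis tau_neq0 : nu g0 != 0.
Implicit Types (b c d : Q) (x y z p u v h : E).

Let i : I := idx g0.
Let e : E := gen g0.
Let ai : Q := << 1 *g i >>.
Let q : Qq := qi D i.
Let tau : Qq := nu g0.
Let c0 : Qq := (q^-1 - q)^-1.
Local Notation adjR := (adjR B).
Local Notation adjL := (adjL B).
Local Notation skew_prim := (skew_prim B).
Local Notation ht := (hgt D i).

Let q0 : q != 0. Proof. exact: qi_neq0. Qed.

Definition refl b : Q := b - << ht b *g i >>.

Lemma hgtB b c : ht (b - c) = ht b - ht c.
Proof. by apply/eqP; rewrite eq_sym subr_eq -hgtD subrK. Qed.

Lemma hgt_refl b : ht (refl b) = - ht b.
Proof. by rewrite hgtB hgtU (eqP re_g0); ring. Qed.

Lemma reflD b c : refl (b + c) = refl b + refl c.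
Proof. by rewrite /refl hgtD monalgUD opprD addrACA. Qed.

Lemma refl0 : refl 0 = 0.
Proof.
have h0 : ht 0 = 0 by rewrite /hgt lext0.
by rewrite /refl h0 monalgU0 subrr.
Qed.

Lemma rootform_refl_l b c :
  rf (refl b) c = rf b c - (symm D i)%:Z * (ht b * ht c).
Proof.
have -> : rf b c = rf (refl b) c + rf << ht b *g i >> c by rewrite -rootformDl subrK.
by rewrite rootformUl; ring.
Qed.

(* topR and topL are what is used of the Serre relations. *)
Record root_gen d N p : Prop := RootGen {
  root_gen_prim : skew_prim d p;
  root_gen_hgt : ht d = - N%:Z;
  root_gen_neq0 : d <> 0;
  root_gen_topR : piU nu (qadR q (ht d) e p N.+1) = 0;
  root_gen_topL : piU nu (qadL q (ht d) e p N.+1) = 0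
}.

Local Notation F d p := (qadR q (ht d) e p).
Local Notation G d p := (qadL q (ht d) e p).
Local Notation gam d N := (gamma q c0 (ht d) N (qfact D i N)^-1).

(* x is a lift of an element of U^+[i] of weight b, and x' a lift of its image
   under L''_{i,1}, of weight s_i(b) = refl b. *)
Inductive Lift : Q -> E -> E -> Prop :=
| Lift_gen d N p m : root_gen d N p -> (m <= N)%N ->
    Lift (d + ai *+ m) (F d p m) (gam d N m *: G d p (N - m))
| Lift_one : Lift 0 1 1
| Lift_zero b : Lift b 0 0
| Lift_lin b (k : Qq) x x' y y' :
    Lift b x x' -> Lift b y y' -> Lift b (k *: x + y) (k *: x' + y')
| Lift_mul b c x x' y y' :
    Lift b x x' -> Lift c y y' -> Lift (b + c) (x * y) (x' * y').

Lemma Lift_scale b (k : Qq) x x' : Lift b x x' -> Lift b (k *: x) (k *: x').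
Proof. by move=> gx; have := Lift_lin k gx (Lift_zero b); rewrite !addr0. Qed.

Lemma d_neq_ai d N p : root_gen d N p -> d <> ai.
Proof.
move=> gd hd; have := root_gen_hgt gd.
by rewrite hd (hgt_ai re_g0); lia.
Qed.

Lemma ai_mulrn m : ai *+ m = << m%:Z *g i >>.
Proof. by rewrite /ai -monalgUMn natz. Qed.

Lemma refl_gen d N m : ht d = - N%:Z -> (m <= N)%N ->
  refl (d + ai *+ m) = d + ai *+ (N - m).
Proof.
move=> hd mN; rewrite !ai_mulrn /refl hgtD hgtU (eqP re_g0) hd -addrA -monalgUB.
by congr (_ + << _ *g _ >>); lia.
Qed.

Lemma Lift_homog b x x' : Lift b x x' -> homog b x /\ homog (refl b) x'.
Proof.
elim=> {b x x'}.
- move=> d N p m gd mN; split; first exact: (@homog_qadR _ _ _ _ lev_g0 _ _ (root_gen_prim gd) m).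
  rewrite (refl_gen (root_gen_hgt gd) mN) -[_ *: _]addr0.
  by apply: homogP; [exact: (@homog_qadL _ _ _ _ lev_g0 _ _ (root_gen_prim gd) (N - m)) | exact: homog0].
- by rewrite refl0; split; exact: homog1.
- by move=> b; split; exact: homog0.
- by move=> b k x x' y y' _ [hx hx'] _ [hy hy']; split; exact: homogP.
- by move=> b c x x' y y' _ [hx hx'] _ [hy hy']; rewrite reflD; split; exact: homogM.
Qed.

Lemma adjR_linP p (k : Qq) y y' z z' :
  adjR p y y' -> adjR p z z' -> adjR p (k *: y + z) (k *: y' + z').
Proof. by move=> hy hz v; rewrite !(form_addr formP) !(form_scaler formP) hy hz. Qed.

Lemma adjL_linP p (k : Qq) y y' z z' :
  adjL p y y' -> adjL p z z' -> adjL p (k *: y + z) (k *: y' + z').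
Proof. by move=> hy hz v; rewrite !(form_addr formP) !(form_scaler formP) hy hz. Qed.

Lemma adjR_eq p y z z' : adjR p y z -> z = z' -> adjR p y z'.
Proof. by move=> hy <-. Qed.

Lemma adjR_zero p : adjR p 0 0.
Proof. by move=> v; rewrite !(form_zero_r formP). Qed.

Lemma adjL_zero p : adjL p 0 0.
Proof. by move=> v; rewrite !(form_zero_r formP). Qed.

Lemma adjR_scale p (k : Qq) y y' : adjR p y y' -> adjR p (k *: y) (k *: y').
Proof. by move=> hy v; rewrite !(form_scaler formP) hy. Qed.

Lemma adjL_scale p (k : Qq) y y' : adjL p y y' -> adjL p (k *: y) (k *: y').
Proof. by move=> hy v; rewrite !(form_scaler formP) hy. Qed.

Lemma adjR_e_one : adjR e 1 0.
Proof. exact: (adjR_one formP (homog_e lev_g0) (ai_neq0 re_g0)). Qed.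

Lemma adjL_e_one : adjL e 1 0.
Proof.
move=> v; rewrite (form_sym formP) (form1M formP) (form_zero_r formP).
by rewrite (form1_homog formP (homog_e lev_g0) (ai_neq0 re_g0)) mul0r.
Qed.

Lemma Lift_adjL0 b x x' : Lift b x x' -> adjL e x 0.
Proof.
elim=> {b x x'}.
- by move=> d N p m gd mN; apply: (adjL_qadR formP _ _ (root_gen_prim gd) (d_neq_ai gd)).
- exact: adjL_e_one.
- by move=> b; exact: adjL_zero.
- by move=> b k x x' y y' _ hx _ hy; have := adjL_linP k hx hy; rewrite scaler0 addr0.
- move=> b c x x' y y' gx hx gy hy.
  have := adjL_mul formP lev_g0 (proj1 (Lift_homog gx)) (proj1 (Lift_homog gy)) hx hy.
  by rewrite mul0r mulr0 scaler0 addr0.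
Qed.

Lemma Lift_adjR0 b x x' : Lift b x x' -> adjR e x' 0.
Proof.
elim=> {b x x'}.
- move=> d N p m gd mN; rewrite -[X in adjR _ _ X](scaler0 _ (gam d N m)).
  by apply: adjR_scale; apply: (adjR_qadL formP _ _ (root_gen_prim gd) (d_neq_ai gd)).
- exact: adjR_e_one.
- by move=> b; exact: adjR_zero.
- by move=> b k x x' y y' _ hx _ hy; have := adjR_linP k hx hy; rewrite scaler0 addr0.
- move=> b c x x' y y' gx hx gy hy.
  have := adjR_mul_e formP lev_g0 (proj2 (Lift_homog gx)) (proj2 (Lift_homog gy)) hx hy.
  by rewrite mul0r mulr0 scaler0 addr0.
Qed.

Lemma Lift_cast b b' x x' : Lift b x x' -> b = b' -> Lift b' x x'.
Proof. by move=> gx <-. Qed.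

(** In [coef_delta] the constant lowering G_(k+1) contains q^(c + 2k); for k = N - m - 1 and c = -N
    this is q^(-2) q^(-(c + 2m)), whence the factor q^(-2). *)
Let C : Qq := tau * (q - q^-1) * q ^ (-2).

(** The pair (z, z') belongs to the q-commutator of x with e. That identity is stated in U because
    at the end of a string F_(N+1) vanishes only after [piU]. *)
Record raised b x x' z z' : Prop := Raised {
  raised_Lift : Lift (b + ai) z z';
  raised_pi : piU nu z = piU nu x * piU nu e - q ^ ht b *: (piU nu e * piU nu x);
  raised_adj : adjL e x' ((C * q ^ (- ht b)) *: z')
}.

(** Dual to [raised]: now z is an adjoint and z' a q-commutator, closed up in U by G_(N+1) = 0. *)
Record lowered b x x' z z' : Prop := Lowered {
  lowered_Lift : Lift (b - ai) z z';
  lowered_adj : adjR e x z;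
  lowered_pi : piU nu z' =
    (C * q ^ ht b) *: (piU nu e * piU nu x' - q ^ (- ht b) *: (piU nu x' * piU nu e))
}.

Lemma piU_comb (k : Qq) x y z t :
  piU nu (k *: (x * y) + z * t) = k *: (piU nu x * piU nu y) + piU nu z * piU nu t.
Proof. by rewrite piU_linear (piUM nu x y) (piUM nu z t). Qed.

Lemma piU_qcomm (k : Qq) x y z t :
  piU nu (x * y - k *: (z * t)) = piU nu x * piU nu y - k *: (piU nu z * piU nu t).
Proof. by rewrite piUB piUZ (piUM nu x y) (piUM nu z t). Qed.

Lemma raised_gen d N p m : root_gen d N p -> (m < N)%N ->
  raised (d + ai *+ m) (F d p m) (gam d N m *: G d p (N - m))
    (F d p m.+1) (gam d N m.+1 *: G d p (N - m.+1)).
Proof.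
move=> gd mN; have hw := hgt_wt lev_g0 re_g0 d m.
split.
- by apply: Lift_cast (Lift_gen gd mN) _; rewrite mulrSr addrA.
- by rewrite hw -piU_qcomm.
have [k hk] : exists k, (N - m = k.+1)%N by exists (N - m.+1)%N; lia.
have kE : (N - m.+1 = k)%N by lia.
have cE : coef nu g0 d k.+1 = C * q ^ (- (ht d + 2 * m%:Z)) * delta q c0 (ht d) k.+1.
  rewrite coef_delta /C -[in RHS](mulrA (tau * _)) -expfzDr //.
  congr (_ * _ ^ _ * _); rewrite (root_gen_hgt gd); lia.
rewrite hw kE hk.
have -> : (C * q ^ (- (ht d + 2 * m%:Z))) *: (gam d N m.+1 *: G d p k) =
    gam d N m *: (coef nu g0 d k.+1 *: G d p k).
  by rewrite !scalerA cE [gam d N m.+1]/= hk mulrCA.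
apply: adjL_scale.
exact: (adjL_qadL formP lev_g0 re_g0 (root_gen_prim gd) (d_neq_ai gd)).
Qed.

Lemma raised_mul b c x x' y y' z z' t t' :
  Lift b x x' -> Lift c y y' -> raised b x x' z z' -> raised c y y' t t' ->
  raised (b + c) (x * y) (x' * y')
    (q ^ ht c *: (z * y) + x * t) (q ^ ht c *: (z' * y') + x' * t').
Proof.
move=> gx gy [gz hz az] [gt' ht' at'].
split.
- apply: Lift_lin; first by apply: Lift_cast (Lift_mul gz gy) _; rewrite addrAC.
  by apply: Lift_cast (Lift_mul gx gt') _; rewrite addrA.
- rewrite piU_comb hz ht' (qcomm_right_mul (@scalerAr _ _)) -expfzDr // -hgtD.
  by rewrite (piUM nu x y).
have := adjL_mul formP lev_g0 (proj2 (Lift_homog gx)) (proj2 (Lift_homog gy)) az at'.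
rewrite hgt_refl (@scale_leibniz _ (@free_scaleAr _) _ _ _ (q ^ ht c) (C * q ^ (- ht (b + c)))) //.
- rewrite -mulrA -expfzDr // hgtD; congr (_ * _ ^ _); lia.
- rewrite mulrCA -expfzDr // hgtD; congr (_ * _ ^ _); lia.
Qed.

Lemma raised_ex b x x' : Lift b x x' -> exists z z', raised b x x' z z'.
Proof.
elim=> {b x x'}.
- move=> d N p m gd; rewrite leq_eqVlt => /orP[/eqP ->|mN]; last first.
    by do 2!eexists; exact: raised_gen gd mN.
  (* At m = N, F_(N+1) is zero in U, and the adjoint of e kills G_0 = p. *)
  exists 0, 0; split; first exact: Lift_zero.
    by rewrite (hgt_wt lev_g0 re_g0) -piU_qcomm piU0 -(root_gen_topR gd).
  rewrite subnn scaler0 -[X in adjL _ _ X](scaler0 _ (gam d N N)); apply: adjL_scale.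
  exact: (adjL_e_p formP lev_g0 re_g0 (root_gen_prim gd) (d_neq_ai gd)).
- exists 0, 0; split; first exact: Lift_zero.
    by rewrite piU0 piU1 /hgt lext0 expr0z scale1r mul1r mulr1 subrr.
  by rewrite scaler0; exact: adjL_e_one.
- move=> b; exists 0, 0; split; first exact: Lift_zero.
    by rewrite piU0 mul0r mulr0 scaler0 subr0.
  by rewrite scaler0; exact: adjL_zero.
- move=> b k x x' y y' _ [z [z' [gz hz az]]] _ [t [t' [gt' ht' at']]].
  exists (k *: z + t), (k *: z' + t'); split; first exact: Lift_lin.
    rewrite (piU_linear nu k z t) hz ht' (piU_linear nu k x y) mulrDl mulrDr.
    rewrite -scalerAl -scalerAr scalerBr scalerDr !scalerA [k * _]mulrC.
    by rewrite addrACA -opprD.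
  by rewrite scaler_lin; exact: adjL_linP.
- move=> b c x x' y y' gx [z [z' hz]] gy [t [t' ht']].
  by do 2!eexists; exact: raised_mul gx gy hz ht'.
Qed.

Lemma lowered_gen d N p m : root_gen d N p -> (m < N)%N ->
  lowered (d + ai *+ m.+1) (F d p m.+1) (gam d N m.+1 *: G d p (N - m.+1))
    (coef nu g0 d m.+1 *: F d p m) (coef nu g0 d m.+1 *: (gam d N m *: G d p (N - m))).
Proof.
move=> gd mN; have hw := hgt_wt lev_g0 re_g0 d m.+1; have dN := root_gen_hgt gd.
split.
- apply: Lift_scale; apply: Lift_cast (Lift_gen gd (ltnW mN)) _.
  by rewrite mulrSr addrA addrK.
- exact: (adjR_qadR formP lev_g0 re_g0 (root_gen_prim gd) (d_neq_ai gd)).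
have [k [hk kE]] : exists k, (N - m = k.+1)%N /\ (N - m.+1 = k)%N.
  by exists (N - m.+1)%N; split=> //; lia.
(* F and its image are lowered at the complementary positions m + 1 and N - m; [delta_sym]
   identifies the constants. *)
have cE : coef nu g0 d m.+1 = C * q ^ (ht d + 2 * m.+1%:Z) * delta q c0 (ht d) k.+1.
  have -> : delta q c0 (ht d) k.+1 = delta q c0 (ht d) m.+1.
    by rewrite dN [RHS](delta_sym g0 (leqW mN : (m.+1 <= N.+1)%N)) subSS hk.
  rewrite coef_delta /C -[in RHS](mulrA (tau * _)) -expfzDr //.
  congr (_ * _ ^ _ * _); rewrite dN; lia.
rewrite hw kE hk !piUZ [qadL _ _ _ _ k.+1]/= piU_qcomm.
have -> : - (ht d + 2 * m.+1%:Z) = ht d + 2 * k%:Z by rewrite dN; lia.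
rewrite (qcomm_left_scale (@scalerAr _ _)) !scalerA cE [gam d N m.+1]/= hk.
by rewrite [gam d N m * _]mulrC mulrA.
Qed.

Lemma lowered_mul b c x x' y y' z z' t t' :
  Lift b x x' -> Lift c y y' -> lowered b x x' z z' -> lowered c y y' t t' ->
  lowered (b + c) (x * y) (x' * y')
    (q ^ ht c *: (z * y) + x * t) (q ^ ht c *: (z' * y') + x' * t').
Proof.
move=> gx gy [gz az hz] [gt' at' ht'].
split.
- apply: Lift_lin; first by apply: Lift_cast (Lift_mul gz gy) _; rewrite addrAC.
  by apply: Lift_cast (Lift_mul gx gt') _; rewrite addrA.
- exact: (adjR_mul_e formP lev_g0 (proj1 (Lift_homog gx)) (proj1 (Lift_homog gy)) az at').
have e1 : q ^ ht c * (C * q ^ ht b) = C * q ^ ht (b + c).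
  by rewrite mulrCA -expfzDr // hgtD [ht c + _]addrC.
have e2 : q ^ ht c * (C * q ^ ht b) * q ^ (- ht b) = C * q ^ ht c.
  by rewrite e1 -mulrA -expfzDr // hgtD; congr (_ * _ ^ _); lia.
rewrite piU_comb hz ht' (qcomm_left_mul (@scalerAr _ _) _ _ _ _ e1 e2) (piUM nu x' y').
by rewrite -expfzDr // -opprD -hgtD.
Qed.

Lemma lowered_ex b x x' : Lift b x x' -> exists z z', lowered b x x' z z'.
Proof.
elim=> {b x x'}.
- move=> d N p [|m] gd mN; last by do 2!eexists; exact: lowered_gen gd mN.
  (* At m = 0 the adjoint kills F_0 = p, and the q-commutator on the image side is a multiple of
     G_(N+1), zero in U. *)
  exists 0, 0; split; first exact: Lift_zero.
    exact: (adjR_e_p formP lev_g0 re_g0 (root_gen_prim gd) (d_neq_ai gd)).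
  rewrite (hgt_wt lev_g0 re_g0) subn0 piU0 piUZ (qcomm_left_scale (@scalerAr _ _)).
  have -> : - (ht d + 2 * 0%:Z) = ht d + 2 * N%:Z by rewrite (root_gen_hgt gd); lia.
  by rewrite -piU_qcomm (root_gen_topL gd) scaler0.
- exists 0, 0; split; [exact: Lift_zero | exact: adjR_e_one |].
  by rewrite piU0 piU1 /hgt lext0 oppr0 expr0z scale1r mul1r mulr1 subrr scaler0.
- move=> b; exists 0, 0; split; [exact: Lift_zero | exact: adjR_zero |].
  by rewrite piU0 mul0r mulr0 scaler0 subr0 scaler0.
- move=> b k x x' y y' _ [z [z' [gz az hz]]] _ [t [t' [gt' at' ht']]].
  exists (k *: z + t), (k *: z' + t'); split; [exact: Lift_lin | exact: adjR_linP |].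
  rewrite (piU_linear nu k z' t') hz ht' (piU_linear nu k x' y') mulrDl mulrDr.
  rewrite -scalerAl -scalerAr -scaler_lin; congr (_ *: _).
  rewrite scalerBr scalerDr !scalerA [k * _]mulrC.
  by rewrite addrACA -opprD.
- move=> b c x x' y y' gx [z [z' hz]] gy [t [t' ht']].
  by do 2!eexists; exact: lowered_mul gx gy hz ht'.
Qed.

Let kappa : Qq := tau * (1 - q ^- 2).

Lemma topcoef0 d m : topcoef g0 d 0 m = 0.
Proof. by elim: m => //= m ->; rewrite mul0r. Qed.

Section Derivations.
Variables (dh : Q) (Nh : nat) (h : E) (gh : root_gen dh Nh h).
(** The constant kappa^N [N]!^2 of [topcoef_prod], divided by the [N]! that normalizes the image G_N
    / [N]! of a generator. *)
Let xi : Qq := kappa ^+ Nh * qfact D i Nh.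

Record derived b x x' z z' : Prop := Derived {
  derived_Lift : Lift (b - dh) z z';
  derived_adj : adjR h x z;
  derived_top : adjR (e ^+ Nh * h) x' (xi *: z')
}.

Lemma form_root_gen d N p : root_gen d N p -> B h p = 0 \/ dh = d.
Proof.
move=> gd; have [->|/eqP ne] := eqVneq dh d; [by right | left].
exact: (form_orth formP (skew_prim_homog (root_gen_prim gh))
  (skew_prim_homog (root_gen_prim gd)) ne).
Qed.

(** Removing h leaves a multiple of e^(N-m), which is zero if the weights of h and p differ.
    Otherwise Nh = N, and e^N is orthogonal to the shorter power e^(N-m) unless m = 0. *)
Lemma derived_top_gen d N p m : root_gen d N p -> (m <= N)%N ->
  adjR (e ^+ Nh * h) (gam d N m *: G d p (N - m))
    (if m == 0%N then (xi * B h p) *: 1 else 0).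
Proof.
move=> gd mN v; have t_dh := form_root_gen gd.
have hadj := adjR_prim formP (root_gen_prim gh) (root_gen_prim gd) (root_gen_neq0 gh).
have hL := adjR_h_qadL formP lev_g0 re_g0 (root_gen_prim gd) (root_gen_prim gh)
  (d_neq_ai gh) (root_gen_neq0 gh) hadj t_dh (N - m).
rewrite (form_scaler formP) mulrA hL (form_scaler formP).
case: t_dh => [->|hd].
  rewrite topcoef0 mul0r mulr0 mulr0; case: ifP => _; rewrite ?scale0r.
    by rewrite (form_zero_r formP).
  by rewrite (form_zero_r formP).
have NN : Nh = N by have := root_gen_hgt gh; rewrite hd (root_gen_hgt gd); lia.
rewrite NN (form_exp formP lev_g0 re_g0); last by rewrite leq_subr.
have [->|m0] := eqVneq m 0%N; last first.
  rewrite (_ : (N == N - m)%N = false) ?mulr0 ?(form_zero_r formP) //; lia.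
rewrite subn0 eqxx (form_scaler formP) !mulrA -(mulrA _ (topcoef _ _ _ _)).
rewrite (topcoef_prod nu _ (root_gen_hgt gd)) /xi NN.
have := qfact_neq0 D i N; rewrite [gam d N 0]/=; move: (qfact D i N) => f f0.
rewrite -/kappa -/tau -/q; move: (B h p) (kappa ^+ N) (B v 1) => t k s.
by field.
Qed.

Lemma derived_ex b x x' : Lift b x x' -> exists z z', derived b x x' z z'.
Proof.
elim=> {b x x'}.
- move=> d N p [|m] gd mN; have htop := derived_top_gen gd mN; last first.
    exists 0, 0; split; [exact: Lift_zero | | by rewrite scaler0].
    exact: (adjR_h_qadR formP lev_g0 (root_gen_prim gd) (root_gen_prim gh)
      (d_neq_ai gh) (root_gen_neq0 gh)
      (adjR_prim formP (root_gen_prim gh) (root_gen_prim gd) (root_gen_neq0 gh))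
      (form_root_gen gd)).
  exists (B h p *: 1), (B h p *: 1); split.
  + case: (form_root_gen gd) => [->|->]; first by rewrite scale0r; exact: Lift_zero.
    by rewrite addr0 subrr; apply: Lift_scale; exact: Lift_one.
  + exact: (adjR_prim formP (root_gen_prim gh) (root_gen_prim gd) (root_gen_neq0 gh)).
  + by rewrite scalerA.
- have hh := skew_prim_homog (root_gen_prim gh).
  have h1 := adjR_one formP hh (root_gen_neq0 gh).
  exists 0, 0; split; [exact: Lift_zero | exact: h1 |].
  by rewrite scaler0 => v; rewrite mulrA h1 !(form_zero_r formP).
- move=> b; exists 0, 0; rewrite ?scaler0.
  by split; [exact: Lift_zero | exact: adjR_zero | rewrite scaler0; exact: adjR_zero].
- move=> b k x x' y y' _ [z [z' [gz az hz]]] _ [t [t' [gt' at' ht']]].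
  exists (k *: z + t), (k *: z' + t'); split; [exact: Lift_lin | exact: adjR_linP |].
  by rewrite scaler_lin; exact: adjR_linP.
- move=> b c x x' y y' gx [z [z' [gz az hz]]] gy [t [t' [gt' at' ht']]].
  have [[hx hx'] [hy hy']] := (Lift_homog gx, Lift_homog gy).
  exists (qq ^ rf c dh *: (z * y) + x * t), (qq ^ rf c dh *: (z' * y') + x' * t'); split.
  + apply: Lift_lin; first by apply: Lift_cast (Lift_mul gz gy) _; rewrite addrAC.
    by apply: Lift_cast (Lift_mul gx gt') _; rewrite addrA.
  + exact: (adjR_mul formP (root_gen_prim gh) hx hy az at').
  (* Both sides carry the same twist: e^Nh h has weight s_i(dh), and s_i preserves the form on
     weights. *)
  have es : qq ^ rf (refl c) dh * q ^ (ht (refl c) * Nh%:Z) = qq ^ rf c dh.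
    rewrite rootform_refl_l hgt_refl (root_gen_hgt gh) /q /qi.
    rewrite -[qq ^+ _]/(qq ^ (symm D i)%:Z) exprz_exp -expfzDr ?qq_neq0 //.
    by congr (_ ^ _); ring.
  have := adjR_top_mul formP lev_g0 (root_gen_prim gh) hx' hy' (Lift_adjR0 gx)
    (Lift_adjR0 gy) hz ht'.
  rewrite es => top; apply: (adjR_eq top).
  exact: (scale_derivation (@free_scaleAr _)).
Qed.

End Derivations.

Lemma form1_qadR d N p m : root_gen d N p -> B 1 (F d p m) = 0.
Proof.
have Be : B 1 e = 0 by apply: (form1_homog formP (homog_e lev_g0)); exact: ai_neq0 re_g0.
move=> gd; case: m => [|m].
  exact: (form1_homog formP (skew_prim_homog (root_gen_prim gd)) (root_gen_neq0 gd)).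
by rewrite (form_subr formP) (form_scaler formP) !(form1M formP) Be mulr0 mul0r mulr0 subr0.
Qed.

Lemma form1_qadL d N p m : root_gen d N p -> B 1 (G d p m) = 0.
Proof.
have Be : B 1 e = 0 by apply: (form1_homog formP (homog_e lev_g0)); exact: ai_neq0 re_g0.
move=> gd; case: m => [|m].
  exact: (form1_homog formP (skew_prim_homog (root_gen_prim gd)) (root_gen_neq0 gd)).
by rewrite (form_subr formP) (form_scaler formP) !(form1M formP) Be mulr0 mul0r mulr0 subr0.
Qed.

(** Quantified over all second arguments, since the induction on the first replaces the second by
    its adjoints. *)
Definition matched b u u' :=
  forall c y y', Lift c y y' -> B u' y' = kappa ^ (- ht b) * B u y.

Lemma matched_one : matched 0 1 1.
Proof.
have h0 : ht (0 : Q) = 0 by rewrite /hgt lext0.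
rewrite /matched h0 oppr0 expr0z => c y y'; rewrite mul1r; elim=> {c y y'} //.
- move=> d N p m gd mN.
  by rewrite (form_scaler formP) (form1_qadR _ gd) (form1_qadL _ gd) mulr0.
- by move=> b k x x' y y' _ IHx _ IHy; rewrite !(form_addr formP) !(form_scaler formP) IHx IHy.
- by move=> b c x x' y y' _ IHx _ IHy; rewrite !(form1M formP) IHx IHy.
Qed.

Lemma kappa_neq0 : kappa != 0.
Proof.
rewrite mulf_neq0 // subr_eq0 eq_sym invr_eq1.
exact: qi_exp_neq1.
Qed.

Lemma C_kappa : C * C * q ^ 2%:Z = kappa * kappa.
Proof.
rewrite /C /kappa -[q ^ (-2)]/((q * q)^-1) -[q ^- 2]/((q * q)^-1) -[q ^ 2%:Z]/(q * q).
by field.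
Qed.

(** With (t, t') the lowering of (y, y'): {z, y} = {x, t}, the other half of the q-commutator being
    killed by y, while {x', t'} unfolds to {z', y'} with two factors C. *)
Lemma matched_raised b x x' z z' :
  Lift b x x' -> matched b x x' -> raised b x x' z z' -> matched (b + ai) z z'.
Proof.
move=> gx mx [gz hz az] c y y' gy; have [t [t' [gt' at' ht']]] := lowered_ex gy.
have e1 : B z y = B x t.
  have : piU nu z = piU nu (x * e - q ^ ht b *: (e * x)) by rewrite hz piU_qcomm.
  move/form_piU => ->; rewrite (form_subl formP) (form_scalel formP) at'.
  by rewrite (Lift_adjL0 gy) (form_zero_r formP) mulr0 subr0.
have e2 : B x' t' = C * C * q ^ (ht c - ht b) * B z' y'.
  have : piU nu t' = piU nu ((C * q ^ ht c) *: (e * y' - q ^ (- ht c) *: (y' * e))).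
    by rewrite piUZ piU_qcomm.
  rewrite (form_sym formP) => /form_piU ->.
  rewrite (form_scalel formP) (form_subl formP) (form_scalel formP) az.
  rewrite (Lift_adjR0 gx) (form_zero_r formP) mulr0 subr0 (form_scaler formP).
  rewrite (form_sym formP y') expfzDr //.
  by move: C (B z' y') (q ^ ht c) (q ^ (- ht b)) => k l r s; ring.
have [[hz' hz''] [hy hy']] := (Lift_homog gz, Lift_homog gy).
have hbai : ht (b + ai) = ht b + 2 by rewrite hgtD (hgt_ai re_g0).
(* If the weights differ both sides vanish; if they agree, <c> - <b> = 2, the exponent for which C^2
   q^2 = kappa^2 applies. *)
have [ec|/eqP nec] := eqVneq (refl (b + ai)) (refl c); last first.
  rewrite (form_orth formP hz'' hy' nec) (form_orth formP hz' hy) ?mulr0 //.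
  by move=> h; apply: nec; rewrite h.
have hc : ht c - ht b = 2%:Z.
  by have := congr1 ht ec; rewrite !hgt_refl hbai; lia.
have k0 := kappa_neq0.
apply: (mulfI (mulf_neq0 k0 k0)); rewrite -{1}C_kappa -hc -e2 (mx _ _ _ gt') e1 hbai.
rewrite mulrA; congr (_ * _).
rewrite -[kappa * kappa]/(kappa ^ 2%:Z) -expfzDr //; congr (_ ^ _); lia.
Qed.

(* For F_(m+1), write w F_(m+1) as the q-commutator of w F_m with e minus a
   multiple of (q-commutator of w with e) F_m. *)
Lemma matched_mul b x x' : Lift b x x' -> forall a u u',
  Lift a u u' -> matched a u u' -> matched (a + b) (u * x) (u' * x').
Proof.
elim=> {b x x'}.
- move=> d N p; elim=> [|m IH] gd mN a u u' gu mu c y y' gy.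
    (* F_0 = p is peeled off one side and its image G_N / [N]!, replaced by e^N p / [N]!, off the
       other; xi / [N]! = kappa^N fits <d> = -N. *)
    have [z [z' [gz az hz]]] := derived_ex gd gy.
    have ky v : B (v * e) y' = 0 by rewrite (Lift_adjR0 gy) (form_zero_r formP).
    rewrite subn0 -free_scaleAr (form_scalel formP).
    rewrite (form_qadL_top formP _ _ _ _ ky) hz (form_scaler formP) az (mu _ _ _ gz).
    have -> : ht (a + (d + ai *+ 0)) = ht a - N%:Z by rewrite addr0 hgtD (root_gen_hgt gd).
    have -> : - (ht a - N%:Z) = N%:Z - ht a by ring.
    rewrite expfzDr ?kappa_neq0 // [gam d N 0]/= -[kappa ^ N%:Z]/(kappa ^+ N).
    have := qfact_neq0 D i N; move: (qfact D i N) (kappa ^+ N) (kappa ^ _) (B u z) => f k l s f0.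
    by field.
  have {}IH := IH gd (ltnW mN); have gm := Lift_gen gd (ltnW mN).
  have [z [z' rz]] := raised_ex gu; have rm := raised_gen gd mN.
  have mz := matched_raised gu mu rz.
  have gum := Lift_mul gu gm.
  have rum := raised_mul gu gm rz rm.
  have m1 := matched_raised gum (IH _ _ _ gu mu) rum gy.
  have m2 := IH _ _ _ (raised_Lift rz) mz _ _ _ gy.
  have w1 : ht (a + (d + ai *+ m) + ai) = ht (a + (d + ai *+ m.+1)).
    by rewrite mulrSr !addrA.
  have w2 : ht (a + ai + (d + ai *+ m)) = ht (a + (d + ai *+ m.+1)).
    by rewrite mulrSr addrACA [ai + _]addrC !addrA.
  rewrite w1 2!(form_linear formP) in m1; rewrite w2 in m2.
  exact: (cancel_comb m1 m2).
- move=> a u u' gu mu; rewrite !mulr1 addr0; exact: mu.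
- move=> b a u u' gu mu c y y' gy; rewrite !mulr0.
  by rewrite !(form_sym formP 0) !(form_zero_r formP) mulr0.
- move=> b k x x' y y' _ IHx _ IHy a u u' gu mu c t t' gt'.
  have mulr_lin (w w1 w2 : E) : w * (k *: w1 + w2) = k *: (w * w1) + w * w2.
    by rewrite mulrDr -free_scaleAr.
  rewrite (mulr_lin u') (mulr_lin u) 2!(form_linear formP).
  by rewrite (IHx _ _ _ gu mu _ _ _ gt') (IHy _ _ _ gu mu _ _ _ gt') mulrDr mulrCA.
- move=> b c x x' y y' gx IHx gy IHy a u u' gu mu; rewrite !mulrA addrA.
  by apply: IHy; [exact: Lift_mul | exact: IHx].
Qed.

Lemma Lift_form b c x x' y y' : Lift b x x' -> Lift c y y' ->
  B x' y' = kappa ^ (- ht b) * B x y.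
Proof.
move=> gx gy; have := matched_mul gx Lift_one matched_one gy.
by rewrite !mul1r add0r.
Qed.

End GradedPairs.

(** To first order, x - 1 is p / d with deg p < deg d, and x = 0 would force p = -d. *)
Lemma admissible_neq0 (x : Qq) : admissible x -> x != 0.
Proof.
move=> [c c0 /(_ 1%N)]; rewrite big_ord1 c0 expr0 invr1 mulr1 => -[p [d [d0 sz xE]]].
apply: contra_eqN xE => /eqP ->; rewrite sub0r eq_sym.
have d0' : ofpoly d != 0 by rewrite ofpoly_eq0.
rewrite -subr_eq0 opprK -(divff d0') -mulrDl mulf_eq0 invr_eq0 (negbTE d0') orbF.
rewrite -rmorphD ofpoly_eq0 addr_eq0; apply: contraTneq sz => ->.
by rewrite size_polyN addn1 ltnn.
Qed.

Lemma sign_rev n k : (k <= n)%N -> (-1) ^+ (n - k) = (-1) ^+ n * (-1) ^+ k :> Qq.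
Proof.
by move=> kn; rewrite -[in RHS](subnK kn) exprD -mulrA -expr2 sqrr_sign mulr1.
Qed.

Section ReversedSum.
Variables (I : countType) (D : BCdatum I) (i : I) (A : algType Qq).

Lemma dpow_scale (k : Qq) (x : A) n : dpow D i (k *: x) n = k ^+ n *: dpow D i x n.
Proof. by rewrite /dpow exprZn !scalerA mulrC. Qed.

(** The elements f and g are written with their divided powers in opposite order, whereas omega
    preserves the order of products. *)
Lemma dpow_reversed_sum (s r : Qq) (f f' : nat -> Qq) (x y : A) n :
  (forall k, (k <= n)%N -> s ^+ n * f (n - k)%N = r * f' k) ->
  \sum_(k < n.+1) f k *: (dpow D i (s *: y) (n - k) * x * dpow D i (s *: y) k) =
  r *: \sum_(k < n.+1) f' k *: (dpow D i y k * x * dpow D i y (n - k)).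
Proof.
move=> ff'; rewrite (reindex_inj rev_ord_inj) scaler_sumr; apply: eq_bigr => k _.
have kn : (k <= n)%N by rewrite -ltnS.
rewrite /= subSS subKn // !dpow_scale -!scalerAl -!scalerAr !scalerA -ff' //.
have -> : s ^+ n = s ^+ k * s ^+ (n - k) by rewrite -exprD subnKC.
by congr (_ *: _); ring.
Qed.

Lemma dpow_scaled_sum (s r : Qq) (f f' : nat -> Qq) (x y : A) n :
  (forall k, (k <= n)%N -> s ^+ n * f k = r * f' k) ->
  \sum_(k < n.+1) f k *: (dpow D i (s *: y) (n - k) * x * dpow D i (s *: y) k) =
  r *: \sum_(k < n.+1) f' k *: (dpow D i y (n - k) * x * dpow D i y k).
Proof.
move=> ff'; rewrite scaler_sumr; apply: eq_bigr => k _.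
have kn : (k <= n)%N by rewrite -ltnS.
rewrite !dpow_scale -!scalerAl -!scalerAr !scalerA -ff' //.
have -> : s ^+ n = s ^+ k * s ^+ (n - k) by rewrite -exprD subnKC.
by congr (_ *: _); ring.
Qed.

End ReversedSum.

(** * Passage to the quantum group *)

Section Main.
Variables (I : countType) (D : BCdatum I) (nu : Iinf D -> Qq).
Local Notation E := (freealg (Iinf D)).
Local Notation U := (Uq nu).
Variables (form : E -> E -> Qq) (formP : is_form nu form).
Variables (formU : U -> U -> Qq) (formUP : is_descended_form form formU).
Variables (omega : {lrmorphism U -> U}) (omegaP : is_omega omega).
Variables (aa : Iinf D -> U) (aaP : is_prim_gens formU aa).
Variables (g0 : Iinf D) (lev_g0 : lev g0 = 1%N) (re_g0 : is_re D (idx g0)).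
Hypothesis tau_neq0 : nu g0 != 0.

Let i : I := idx g0.
Let e : E := gen g0.
Let q : Qq := qi D i.
Let c0 : Qq := (q^-1 - q)^-1.
Let dg (g : Iinf D) : Qlattice I := << (lev g)%:Z *g idx g >>.
Let Ng (g : Iinf D) : nat := absz (- ((lev g)%:Z * cartan D i (idx g))).

Lemma form_piU x y z : piU nu x = piU nu y -> form x z = form y z.
Proof. by move=> xy; rewrite -!formUP xy. Qed.

Lemma form_ker n v y : piU nu n = 0 -> form (v * n) y = 0.
Proof.
move=> n0; have : piU nu (v * n) = piU nu 0 by rewrite (piUM nu v n) n0 mulr0 piU0.
by move/form_piU => ->; rewrite (form_sym formP) (form_zero_r formP).
Qed.

Lemma prim_gen_lift (g : Iinf D) : exists2 p, piU nu p = aa g & skew_prim form (dg g) p.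
Proof.
have kerP n v y : piU nu n = 0 -> form (v * n) y = 0 by exact: form_ker.
have [re_g|im_g] := boolP (is_re D (idx g)).
  have lg : lev g = 1%N.
    have := valP g; rewrite /in_Iinf -/(idx g) -/(lev g) re_g.
    by case/andP => _ /eqP.
  exists (gen g); first by rewrite piU_gen (prim_re aaP re_g).
  rewrite /dg lg; exact: (prim_e formP lg).
have [p hp pE] := prim_homog aaP im_g.
have [p' p'E [s sE sN]] := prim_rho aaP im_g.
exists p => //; apply: (prim_of_rho formP kerP hp (p' := p')).
  by rewrite piUB pE p'E subrr.
by exists s.
Qed.

Lemma idx_neq (g : Iinf D) : val g != (i, 1%N) -> i != idx g.
Proof.
apply: contra => /eqP ig; rewrite [val g]surjective_pairing -/(idx g) -/(lev g) -ig.
have := valP g; rewrite /in_Iinf -/(idx g) -/(lev g) -ig re_g0.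
by case/andP => _ /eqP ->.
Qed.

(** f_i commutes with every e_jk, and a_jl lies in the algebra that these generate. *)
Lemma fU_aa_comm (g : Iinf D) : i != idx g -> fU nu g0 * aa g = aa g * fU nu g0.
Proof.
move=> ig; have ef g' : idx g' = idx g -> fU nu g0 * eU nu g' = eU nu g' * fU nu g0.
  by move=> gg; rewrite eU_fU_comm // gg eq_sym.
have [re_g|im_g] := boolP (is_re D (idx g)); first by rewrite (prim_re aaP re_g) ef.
apply: (@subalg_comm _ (fun z => exists2 g', idx g' = idx g & z = eU nu g')).
  by move=> z [g' gg ->]; exact: ef.
apply/(prim_same_alg aaP im_g).
by apply: subalg_gen; exists g.
Qed.

Lemma hgt_dg (g : Iinf D) : val g != (i, 1%N) -> hgt D i (dg g) = - (Ng g)%:Z.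
Proof.
move=> /idx_neq ig; rewrite /dg hgtU /Ng.
have := cartan_off D ig; move: (cartan D i (idx g)) => c c_le0.
have : ((lev g)%:Z * c <= 0)%R by rewrite mulr_ge0_le0.
lia.
Qed.

Lemma dg_neq0 (g : Iinf D) : dg g <> 0.
Proof.
move/eqP; rewrite monalgU_eq0 => /eqP; have := valP g; rewrite /in_Iinf -/(lev g).
by case/andP; lia.
Qed.

Let K : U := KU nu i 1.
Let K' : U := KU nu i (-1).
Let s0 : Qq := (nu g0 * (q^-1 - q))^-1.
Let Bi : U := s0 *: fU nu g0.

Lemma K_K' : K * K' = 1. Proof. by rewrite -KUD subrr KU0. Qed.
Lemma K'_K : K' * K = 1. Proof. by rewrite -KUD addNr KU0. Qed.

Lemma K_e : K * piU nu e = q ^ 2%:Z *: (piU nu e * K).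
Proof.
by rewrite (KU_homog nu i 1 (homog_e lev_g0)) mul1r (hgt_ai re_g0).
Qed.

Lemma qV_sub_neq0 : q^-1 - q != 0.
Proof. by rewrite -opprB oppr_eq0; exact: (@qi_subV_neq0 _ D i 1). Qed.

Lemma Bi_e : Bi * piU nu e = piU nu e * Bi + c0 *: (K - K').
Proof.
rewrite piU_gen /Bi -scalerAl -scalerAr (eU_fU_same nu lev_g0) scalerDr scalerA.
have -> : s0 * nu g0 = c0 by rewrite /s0 invfM mulrAC mulVf // mul1r.
by rewrite -/i -/K -/K' -[K - K']opprB scalerN addrK.
Qed.

Lemma ext_g0 (A : pzRingType) (f : Iinf D -> A) : ext f i 1 = f g0.
Proof. by rewrite -[1%N]lev_g0 ext_gen. Qed.

Lemma aa_g0 : aa g0 = piU nu e.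
Proof. by rewrite piU_gen (prim_re aaP re_g0). Qed.

Lemma tauE : tau formU aa i = nu g0.
Proof. by rewrite /tau ext_g0 aa_g0 formUP (form_gen formP). Qed.

Lemma bigBE : bigB formU omega aa i = Bi.
Proof. by rewrite /bigB tauE ext_g0 /bb aa_g0 piU_gen (omega_e omegaP). Qed.

Lemma piU_qadR v c p m : piU nu (qadR v c e p m) = qadR v c (piU nu e) (piU nu p) m.
Proof. by elim: m => // m IH; rewrite /= piU_qcomm IH. Qed.

Lemma piU_qadL v c p m : piU nu (qadL v c e p m) = qadL v c (piU nu e) (piU nu p) m.
Proof. by elim: m => // m IH; rewrite /= piU_qcomm IH. Qed.

Lemma K_aa (g : Iinf D) p : homog (dg g) p ->
  K * piU nu p = q ^ hgt D i (dg g) *: (piU nu p * K).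
Proof. by move=> hp; rewrite (KU_homog nu i 1 hp) mul1r. Qed.

Lemma Bi_aa (g : Iinf D) : val g != (i, 1%N) -> Bi * aa g = aa g * Bi.
Proof. by move=> /idx_neq ig; rewrite /Bi -scalerAl -scalerAr fU_aa_comm. Qed.

Variables (L : {lrmorphism U -> U}) (LP : is_L2 formU omega aa i L).

Lemma L_e : L (piU nu e) = - (Bi * K).
Proof. by have := L2_a LP; rewrite ext_g0 aa_g0 bigBE. Qed.

Lemma L_Bi : L Bi = - (K' * piU nu e).
Proof. by have := L2_B LP; rewrite ext_g0 aa_g0 bigBE. Qed.

Lemma qcoef_top N (k : 'I_N.+1) : qcoef D i (- N%:Z) N k = (-1) ^+ k * q ^- k.
Proof.
rewrite /qcoef addNr sub0r; congr (_ * _); rewrite -[q ^+ k]/(q ^ k%:Z) invr_expz.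
by congr (_ ^ _); ring.
Qed.

Lemma L_aa (g : Iinf D) : val g != (i, 1%N) ->
  L (aa g) = (qfact D i (Ng g))^-1 *: qadL q (hgt D i (dg g)) (piU nu e) (aa g) (Ng g).
Proof.
move=> gi; rewrite (L2_aa LP gi) ext_g0 aa_g0 -/(Ng g).
rewrite qadL_closed scalerA mulVf ?qfact_neq0 // scale1r.
by apply: eq_bigr => k _; rewrite hgt_dg // qcoef_top.
Qed.

Lemma root_gen_aa (g : Iinf D) p : val g != (i, 1%N) ->
  piU nu p = aa g -> skew_prim form (dg g) p -> root_gen nu form g0 (dg g) (Ng g) p.
Proof.
move=> gi pE pp; have Ka := K_aa (skew_prim_homog pp).
have Ba := Bi_aa gi; have La := L_aa gi; rewrite -pE in Ba La.
split=> //; [exact: hgt_dg | exact: dg_neq0 | |].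
  rewrite piU_qadR; apply: (bij_inj (L2_bij LP)).
  rewrite (L_qadR_top (qi_neq0 D i) K_K' K'_K K_e Bi_e Ka Ba (hgt_dg gi) L_e La).
  by rewrite linear0.
rewrite piU_qadL.
apply: (qadL_top (qi_neq0 D i) K_K' K_e Ka Ba La _ L_Bi).
by rewrite invr_eq0 qfact_neq0.
Qed.

Lemma L_F (g : Iinf D) p m : val g != (i, 1%N) ->
  piU nu p = aa g -> skew_prim form (dg g) p -> (m <= Ng g)%N ->
  L (piU nu (qadR q (hgt D i (dg g)) e p m)) =
    piU nu (gamma q c0 (hgt D i (dg g)) (Ng g) (qfact D i (Ng g))^-1 m *:
            qadL q (hgt D i (dg g)) e p (Ng g - m)).
Proof.
move=> gi pE pp mN; have Ka := K_aa (skew_prim_homog pp).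
have Ba := Bi_aa gi; have La := L_aa gi; rewrite -pE in Ba La.
rewrite piUZ piU_qadR piU_qadL.
exact: (L_qadR (qi_neq0 D i) K_K' K'_K K_e Bi_e Ka Ba (hgt_dg gi) L_e La mN).
Qed.

(** Makes f(i,(j,l),n) zero for n > N, so that [Lift], which stops at m = N, covers all generators
    of U^+[i]. *)
Lemma qadR_vanish (A : lalgType Qq) (v : Qq) (c : int) (x y : A) m n :
  qadR v c x y m = 0 -> (m <= n)%N -> qadR v c x y n = 0.
Proof.
move=> F0; elim: n => [|n IH]; first by rewrite leqn0 => /eqP <-.
rewrite leq_eqVlt => /orP[/eqP <- //|/IH /= ->].
by rewrite mul0r mulr0 scaler0 subr0.
Qed.

Lemma fI_qadR (g : Iinf D) n :
  fI aa i g n%:Z =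
    (qfact D i n)^-1 *: qadR q (hgt D i (dg g)) (piU nu e) (aa g) n.
Proof.
rewrite /fI ext_g0 aa_g0 qadR_closed scalerA mulVf ?qfact_neq0 // scale1r.
by apply: eq_bigr => k _; rewrite hgtU.
Qed.

Let kappa : Qq := nu g0 * (1 - q ^- 2).

Lemma s0E : s0 = - (q * kappa)^-1.
Proof.
rewrite /s0 /kappa -[q ^- 2]/((q * q)^-1) -invrN; congr (_^-1).
by have := qi_neq0 D i; rewrite -/q; move: (nu g0) q => t k k0; field.
Qed.

Let kappa0 : kappa != 0. Proof. exact: kappa_neq0. Qed.

Lemma lrmorphZ (M : {lrmorphism U -> U}) (k : Qq) x : M (k *: x) = k *: M x.
Proof. exact: linearZ. Qed.

Lemma lrmorph_mul (M : {lrmorphism U -> U}) x y : M (x * y) = M x * M y.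
Proof. exact: rmorphM. Qed.

Lemma lrmorphN (M : {lrmorphism U -> U}) x : M (- x) = - M x.
Proof. exact: rmorphN. Qed.

Lemma lrmorph_sum (M : {lrmorphism U -> U}) n (f : 'I_n -> Qq) (F1 F2 F3 : 'I_n -> U) :
  M (\sum_(k < n) f k *: (F1 k * F2 k * F3 k)) =
    \sum_(k < n) f k *: (M (F1 k) * M (F2 k) * M (F3 k)).
Proof.
rewrite linear_sum; apply: eq_bigr => k _.
by rewrite -[LHS]/(M (f k *: _)) lrmorphZ !lrmorph_mul.
Qed.

Lemma lrmorph_dpow (M : {lrmorphism U -> U}) x n : M (dpow D i x n) = dpow D i (M x) n.
Proof. by rewrite /dpow lrmorphZ; congr (_ *: _); exact: rmorphXn. Qed.

Lemma omega_Bi : omega Bi = s0 *: piU nu e.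
Proof. by rewrite /Bi linearZ /= (omega_f omegaP) piU_gen. Qed.

Lemma omega_gI (g : Iinf D) n :
  exists r, omega (gI formU omega aa i g n%:Z) = r *: fI aa i g n%:Z.
Proof.
set c : int := (lev g)%:Z * cartan D i (idx g).
exists (s0 ^+ n * ((-1) ^+ n * q ^ (n%:Z * (1 - c - n%:Z)))).
rewrite /gI lrmorph_sum bigBE /fI ext_g0 aa_g0 -/c.
rewrite -(@dpow_reversed_sum _ D i _ s0 _
  (fun k => (-1) ^+ k * q ^ (k%:Z * (- c - n%:Z + 1)))
  (fun k => (-1) ^+ k * q ^ (k%:Z * (c + n%:Z - 1)))); last first.
  move=> k kn; rewrite sign_rev //.
  have -> : q ^ ((n - k)%N%:Z * (- c - n%:Z + 1)) =
      q ^ (n%:Z * (1 - c - n%:Z)) * q ^ (k%:Z * (c + n%:Z - 1)).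
    by rewrite -expfzDr ?qi_neq0 // -subzn //; congr (_ ^ _); ring.
  by move: (q ^ _) (q ^ _) => l l'; ring.
by apply: eq_bigr => k _; rewrite !lrmorph_dpow omega_Bi /bb (omega_invol omegaP).
Qed.

(** The form on U^+ and U^- applies omega to its second argument, and omega (L y) is [conjL] of
    omega y, which lies in U^+[i]. *)
Definition conjL : {lrmorphism U -> U} := omega \o L \o omega.

(** Needed to pass from F_m to F_(m+1). The constant is s0^(-2) q^(-2): f_i is s0^(-1) B_i once
    before and once after L, and q^(-2) comes from moving K past f_i. *)
Lemma conjL_e : conjL (piU nu e) = kappa ^+ 2 *: L (piU nu e).
Proof.
rewrite /conjL /= piU_gen (omega_e omegaP) -piU_gen.
have s00 : s0 != 0 by rewrite invr_eq0 mulf_neq0 // qV_sub_neq0.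
have -> : fU nu g0 = s0^-1 *: Bi by rewrite /Bi scalerA mulVf // scale1r.
rewrite lrmorphZ L_Bi scalerN lrmorphN lrmorphZ lrmorph_mul L_e.
rewrite [omega K'](omega_q omegaP) piU_gen (omega_e omegaP).
have -> : qU nu (- coroot ((symm D i)%:Z * -1) i) = K.
  by rewrite /K /KU /coroot mulrN1 mulr1 monalgUN; congr (qU nu _); congr pair; rewrite /= ?opprK ?oppr0.
rewrite (KU_fU nu i 1 g0) /Bi lev_g0 mul1r mul1r (eqP re_g0).
rewrite scalerN -scalerAl !scalerA; congr (- (_ *: _)).
rewrite s0E -[q ^ (-2%:Z)]/((q * q)^-1) !invrN !invrK.
by have := qi_neq0 D i; rewrite -/q; move: kappa kappa0 q => l l0 k k0; field; rewrite k0 l0.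
Qed.

Lemma conjL_aa (g : Iinf D) : val g != (i, 1%N) ->
  conjL (aa g) = kappa ^- Ng g *: L (aa g).
Proof.
move=> gi; have -> : conjL (aa g) = omega (L (bb omega aa g)) by [].
rewrite (L2_bb LP gi) (L2_aa LP gi) ext_g0 aa_g0 -/(Ng g) bigBE lrmorph_sum.
have e1 : \sum_(k < (Ng g).+1) ((-1) ^+ k * q ^+ k) *: (omega (dpow D i Bi k) *
      omega (bb omega aa g) * omega (dpow D i Bi (Ng g - k))) =
    \sum_(k < (Ng g).+1) ((-1) ^+ (Ng g - k) * q ^+ (Ng g - k)) *:
      (dpow D i (s0 *: piU nu e) (Ng g - k) * aa g * dpow D i (s0 *: piU nu e) k).
  rewrite (reindex_inj rev_ord_inj); apply: eq_bigr => k _.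
  have kn : (k <= Ng g)%N by rewrite -ltnS.
  rewrite /= subSS subKn // !lrmorph_dpow omega_Bi /bb.
  by rewrite (omega_invol omegaP).
rewrite e1 {e1}; apply: (@dpow_scaled_sum _ D i _ s0 _
  (fun k => (-1) ^+ (Ng g - k) * q ^+ (Ng g - k)) (fun k => (-1) ^+ k * q ^- k)) => k kn.
have q0 := qi_neq0 D i; have e0 n : q ^+ n != 0 by rewrite expf_neq0.
have -> : q ^+ (Ng g - k) = q ^+ Ng g / q ^+ k by rewrite -[in RHS](subnK kn) exprD mulfK.
rewrite sign_rev // s0E (exprNn (q * kappa)^-1) exprVn exprMn.
have := sqrr_sign Qq (Ng g); rewrite expr2; move: ((-1) ^+ Ng g) => sg sg2.
have k0N : kappa ^+ Ng g != 0 by rewrite expf_neq0.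
move: (q ^+ Ng g) (q ^+ k) (kappa ^+ Ng g) (e0 (Ng g)) (e0 k) k0N => l r t l0 r0 t0.
transitivity ((sg * sg) * ((-1) ^+ k * (r * t)^-1)); first by field; rewrite l0 r0 t0.
by rewrite sg2 mul1r; field; rewrite r0 t0.
Qed.

Lemma conjL_qadR (g : Iinf D) p m : val g != (i, 1%N) -> piU nu p = aa g ->
  conjL (piU nu (qadR q (hgt D i (dg g)) e p m)) =
    kappa ^ (hgt D i (dg g) + 2 * m%:Z) *: L (piU nu (qadR q (hgt D i (dg g)) e p m)).
Proof.
move=> gi pE; elim: m => [|m IH].
  have -> : kappa ^ (hgt D i (dg g) + 2 * 0%:Z) = kappa ^- Ng g.
    by rewrite mulr0 addr0 (hgt_dg gi) -invr_expz.
  by rewrite -[qadR _ _ _ _ _]/p pE conjL_aa.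
have -> : piU nu (qadR q (hgt D i (dg g)) e p m.+1) =
    piU nu (qadR q (hgt D i (dg g)) e p m) * piU nu e -
    q ^ (hgt D i (dg g) + 2 * m%:Z) *:
      (piU nu e * piU nu (qadR q (hgt D i (dg g)) e p m)) by exact: piU_qcomm.
move: (piU nu (qadR _ _ _ _ m)) IH => x IH.
have lrmorphB (M : {lrmorphism U -> U}) u v : M (u - v) = M u - M v by exact: rmorphB.
rewrite !lrmorphB !lrmorphZ !lrmorph_mul IH conjL_e.
have -> : kappa ^ (hgt D i (dg g) + 2 * m.+1%:Z) =
    kappa ^ (hgt D i (dg g) + 2 * m%:Z) * kappa ^+ 2.
  by rewrite -[kappa ^+ 2]/(kappa ^ 2%:Z) -expfzDr //; congr (_ ^ _); lia.
rewrite -!scalerAl -!scalerAr !scalerA scalerBr !scalerA.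
by move: (kappa ^+ 2) (kappa ^ _) (q ^ _) => k l r; congr (_ *: _ - _ *: _); ring.
Qed.

(* Inhomogeneous pairs, the second component twisted by l^<b> in weight b. *)
Inductive LiftSpan (l : Qq) : E -> E -> Prop :=
| LiftSpan_hom b x x' : Lift nu form g0 b x x' -> LiftSpan l x (l ^ hgt D i b *: x')
| LiftSpan_add x x' y y' : LiftSpan l x x' -> LiftSpan l y y' -> LiftSpan l (x + y) (x' + y').

Lemma LiftSpan_scale l (k : Qq) x x' : LiftSpan l x x' -> LiftSpan l (k *: x) (k *: x').
Proof.
elim=> {x x'} [b x x' gx|x x' y y' _ IHx _ IHy].
  rewrite scalerA mulrC -scalerA; apply: LiftSpan_hom; exact: Lift_scale.
by rewrite !scalerDr; apply: LiftSpan_add.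
Qed.

Lemma LiftSpan_mul l x x' y y' :
  l != 0 -> LiftSpan l x x' -> LiftSpan l y y' -> LiftSpan l (x * y) (x' * y').
Proof.
move=> l0; elim=> {x x'} [b x x' gx|x x' z z' _ IHx _ IHz] sy; last first.
  by rewrite !mulrDl; apply: LiftSpan_add; [exact: IHx | exact: IHz].
elim: sy => {y y'} [c y y' gy|y y' z z' _ IHy _ IHz]; last first.
  by rewrite !mulrDr; apply: LiftSpan_add.
rewrite -scalerAl -free_scaleAr scalerA -expfzDr // -hgtD.
by apply: LiftSpan_hom; exact: Lift_mul.
Qed.

Lemma LiftSpan_form x x' y y' : LiftSpan 1 x x' -> LiftSpan kappa y y' -> form x' y' = form x y.
Proof.
elim=> {x x'} [b x x' gx|x x' z z' _ IHx _ IHz] sy; last first.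
  by rewrite !(form_addl formP) IHx ?IHz.
elim: sy => {y y'} [c y y' gy|y y' z z' _ IHy _ IHz]; last first.
  by rewrite !(form_addr formP) IHy IHz.
rewrite exp1rz scale1r (form_scaler formP) (form_sym formP) (form_sym formP x).
rewrite (Lift_form formP form_piU lev_g0 re_g0 tau_neq0 gy gx) mulrA -expfzDr //.
by rewrite subrr expr0z mul1r.
Qed.

(** Serves both arguments of the form: L with l = 1 for the first and [conjL] with l = kappa for the
    second, whose twist cancels kappa^(-<b>). *)
Lemma UplusI_LiftSpan l (M : {lrmorphism U -> U}) : l != 0 ->
  (forall (g : Iinf D) p m, val g != (i, 1%N) -> piU nu p = aa g ->
     M (piU nu (qadR q (hgt D i (dg g)) e p m)) =
       l ^ (hgt D i (dg g) + 2 * m%:Z) *: L (piU nu (qadR q (hgt D i (dg g)) e p m))) ->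
  forall x, UplusI aa i x ->
    exists X X', [/\ LiftSpan l X X', piU nu X = x & piU nu X' = M x].
Proof.
move=> l0 ML x; elim=> {x} [x [g [m [gi ->]]]||k x _ [X [X' [sX XE X'E]]]
  |x y _ [X [X' [sX XE X'E]]] _ [Y [Y' [sY YE Y'E]]]
  |x y _ [X [X' [sX XE X'E]]] _ [Y [Y' [sY YE Y'E]]]].
- have Lift00 := LiftSpan_hom l (Lift_zero nu form g0 0).
  have M0 : M 0 = 0 by exact: linear0.
  case: m => [n|n]; last first.
    exists 0, (l ^ hgt D i 0 *: 0); split; [exact: Lift00 | exact: piU0 |].
    by rewrite piUZ piU0 scaler0; exact: esym M0.
  have [p pE pp] := prim_gen_lift g; have gd := root_gen_aa gi pE pp.
  rewrite fI_qadR; have [nN|Nn] := leqP n (Ng g); last first.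
    have top := root_gen_topR gd; rewrite piU_qadR pE in top.
    rewrite (qadR_vanish top Nn) scaler0.
    exists 0, (l ^ hgt D i 0 *: 0); split; [exact: Lift00 | exact: piU0 |].
    by rewrite piUZ piU0 scaler0 M0.
  have sp := LiftSpan_scale (qfact D i n)^-1 (LiftSpan_hom l (Lift_gen gd nN)).
  do 2!eexists; split; first exact: sp.
    by rewrite piUZ piU_qadR pE.
  rewrite lrmorphZ piUZ; congr (_ *: _).
  rewrite piUZ -L_F // -[in RHS]pE -piU_qadR ML //.
  by congr (_ ^ _ *: _); exact: (hgt_wt lev_g0 re_g0).
- exists 1, (l ^ hgt D i 0 *: 1); split; first exact: LiftSpan_hom (Lift_one nu form g0).
    exact: piU1.
  have M1 : M 1 = 1 by exact: rmorph1.
  by rewrite piUZ piU1 M1 /hgt lext0 expr0z scale1r.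
- exists (k *: X), (k *: X'); split; first exact: LiftSpan_scale.
    by rewrite piUZ XE.
  by rewrite piUZ X'E lrmorphZ.
- have piUD u v : piU nu (u + v) = piU nu u + piU nu v.
    by have := piU_linear nu 1 u v; rewrite !scale1r.
  exists (X + Y), (X' + Y'); split; first exact: LiftSpan_add.
    by rewrite piUD XE YE.
  have MD : M (x + y) = M x + M y by exact: rmorphD.
  by rewrite piUD X'E Y'E MD.
- exists (X * Y), (X' * Y'); split; first exact: LiftSpan_mul.
    by rewrite (piUM nu X Y) XE YE.
  by rewrite (piUM nu X' Y') X'E Y'E lrmorph_mul.
Qed.

Lemma omega_UminusI y : UminusI formU omega aa i y -> UplusI aa i (omega y).
Proof.
elim=> {y} [y [g [m [gi ->]]]||k y _ IH|x y _ IHx _ IHy|x y _ IHx _ IHy].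
- case: m => [n|n].
    have [r ->] := omega_gI g n; apply: subalg_scale; apply: subalg_gen.
    by exists g, n%:Z.
  have -> : gI formU omega aa i g (Negz n) = fI aa i g (Negz n) by [].
  have -> : omega (fI aa i g (Negz n)) = fI aa i g (Negz n) by exact: linear0.
  by apply: subalg_gen; exists g, (Negz n).
- have -> : omega 1 = 1 by exact: rmorph1.
  exact: subalg_one.
- by rewrite lrmorphZ; exact: subalg_scale.
- have -> : omega (x + y) = omega x + omega y by exact: rmorphD.
  exact: subalg_add.
- by rewrite lrmorph_mul; exact: subalg_mul.
Qed.

Lemma L_form x y : UplusI aa i x -> UminusI formU omega aa i y ->
  formU (L x) (omega (L y)) = formU x (omega y).
Proof.
move=> hx /omega_UminusI hy.
have L1 (g : Iinf D) p m : val g != (i, 1%N) -> piU nu p = aa g ->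
    L (piU nu (qadR q (hgt D i (dg g)) e p m)) =
      1 ^ (hgt D i (dg g) + 2 * m%:Z) *: L (piU nu (qadR q (hgt D i (dg g)) e p m)).
  by rewrite exp1rz scale1r.
have [X [X' [sX <- <-]]] := UplusI_LiftSpan (oner_neq0 _) L1 hx.
have [Y [Y' [sY YE Y'E]]] := UplusI_LiftSpan kappa0 conjL_qadR hy.
have <- : piU nu Y' = omega (L y) by rewrite Y'E /conjL /= (omega_invol omegaP).
by rewrite -YE !formUP; exact: LiftSpan_form.
Qed.

End Main.

Theorem theorem3p5 (I : countType) (D : BCdatum I)
  (nu : Iinf D -> Qq) (nu_adm : forall g, admissible (nu g))
  (form : freealg (Iinf D) -> freealg (Iinf D) -> Qq)
  (formP : is_form nu form)
  (formU : Uq nu -> Uq nu -> Qq) (formUP : is_descended_form form formU)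
  (omega : {lrmorphism Uq nu -> Uq nu}) (omegaP : is_omega omega)
  (aa : Iinf D -> Uq nu) (aaP : is_prim_gens formU aa)
  (i : I) (i_re : is_re D i)
  (L : {lrmorphism Uq nu -> Uq nu}) (LP : is_L2 formU omega aa i L)
  (x y : Uq nu)
  (hx : UplusI aa i x) (hy : UminusI formU omega aa i y) :
  formU (L x) (omega (L y)) = formU x (omega y).
Proof.
(* The index (i,1) provides e; admissibility of its parameter gives {e, e} != 0, hence kappa !=
   0. *)
have i_in : in_Iinf D (i, 1%N) by rewrite /in_Iinf implybT.
pose g0 : Iinf D := Sub (i, 1%N) i_in.
exact: (@L_form _ _ _ _ formP _ formUP _ omegaP _ aaP g0 erefl i_re
  (admissible_neq0 (nu_adm g0)) L LP).
Qed.
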